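(* Let $\{f_n\}_{n\ge1}\subset\mathcal{LP}$ be a sequence of functions with only negative roots which is admissible with limit data $(c,\Sigma)$ (as defined in the context). If $t\ge0$ and $\{p_n\}_{n\ge1}$ is a sequence of positively-rooted polynomials indexed by their degree such that $[\![p_n]\!]\Rightarrow\mu$ as $n\to\infty$, then $$[\![f_{\lfloor tn\rfloor}(tz\partial_z)p_n(z)]\!]\Rightarrow\mu\boxtimes\tilde\mu_{c,\Sigma}^{\boxtimes t},$$ where $\tilde\mu_{c,\Sigma}$ is the $\boxtimes$-infinitely divisible probability measure on $[0,\infty)$ with $S$-transform $$S_{\tilde\mu_{c,\Sigma}}(z)=\exp\big(-R_{\mu_{c,\Sigma}}(z+1)\big),\qquad z\in(-1,0).$$
   Context: $\mathcal{LP}$ (Laguerre–Pólya class) is the set of real entire functions of the form $f(z)=Cz^me^{-cz-\frac{\sigma^2}{2}z^2}\prod_{j\ge1}(1-\alpha_jz)e^{\alpha_jz}$ with $c,\sigma\in\mathbb R$, $\alpha_j\in\mathbb R$ and $\sum_j\alpha_j^2<\infty$ (the product may have finitely many or no factors). Admissible sequence in $\mathcal{LP}$ with limit data $(c,\Sigma)$: $f_n\in\mathcal{LP}$ has the form $f_n(z)=e^{-c_nz-\frac{\sigma_n^2}{2}z^2}\prod_{j}(1-\alpha_{j,n}z)e^{\alpha_{j,n}z}$, the finite measures $\Sigma_n=n\sigma_n^2\delta_0+\frac1n\sum_j\frac{n^2\alpha_{j,n}^2}{n^2\alpha_{j,n}^2+1}\,\delta_{n\alpha_{j,n}}$ converge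 vaguely, as $n\to\infty$, to a positive finite Borel measure $\Sigma$ on $\mathbb R$, and $\lim_{n\to\infty}\big(c_n-\int x\,d\Sigma_n(x)\big)=c$. For $f(z)=\sum_k\frac{\gamma_k}{k!}z^k$, $f(tz\partial_z)=\sum_k\frac{\gamma_k}{k!}t^k(z\partial_z)^k$ acting on polynomials, i.e. $f(tz\partial_z)z^k=f(tk)z^k$. For a polynomial $p$ of (formal) degree $n$, $[\![p]\!]=\frac1n\sum_{w:p(w)=0}\delta_w$ (roots counted with multiplicity); $\Rightarrow$ is weak convergence; $\mu$ is a probability measure on $[0,\infty)$. $R_{\mu_{c,\Sigma}}(u)=c+\int_{\mathbb R}\frac{u+x}{1-xu}\,d\Sigma(x)$ is the ($R$-transform) function characterizing the probability measure $\mu_{c,\Sigma}$ that is infinitely divisible for the free additive convolution and has Lévy pair $(c,\Sigma)$: with $G(z)=\int\frac{d\mu_{c,\Sigma}(s)}{z-s}$ one has $G(R_{\mu_{c,\Sigma}}(u)+1/u)=u$ for $u$ in a set $\{u:1/u\in\Gamma_{\alpha,\beta}\}$, $\Gamma_{\alpha,\beta}=\{z:\alpha\,\mathrm{Im}\,z>|\mathrm{Re}\,z|,\ \mathrm{Im}\,z>\beta\}$. Since the roots of $f_n$ are negative, $R_{\mu_{c,\Sigma}}$ is analytic on $\mathbb C\setminus(-\infty,0]$. For a probability measure $\mu$ on $[0,\infty)$, $\psi_\mu(z)=\int_0^\infty\frac{uz}{1-uz}\,d\mu(u)$; if $\mu\ne\delta_0$ it has an inverse on a neighborhood of $(-1+\mu(\{0\}),0)$,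 and $S_\mu(z)=\frac{1+z}{z}\psi_\mu^{-1}(z)$ for $z\in(-1+\mu(\{0\}),0)$. For $\mu_1,\mu_2\neq\delta_0$ on $[0,\infty)$, $\mu_1\boxtimes\mu_2$ is the probability measure with $S_{\mu_1\boxtimes\mu_2}=S_{\mu_1}S_{\mu_2}$ on some common interval $(-\varepsilon,0)$ (as usual, $\delta_0\boxtimes\nu=\delta_0$). $\mu^{\boxtimes t}$ is the probability measure with $S$-transform $S_\mu^t$, when it exists; $\mu$ is $\boxtimes$-infinitely divisible if $\mu^{\boxtimes t}$ exists for all $t>0$.
   Formalization: The vague convergence of Σ_n to Σ is taken together with convergence of total masses Σ_n(ℝ)→Σ(ℝ); without it the claim fails, e.g. f_n(z)=(1+z)^n e^{-nz/(n²+1)}, t=1, p_n=(z-1)^n. *)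

(* Defs.v *)
From HB Require Import structures.
From mathcomp Require Import all_boot all_order all_algebra.
From mathcomp Require Import all_classical all_reals all_analysis.
From mathcomp Require Import complex.

Set Implicit Arguments.
Unset Strict Implicit.
Unset Printing Implicit Defensive.

Import Order.TTheory GRing.Theory Num.Theory.
Import numFieldNormedType.Exports.

Local Open Scope classical_set_scope.
Local Open Scope ring_scope.

(* A Laguerre-Polya function normalised by C = 1 and m = 0.  Finite (or empty)
   products are obtained by padding [lp_alpha] with zeros, which contribute
   neither a factor to the function nor mass to [lp_measure] below. *)
Record LPfun (R : realType) := MkLPfun {
  lp_c : R;
  lp_sigma : R;
  lp_alpha : nat -> R;
  lp_summable : cvgn (series (fun j => lp_alpha j ^+ 2))
}.

(* Restriction to the real line of the entire function; all its zeros are real,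
   being the reciprocals of the nonzero [lp_alpha f j]. *)
Definition lp_eval (R : realType) (f : LPfun R) (z : R) : R :=
  expR (- lp_c f * z - lp_sigma f ^+ 2 / 2 * z ^+ 2) *
  limn (fun N => \prod_(j < N) ((1 - lp_alpha f j * z) * expR (lp_alpha f j * z))).

Coercion lp_eval : LPfun >-> Funclass.

Fact variance_ge0 (R : realType) (n : nat) (s : R) : 0 <= n%:R * s ^+ 2.
Proof. by rewrite mulr_ge0 ?sqr_ge0. Qed.

Fact weight_ge0 (R : realType) (x : R) : 0 <= x ^+ 2 / (x ^+ 2 + 1).
Proof. by rewrite divr_ge0 ?addr_ge0 ?sqr_ge0. Qed.

Definition lp_measure (R : realType) (n : nat) (f : LPfun R) :
    {measure set (measurableTypeR R) -> \bar R} :=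
  let x j := n%:R * lp_alpha f j in
  measure_add
    (mscale (NngNum (variance_ge0 n (lp_sigma f))) \d_(0 : measurableTypeR R))
    (mscale (n%:R^-1)%:nng
       (mseries (fun j => mscale (NngNum (weight_ge0 (x j)))
                            \d_(x j : measurableTypeR R)) 0)).

Definition vague_cvg (R : realType)
    (mu_ : nat -> {measure set (measurableTypeR R) -> \bar R})
    (mu : {measure set (measurableTypeR R) -> \bar R}) : Prop :=
  forall g : R -> R, continuous g -> compact (closure [set x | g x != 0]) ->
  Rintegral (mu_ n) setT g @[n --> \oo] --> Rintegral mu setT g.

(* The second clause makes the vague convergence one of finite measures: no mass
   escapes to infinity.  Vague convergence alone does not make (c, Sigma)
   determine the limit: for f_n(z) = (1 + z)^n exp(- n z / (n^2 + 1)) the measures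
   n^2 / (n^2 + 1) delta_{-n} converge vaguely to 0 and the third clause holds
   with c = 0, yet (f_n' / f_n)(n u) tends to 1 / u and not to 0. *)
Definition admissible (R : realType) (f : nat -> LPfun R) (c : R)
    (Sigma : {finite_measure set (measurableTypeR R) -> \bar R}) : Prop :=
  [/\ vague_cvg (fun n => lp_measure n (f n)) Sigma,
      lp_measure n (f n) setT @[n --> \oo] --> Sigma setT &
      lp_c (f n) - Rintegral (lp_measure n (f n)) setT id @[n --> \oo] --> c].

Definition Rtransform (R : realType) (c : R)
    (Sigma : {finite_measure set (measurableTypeR R) -> \bar R}) (u : R) : R :=
  c + Rintegral Sigma setT (fun x => (u + x) / (1 - x * u)).

(* f (s z d/dz) p, acting diagonally on monomials: z^k is mapped to f(s k) z^k. *)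
Definition euler_op (R : realType) (f : R -> R) (s : R) (p : {poly R[i]}) :
    {poly R[i]} :=
  \poly_(k < size p) ((f (s * k%:R))%:C%C * p`_k).

Definition Cborel (R : realType) :=
  g_sigma_algebraType (@open (R[i])^o).

Definition proots (R : realType) (p : {poly R[i]}) : seq R[i] :=
  sval (closed_field_poly_normal p).

(* [n] is the formal degree of [p]. *)
Definition root_measure (R : realType) (n : nat) (p : {poly R[i]}) :
    {measure set (Cborel R) -> \bar R} :=
  mscale (n%:R^-1 : R)%:nng
    (msum (fun j => \d_((proots p)`_j : Cborel R)) (size (proots p))).

(* Weak convergence of measures on C to the image of [mu] under the inclusion
   of R in C. *)
Definition weak_cvg (R : realType)
    (nu_ : nat -> {measure set (Cborel R) -> \bar R})
    (mu : probability (measurableTypeR R) R) : Prop :=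
  forall g : (R[i])^o -> R, continuous g -> (exists M, forall z, `|g z| <= M) ->
  Rintegral (nu_ n) setT g @[n --> \oo] -->
    Rintegral mu setT (fun x => g (x%:C%C)).

Definition on_nonneg (R : realType) (mu : probability (measurableTypeR R) R) :=
  mu [set x : R | 0 <= x] = 1%E.

Definition is_delta0 (R : realType) (mu : probability (measurableTypeR R) R) :=
  forall A : set (measurableTypeR R), measurable A -> mu A = \d_(0 : R) A.

Definition psi (R : realType) (mu : probability (measurableTypeR R) R) (z : R) : R :=
  Rintegral mu [set u : R | 0 <= u] (fun u => u * z / (1 - u * z)).

(* On negative reals [psi mu] is an increasing bijection onto
   ]-1 + mu {0}, 0[ when mu <> delta_0; elsewhere the default value 0 is
   returned, so that [Stransform mu] vanishes off that interval. *)
Definition psi_inv (R : realType) (mu : probability (measurableTypeR R) R) (z : R) : R :=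
  xget 0 [set w : R | w < 0 /\ psi mu w = z].

Definition Stransform (R : realType) (mu : probability (measurableTypeR R) R) (z : R) : R :=
  (1 + z) / z * psi_inv mu z.

Definition is_boxtimes (R : realType)
    (mu1 mu2 nu : probability (measurableTypeR R) R) : Prop :=
  on_nonneg nu /\
  ((is_delta0 mu1 \/ is_delta0 mu2) /\ is_delta0 nu \/
   [/\ ~ is_delta0 mu1, ~ is_delta0 mu2, ~ is_delta0 nu &
    exists2 e : R, 0 < e & forall z, - e < z < 0 ->
      Stransform nu z = Stransform mu1 z * Stransform mu2 z]).

(* nu is the power of mu of exponent t for the free multiplicative convolution;
   the identity is required wherever both S-transforms are defined. *)
Definition is_boxpow (R : realType) (mu : probability (measurableTypeR R) R)
    (t : R) (nu : probability (measurableTypeR R) R) : Prop :=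
  [/\ on_nonneg nu, ~ is_delta0 mu, ~ is_delta0 nu &
   forall z, -1 + fine (mu [set 0]) < z -> -1 + fine (nu [set 0]) < z -> z < 0 ->
     Stransform nu z = Stransform mu z `^ t].

Definition boxtimes_inf_div (R : realType)
    (mu : probability (measurableTypeR R) R) : Prop :=
  forall t : R, 0 < t -> exists nu, is_boxpow mu t nu.

Definition is_tilde_mu (R : realType) (c : R)
    (Sigma : {finite_measure set (measurableTypeR R) -> \bar R})
    (m : probability (measurableTypeR R) R) : Prop :=
  [/\ on_nonneg m, boxtimes_inf_div m &
   forall z, -1 < z < 0 -> Stransform m z = expR (- Rtransform c Sigma (z + 1))].

(* Main.v *)
(* For a measure mu on the half-line put h_mu(x) = int x / (x + r) dmu(r).  Then
   psi_mu (- 1 / x) = h_mu(x) - 1, so S_mu(u - 1) = u / ((1 - u) x) when u = h_mu(x),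
   and the claimed limit nu is characterised by h_nu(x exp(t R(u))) = u for every
   x > 0 and u = h_mu(x).

   If p has degree n and roots r_j > 0, let e_k be the coefficients of prod_j (z + r_j):
   the average of x / (x + r_j) is the mean of k / n for the weights e_k x^k.  These
   are log-concave, so up to an error bounded independently of n the mean is the
   index k where e_k x^k stops increasing.  The operator multiplies e_k by f_m(t k),
   m = floor(tn), which multiplies the ratio of consecutive weights near k = u n by
   f_m(t (k + 1)) / f_m(t k) = exp(- t R(u) + o(1)), because f_m' / f_m at m u tends
   to - R(u).  Rescaling x by exp(t R(u)) therefore restores the mean u.

   Positivity of the new roots is Laguerre's theorem: f is a limit of products of
   factors 1 + b z with b >= 0, and all roots of p + b z p' are positive.

   To pass from the functions h to weak convergence, a partial fraction argument and
   a limit give the powers of x / (x + r), hence all polynomials in it; Weierstrass'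
   theorem gives the rest.  To construct nu, and the powers of the measure with
   S-transform exp(- R(z + 1)), which arise from p_n = (z - 1)^n, take the limit of
   the quantile functions of the roots along an ultrafilter. *)
Require Import Defs.
From mathcomp Require Import all_boot all_order all_algebra.
From mathcomp Require Import all_classical all_reals all_analysis.
From mathcomp Require Import measurable_realfun complex ring lra.
Set Implicit Arguments.
Unset Strict Implicit.
Unset Printing Implicit Defensive.
Import Order.TTheory GRing.Theory Num.Theory.
Import numFieldNormedType.Exports.
Local Open Scope classical_set_scope.
Local Open Scope ring_scope.

(** * Mean index of a log-concave sequence *)

(** Everything runs through averages of x / (x + r) at real x > 0. Logarithmic derivatives occur
    only as the explicit series [lp_drift], and Hurwitz' theorem is replaced by a lower bound on
    moduli. The peak of the weights e_k x^k is never located exactly: replacing x by a^2 x or x /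
    a^2 with a fixed a > 1 turns an inequality between two consecutive weights into an estimate of
    the mean index with error (a - 1)^-2. Divided by n this error vanishes, and continuity of h_mu
    allows a to be chosen close to 1. The ratios f_m(t (k + 1)) / f_m(t k) have to be controlled for
    all k on one side of u n at once; concavity of log f on the half-line reduces this to a single
    value of the drift. The S-transform identity that defines nu is given only on an interval ending
    at 0, so h_nu is known only for large arguments. The passage to weak convergence therefore
    starts from averages beyond an arbitrary threshold. When nu is constructed, no mass escapes to
    infinity because h_mu(x) tends to 1 as x grows. *)

Definition epoly (R : realType) (rs : seq R) : {poly R} :=
  \prod_(r <- rs) ('X + r%:P).

Definition hsum (R : realType) (rs : seq R) (x : R) : R :=
  \sum_(r <- rs) x / (x + r).

Lemma epoly_cons (R : realType) (r : R) rs :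
  epoly (r :: rs) = ('X + r%:P) * epoly rs.
Proof. by rewrite /epoly big_cons. Qed.

Lemma coef_epoly_consS (R : realType) (r : R) rs k :
  (epoly (r :: rs))`_k.+1 = (epoly rs)`_k + r * (epoly rs)`_k.+1.
Proof. by rewrite epoly_cons mulrDl coefD coefXM coefCM. Qed.

Lemma coef_epoly_cons0 (R : realType) (r : R) rs :
  (epoly (r :: rs))`_0 = r * (epoly rs)`_0.
Proof. by rewrite epoly_cons mulrDl coefD coefXM coefCM add0r. Qed.

Lemma size_epoly (R : realType) (rs : seq R) : size (epoly rs) = (size rs).+1.
Proof.
elim: rs => [|r rs IH]; first by rewrite /epoly big_nil size_poly1.
by rewrite epoly_cons size_monicM ?monicXaddC ?size_XaddC ?IH // -size_poly_eq0 IH.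
Qed.

Lemma epoly_ge0 (R : realType) (rs : seq R) k :
  {in rs, forall r, 0 < r} -> 0 <= (epoly rs)`_k.
Proof.
elim: rs k => [|r rs IH] k rs0.
  by rewrite /epoly big_nil coef1; case: (k == 0).
have r0 : 0 <= r by rewrite ltW // rs0 // mem_head.
have IH' j : 0 <= (epoly rs)`_j by apply: IH => s ss; rewrite rs0 // in_cons ss orbT.
case: k => [|k]; first by rewrite coef_epoly_cons0 mulr_ge0.
by rewrite coef_epoly_consS addr_ge0 // mulr_ge0.
Qed.

Lemma epoly_gt0 (R : realType) (rs : seq R) k :
  {in rs, forall r, 0 < r} -> (k <= size rs)%N -> 0 < (epoly rs)`_k.
Proof.
elim: rs k => [|r rs IH] k rs0.
  by rewrite leqn0 => /eqP ->; rewrite /epoly big_nil coef1.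
have r0 : 0 < r by rewrite rs0 // mem_head.
have rs0' : {in rs, forall r, 0 < r} by move=> s ss; rewrite rs0 // in_cons ss orbT.
case: k => [|k] kn; first by rewrite coef_epoly_cons0 mulr_gt0 // IH.
by rewrite coef_epoly_consS ltr_pwDl // ?IH // mulr_ge0 ?epoly_ge0 // ltW.
Qed.

(** Induction on the roots: a new root r makes the difference of the two sides a polynomial in r
    with nonnegative coefficients. For i > 0 these are minors of the old sequence, and the
    coefficient of r is a sum of two of them with different gaps j - i. This is why the statement
    covers all i <= j and not only i = j - 1. *)
Lemma epoly_logconcave (R : realType) (rs : seq R) i j :
  {in rs, forall r, 0 < r} -> (i <= j)%N ->
  (epoly rs)`_i * (epoly rs)`_j.+1 <= (epoly rs)`_i.+1 * (epoly rs)`_j.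
Proof.
elim: rs i j => [|r rs IH] i j rs0.
  by move=> _; rewrite /epoly big_nil !coef1 mulr0 mul0r.
have r0 : 0 < r by rewrite rs0 // mem_head.
have rs0' : {in rs, forall r, 0 < r} by move=> s ss; rewrite rs0 // in_cons ss orbT.
have {}IH k l := IH k l rs0'.
have E0 k : 0 <= (epoly rs)`_k by exact: epoly_ge0.
rewrite leq_eqVlt => /predU1P[->|]; first by rewrite mulrC.
case: j => // j; rewrite ltnS => ij.
rewrite !coef_epoly_consS.
have := IH i j ij; have := IH i j.+1 (leqW ij).
case: i ij => [|i] ij.
  rewrite coef_epoly_cons0; have := E0 j; have := E0 0%N; have := E0 1%N.
  move: (epoly rs)`_0 (epoly rs)`_1 (epoly rs)`_j (epoly rs)`_j.+1 (epoly rs)`_j.+2 =>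
     e0 e1 ej ej1 ej2 h1 h0 hj H1 H2.
  rewrite -subr_ge0.
  have -> : (e0 + r * e1) * (ej + r * ej1) - r * e0 * (ej1 + r * ej2) =
    e0 * ej + r * (e1 * ej) + r ^+ 2 * (e1 * ej1 - e0 * ej2) by ring.
  by rewrite !addr_ge0 ?mulr_ge0 ?sqr_ge0 ?subr_ge0 // ltW.
rewrite coef_epoly_consS.
have := IH i j (ltnW ij); have := IH i j.+1 (leqW (ltnW ij)).
move: (epoly rs)`_i (epoly rs)`_i.+1 (epoly rs)`_i.+2
  (epoly rs)`_j (epoly rs)`_j.+1 (epoly rs)`_j.+2 =>
  a0 a1 a2 b0 b1 b2 H1 H2 H3 H4.
rewrite -subr_ge0.
have -> : (a1 + r * a2) * (b0 + r * b1) - (a0 + r * a1) * (b1 + r * b2) =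
  (a1 * b0 - a0 * b1) + r * (a2 * b0 - a0 * b2) + r ^+ 2 * (a2 * b1 - a1 * b2) by ring.
have rge0 := ltW r0.
have H5 : a0 * b2 <= a2 * b0 by exact: le_trans H1 H4.
apply: addr_ge0; first apply: addr_ge0.
- by rewrite subr_ge0.
- by rewrite mulr_ge0 // subr_ge0.
- by rewrite mulr_ge0 ?sqr_ge0 // subr_ge0.
Qed.

Lemma hornerX_deriv (R : realType) (p : {poly R}) x :
  x * p^`().[x] = \sum_(i < size p) i%:R * (p`_i * x ^+ i).
Proof.
rewrite /deriv horner_poly mulr_sumr.
case: (size p) => [|n] /=; first by rewrite !big_ord0.
rewrite big_ord_recl mul0r add0r; apply: eq_bigr => i _.
by rewrite lift0 exprS -mulr_natl; ring.
Qed.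

Lemma hsum_deriv (R : realType) (rs : seq R) x :
  {in rs, forall r, 0 < r} -> 0 < x ->
  x * (epoly rs)^`().[x] = hsum rs x * (epoly rs).[x].
Proof.
move=> + x0; elim: rs => [|r rs IH] rs0.
  by rewrite /epoly /hsum !big_nil derivC horner0 mulr0 mul0r.
have r0 : 0 < r by rewrite rs0 // mem_head.
have xr : x + r != 0 by rewrite gt_eqF // addr_gt0.
rewrite epoly_cons derivM derivD derivX derivC addr0 mul1r.
rewrite hornerD !hornerM hornerD hornerX hornerC mulrDr.
rewrite [x * (_ * _)]mulrCA IH; last by move=> s ss; rewrite rs0 // in_cons ss orbT.
by rewrite /hsum big_cons; field.
Qed.

Lemma hsum_mean (R : realType) (rs : seq R) x :
  {in rs, forall r, 0 < r} -> 0 < x ->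
  \sum_(i < (size rs).+1) i%:R * ((epoly rs)`_i * x ^+ i) =
  hsum rs x * \sum_(i < (size rs).+1) (epoly rs)`_i * x ^+ i.
Proof.
move=> rs0 x0; rewrite -size_epoly -hornerX_deriv hsum_deriv //.
by rewrite -horner_coef.
Qed.

Lemma geometric_tail (R : realType) (a : R) k : 1 < a ->
  \sum_(j < k) a^-1 ^+ (k - j) <= (a - 1)^-1.
Proof.
move=> a1; have a0 : 0 < a by lra.
elim: k => [|k IH]; first by rewrite big_ord0 invr_ge0; lra.
rewrite big_ord_recr /= subSnn expr1.
under eq_bigr => i _ do rewrite subSn ?(ltnW (ltn_ord i)) // exprS.
rewrite -mulr_sumr.
apply: (@le_trans _ _ (a^-1 * (a - 1)^-1 + a^-1)).
  by rewrite lerD2r ler_pM2l ?invr_gt0.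
rewrite le_eqVlt; apply/predU1P; left.
by field; rewrite !gt_eqF //; lra.
Qed.

(* [i / a^(2i) <= a^-i / (a - 1)], because [a^i >= i (a - 1)]. *)
Lemma linear_geometric (R : realType) (a : R) i : 1 < a ->
  i%:R * (a ^+ (2 * i))^-1 <= a^-1 ^+ i * (a - 1)^-1.
Proof.
move=> a1; have a0 : 0 < a by lra.
have ai : i%:R * (a - 1) <= a ^+ i.
  elim: i => [|i IH]; first by rewrite mul0r.
  rewrite exprS -natr1.
  have : 1 <= a ^+ i by rewrite exprn_ege1 // ltW.
  by nra.
have p0 : 0 < a ^+ i by rewrite exprn_gt0.
have q0 : 0 < a - 1 by lra.
rewrite exprVn mulnC exprM expr2 invfM mulrA [leRHS]mulrC ler_pM2r ?invr_gt0 //.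
by rewrite ler_pdivrMr // mulrC ler_pdivlMr.
Qed.

(** Indices j > k contribute nonpositive terms. Below k, the linear factor k - j absorbs half of the
    decay a^(-2(k - j)) at the cost of 1 / (a - 1), and summing the other half costs 1 / (a - 1)
    again. *)
Lemma geometric_below (R : realType) (W : nat -> R) (a : R) N k :
  1 < a -> (k <= N)%N -> (forall j, 0 <= W j) ->
  (forall j, (j < k)%N -> W j * a ^+ (2 * (k - j)) <= W k) ->
  \sum_(j < N.+1) (k%:R - j%:R) * W j <= (a - 1) ^- 2 * \sum_(j < N.+1) W j.
Proof.
move=> a1 kN W0 Wk; have a0 : 0 < a by lra.
have b0 : 0 < a - 1 by lra.
apply: (@le_trans _ _ (\sum_(j < k) (k - j)%:R * W j)).
  rewrite -(big_mkord xpredT (fun j => (k%:R - j%:R) * W j)).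
  rewrite (big_cat_nat (n := k)) //=; last exact: leqW.
  rewrite -[leRHS]addr0 lerD //.
    rewrite big_mkord le_eqVlt; apply/predU1P; left.
    by apply: eq_bigr => i _; rewrite natrB // ltnW.
  rewrite big_nat_cond; apply: sumr_le0 => i /andP[/andP[ki _] _].
  by rewrite mulr_le0_ge0 // subr_le0 ler_nat.
apply: (@le_trans _ _ (\sum_(j < k) a^-1 ^+ (k - j) * ((a - 1)^-1 * W k))).
  apply: ler_sum => j _.
  have := Wk j (ltn_ord j); rewrite -ler_pdivlMr ?exprn_gt0 // => Wj.
  apply: (@le_trans _ _ ((k - j)%:R * (W k / a ^+ (2 * (k - j))))).
    by rewrite ler_wpM2l.
  rewrite mulrCA mulrA [leRHS]mulrA [leRHS]mulrC -mulrA.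
  by rewrite ler_wpM2l // linear_geometric.
rewrite -mulr_suml expr2 invfM -mulrA.
apply: (@le_trans _ _ ((a - 1)^-1 * ((a - 1)^-1 * W k))).
  by rewrite ler_wpM2r ?geometric_tail // mulr_ge0 // ltW // invr_gt0.
rewrite ler_pM2l ?invr_gt0 // ler_pM2l ?invr_gt0 //.
have kN' : (k < N.+1)%N by [].
by rewrite (bigD1 (Ordinal kN')) //= lerDl sumr_ge0.
Qed.

(** Follows from [geometric_below] by the reflection j -> N - j. *)
Lemma geometric_above (R : realType) (W : nat -> R) (a : R) N k :
  1 < a -> (k <= N)%N -> (forall j, 0 <= W j) ->
  (forall j, (k < j <= N)%N -> W j * a ^+ (2 * (j - k)) <= W k) ->
  \sum_(j < N.+1) (j%:R - k%:R) * W j <= (a - 1) ^- 2 * \sum_(j < N.+1) W j.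
Proof.
move=> a1 kN W0 Wk.
have := @geometric_below _ (fun j => W (N - j)%N) a N (N - k) a1 (leq_subr _ _)
  (fun j => W0 _).
rewrite (reindex_inj rev_ord_inj) /=.
have iN (i : 'I_N.+1) : (i <= N)%N by rewrite -ltnS.
under eq_bigr => i _.
  rewrite subSS subKn // !natrB //.
  have -> : N%:R - k%:R - (N%:R - i%:R) = i%:R - k%:R :> R by ring.
  over.
rewrite [X in (_ -> _ <= _ * X) -> _](reindex_inj rev_ord_inj) /=.
under [X in (_ -> _ <= _ * X) -> _]eq_bigr => i _ do rewrite subSS subKn //.
apply => j jk; rewrite subKn //.
have jN : (j <= N)%N by rewrite (leq_trans (ltnW jk)) // leq_subr.
rewrite (_ : N - k - j = N - j - k)%N; last by rewrite subnAC.
apply: Wk; rewrite leq_subr andbT ltn_subRL addnC -ltn_subRL //.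
Qed.

(* Multiplying [x] by [a ^+ 2] makes the weights below [k.+1] decay geometrically
   away from [k.+1], so that the mean of the index exceeds [k.+1 - (a - 1) ^- 2]. *)
Lemma hsum_tilt_ge (R : realType) (rs : seq R) (x a : R) k :
  {in rs, forall r, 0 < r} -> 0 < x -> 1 < a -> (k < size rs)%N ->
  (epoly rs)`_k <= (epoly rs)`_k.+1 * x ->
  k.+1%:R - (a - 1) ^- 2 <= hsum rs (a ^+ 2 * x).
Proof.
move=> rs0 x0 a1 kn kx; have a0 : 0 < a by lra.
have y0 : 0 < a ^+ 2 * x by rewrite mulr_gt0 // exprn_gt0.
have Ek0 : 0 < (epoly rs)`_k.+1 by apply: epoly_gt0.
(* Log-concavity carries the increase at k down to all smaller indices. *)
have step i : (i <= k)%N -> (epoly rs)`_i <= (epoly rs)`_i.+1 * x.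
  move=> ik; rewrite -(ler_pM2r Ek0) (le_trans (epoly_logconcave rs0 ik)) //.
  by rewrite -mulrA [x * _]mulrC ler_wpM2l // epoly_ge0.
have mono i : (i <= k.+1)%N ->
    (epoly rs)`_i * x ^+ i <= (epoly rs)`_k.+1 * x ^+ k.+1.
  move=> ik; rewrite -(subKn ik).
  elim: (k.+1 - i)%N (leq_subr i k.+1) => [|d IH] dk; first by rewrite subn0.
  apply: le_trans (IH (ltnW dk)).
  rewrite -(subnSK dk) exprSr mulrA [leRHS]mulrAC ler_wpM2r ?exprn_ge0 ?(ltW x0) //.
  by apply: step; rewrite subSS leq_subr.
have := @geometric_below _ (fun j => (epoly rs)`_j * (a ^+ 2 * x) ^+ j) a
  (size rs) k.+1 a1 kn.
have S0 : 0 < \sum_(j < (size rs).+1) (epoly rs)`_j * (a ^+ 2 * x) ^+ j.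
  rewrite big_ord_recl /= expr0 mulr1 ltr_pwDl ?epoly_gt0 // sumr_ge0 // => i _.
  by rewrite mulr_ge0 ?exprn_ge0 ?epoly_ge0 // ltW.
under eq_bigr => i _ do rewrite mulrBl.
rewrite sumrB -mulr_sumr hsum_mean // -mulrBl ler_pM2r // => H.
suff : k.+1%:R - hsum rs (a ^+ 2 * x) <= (a - 1) ^- 2 by lra.
apply: H => [j|j jk].
  by rewrite mulr_ge0 ?exprn_ge0 ?epoly_ge0 // ltW.
have a2 : 0 < a ^+ 2 by rewrite exprn_gt0.
rewrite exprM; move: (a ^+ 2) a2 => b b0; rewrite !exprMn.
have -> : (epoly rs)`_j * (b ^+ j * x ^+ j) * b ^+ (k.+1 - j) =
    b ^+ k.+1 * ((epoly rs)`_j * x ^+ j).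
  by rewrite -[in RHS](subnKC (ltnW jk)) exprD; ring.
by rewrite [leRHS]mulrCA ler_pM2l ?exprn_gt0 // mono // ltnW.
Qed.

(** Mirror image of [hsum_tilt_ge]: dividing x by a^2 makes the weights above k decay
    geometrically. *)
Lemma hsum_tilt_le (R : realType) (rs : seq R) (x a : R) k :
  {in rs, forall r, 0 < r} -> 0 < x -> 1 < a -> (k < size rs)%N ->
  (epoly rs)`_k.+1 * x <= (epoly rs)`_k ->
  hsum rs (x / a ^+ 2) <= k%:R + (a - 1) ^- 2.
Proof.
move=> rs0 x0 a1 kn kx; have a0 : 0 < a by lra.
have y0 : 0 < x / a ^+ 2 by rewrite divr_gt0 // exprn_gt0.
have Ek0 : 0 < (epoly rs)`_k by apply: epoly_gt0 => //; exact: ltnW.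
have step i : (k <= i)%N -> (epoly rs)`_i.+1 * x <= (epoly rs)`_i.
  move=> ik; rewrite -(ler_pM2l Ek0) mulrA.
  apply: (@le_trans _ _ ((epoly rs)`_k.+1 * (epoly rs)`_i * x)).
    by rewrite ler_wpM2r ?(ltW x0) // epoly_logconcave.
  by rewrite mulrAC ler_wpM2r // epoly_ge0.
have mono d : (epoly rs)`_(k + d) * x ^+ (k + d) <= (epoly rs)`_k * x ^+ k.
  elim: d => [|d IH]; first by rewrite addn0.
  apply: le_trans IH; rewrite addnS exprS mulrA ler_wpM2r ?exprn_ge0 ?(ltW x0) //.
  by apply: step; rewrite leq_addr.
have := @geometric_above _ (fun j => (epoly rs)`_j * (x / a ^+ 2) ^+ j) a
  (size rs) k a1 (ltnW kn).
have S0 : 0 < \sum_(j < (size rs).+1) (epoly rs)`_j * (x / a ^+ 2) ^+ j.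
  rewrite big_ord_recl /= expr0 mulr1 ltr_pwDl ?epoly_gt0 // sumr_ge0 // => i _.
  by rewrite mulr_ge0 ?exprn_ge0 ?epoly_ge0 // ltW.
under eq_bigr => i _ do rewrite mulrBl.
rewrite sumrB -mulr_sumr hsum_mean // -mulrBl ler_pM2r // => H.
suff : hsum rs (x / a ^+ 2) - k%:R <= (a - 1) ^- 2 by lra.
apply: H => [j|j /andP[jk _]].
  by rewrite mulr_ge0 ?exprn_ge0 ?epoly_ge0 // ltW.
rewrite -(subnKC (ltnW jk)); set d := (j - k)%N.
have a2 : 0 < a ^+ 2 by rewrite exprn_gt0.
rewrite exprM addKn; move: (a ^+ 2) a2 => b b0; rewrite !expr_div_n.
rewrite [leRHS]mulrA ler_pdivlMr ?exprn_gt0 //.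
have p1 : b ^+ k != 0 by rewrite gt_eqF // exprn_gt0.
have p2 : b ^+ d != 0 by rewrite gt_eqF // exprn_gt0.
rewrite [X in X <= _](_ : _ = (epoly rs)`_(k + d) * x ^+ (k + d)) //.
by rewrite !exprD; field; rewrite p1 p2.
Qed.

(** * Multipliers preserving positive roots *)

(** In the order of [R[i]], [0 < w] says that w is real and positive. *)
Definition posrooted (R : realType) (p : {poly R[i]}) : Prop :=
  p != 0 /\ forall w : R[i], root p w -> 0 < w.

(** The squared modulus, kept in R and polynomial in the coordinates. *)
Definition nsq (R : realType) (z : R[i]) : R := complex.Re z ^+ 2 + complex.Im z ^+ 2.

Lemma nsqM (R : realType) (z w : R[i]) : nsq (z * w) = nsq z * nsq w.
Proof. by case: z w => a b [c d]; rewrite /nsq /=; ring. Qed.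

Lemma nsq_ge0 (R : realType) (z : R[i]) : 0 <= nsq z.
Proof. by rewrite addr_ge0 ?sqr_ge0. Qed.

Lemma nsq_gt0 (R : realType) (z : R[i]) : z != 0 -> 0 < nsq z.
Proof.
case: z => a b; rewrite /nsq /= eq_complex /= negb_and => ab.
rewrite lt_neqAle addr_ge0 ?sqr_ge0 // andbT eq_sym paddr_eq0 ?sqr_ge0 //.
by rewrite !sqrf_eq0 negb_and.
Qed.

Definition rpoly (R : realType) (rs : seq R) : {poly R[i]} :=
  \prod_(r <- rs) ('X - r%:C%C%:P).

Lemma posrootedP (R : realType) (p : {poly R[i]}) : posrooted p ->
  exists2 rs : seq R, {in rs, forall r, 0 < r} &
    proots p = [seq r%:C%C | r <- rs] /\ p = lead_coef p *: rpoly rs.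
Proof.
move=> [p0 pos].
have pE : p = lead_coef p *: \prod_(z <- proots p) ('X - z%:P).
  by rewrite /proots; case: closed_field_poly_normal.
have rt z : z \in proots p -> 0 < z.
  move=> zr; apply: pos; rewrite pE rootZ ?lead_coef_eq0 //.
  by rewrite root_prod_XsubC.
exists [seq complex.Re z | z <- proots p].
  by move=> _ /mapP[z zr ->]; move/rt: zr; rewrite ltcE => /andP[].
have E : proots p = [seq r%:C%C | r <- [seq complex.Re z | z <- proots p]].
  rewrite -map_comp -[LHS]map_id; apply/eq_in_map => z /rt z0 /=.
  by rewrite RRe_real // realE ltW.
split; first exact: E.
rewrite [LHS]pE; congr (_ *: _).
by rewrite {1}E /rpoly !big_map.
Qed.

Lemma size_rpoly (R : realType) (rs : seq R) : size (rpoly rs) = (size rs).+1.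
Proof. by rewrite /rpoly size_prod_XsubC. Qed.

(** Passes from the roots r to the polynomial with roots - r, whose coefficients are positive; the
    signs cancel when two polynomials of equal degree are compared. *)
Lemma coef_rpoly (R : realType) (rs : seq R) k :
  (rpoly rs)`_k = ((-1) ^+ (size rs + k) * (epoly rs)`_k)%:C%C.
Proof.
elim: rs k => [|r rs IH] k.
  rewrite /rpoly /epoly !big_nil !coef1 add0n.
  by case: k => [|k]; rewrite /= ?mulr0 ?rmorph0 // expr0 mulr1.
rewrite /rpoly big_cons -/(rpoly rs) mulrBl coefB coefXM coefCM.
case: k => [|k] /=; rewrite !IH ?coef_epoly_cons0 ?coef_epoly_consS.
  by rewrite sub0r -rmorphM -rmorphN !addn0 exprS; congr (_%:C%C); ring.
rewrite -rmorphM -rmorphB !addSn !addnS !exprS; congr (_%:C%C).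
by ring.
Qed.

Definition mulop (R : realType) (m : nat -> R) (p : {poly R[i]}) : {poly R[i]} :=
  \poly_(k < size p) ((m k)%:C%C * p`_k).

Lemma coef_mulop (R : realType) (m : nat -> R) p k :
  (mulop m p)`_k = (m k)%:C%C * p`_k.
Proof.
rewrite coef_poly; case: ltnP => // kp.
by rewrite (nth_default _ kp) mulr0.
Qed.

Lemma size_mulop (R : realType) (m : nat -> R) p :
  (forall k, 0 < m k) -> size (mulop m p) = size p.
Proof.
move=> m0; have [->|p0] := eqVneq p 0.
  by rewrite /mulop size_poly0 poly_def big_ord0 size_poly0.
rewrite size_poly_eq // mulf_neq0 //; last by rewrite -lead_coefE lead_coef_eq0.
by rewrite eq_complex /= gt_eqF.
Qed.

Lemma horner_mulop (R : realType) (m : nat -> R) p w :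
  (mulop m p).[w] = \sum_(k < size p) (m k)%:C%C * (p`_k * w ^+ k).
Proof. by rewrite horner_poly; apply: eq_bigr => k _; rewrite mulrA. Qed.

(** Positivity of the multipliers keeps the degree and keeps 0 from becoming a root. *)
Definition preserving (R : realType) (m : nat -> R) : Prop :=
  (forall k, 0 < m k) /\ (forall p, posrooted p -> posrooted (mulop m p)).

Lemma preservingM (R : realType) (m1 m2 : nat -> R) :
  preserving m1 -> preserving m2 -> preserving (fun k => m1 k * m2 k).
Proof.
move=> [m10 m1p] [m20 m2p]; split=> [k|p pp]; first by rewrite mulr_gt0.
suff -> : mulop (fun k => m1 k * m2 k) p = mulop m1 (mulop m2 p) by auto.
by apply/polyP => k; rewrite !coef_mulop mulrA rmorphM.
Qed.

Lemma preserving1 (R : realType) : preserving (fun _ => 1 : R).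
Proof.
split=> // p; suff -> : mulop (fun=> 1) p = p by [].
by apply/polyP => k; rewrite coef_mulop mul1r.
Qed.

Lemma preserving_prod (R : realType) (m : nat -> nat -> R) N :
  (forall j, preserving (m j)) -> preserving (fun k => \prod_(j < N) m j k).
Proof.
move=> mp; elim: N => [|N IH].
  by under eq_fun do rewrite big_ord0; exact: preserving1.
under eq_fun do rewrite big_ord_recr /=.
exact: preservingM.
Qed.

Lemma preserving_scale (R : realType) (a : R) :
  0 < a -> preserving (fun k => a ^+ k).
Proof.
move=> a0; split=> [k|p [p0 pos]]; first by rewrite exprn_gt0.
have sz : size (mulop (fun k => a ^+ k) p) = size p.
  by apply: size_mulop => k; rewrite exprn_gt0.
split=> [|w rw]; first by rewrite -size_poly_eq0 sz size_poly_eq0.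
have a0' : 0 < a%:C%C :> R[i] by rewrite ltcR.
rewrite -(pmulr_rgt0 _ a0'); apply: pos; move: rw.
rewrite /root horner_mulop horner_coef.
under eq_bigr => k _ do rewrite rmorphXn mulrCA -exprMn.
by [].
Qed.

Lemma Im_ratio (R : realType) (w : R[i]) (r : R) :
  complex.Im (w / (w - r%:C%C)) = - r * complex.Im w / nsq (w - r%:C%C).
Proof. by case: w => x y; rewrite /nsq /=; ring. Qed.

Lemma Re_ratio (R : realType) (w : R[i]) (r : R) :
  complex.Re (w / (w - r%:C%C)) = (nsq w - r * complex.Re w) / nsq (w - r%:C%C).
Proof. by case: w => x y; rewrite /nsq /=; ring. Qed.

Lemma rpoly_deriv (R : realType) (rs : seq R) (w : R[i]) :
  ~~ root (rpoly rs) w ->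
  w * (rpoly rs)^`().[w] = (\sum_(r <- rs) w / (w - r%:C%C)) * (rpoly rs).[w].
Proof.
elim: rs => [|r rs IH]; first by rewrite /rpoly !big_nil derivC horner0 mulr0 mul0r.
rewrite /rpoly !big_cons -/(rpoly rs) rootM negb_or root_XsubC => /andP[wr nr].
rewrite derivM derivXsubC mul1r hornerD !hornerM hornerXsubC mulrDr.
rewrite [w * (_ * (rpoly rs)^`().[w])]mulrCA IH //.
by rewrite [RHS]mulrA [in RHS]mulrDl divfK ?subr_eq0 //; ring.
Qed.

(* A root [w] of [p + b z p'] satisfies [1 + b \sum w / (w - r) = 0].  Off the real
   line all the terms have imaginary parts of the same sign; on the negative real
   axis they are all nonnegative. *)
Lemma preserving_linear (R : realType) (b : R) :
  0 <= b -> preserving (fun k => 1 + b * k%:R).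
Proof.
move=> b0; have m0 k : 0 < 1 + b * k%:R by rewrite ltr_pwDl // mulr_ge0.
split=> // p pp; have [p0 pos] := pp.
split=> [|w]; first by rewrite -size_poly_eq0 size_mulop // size_poly_eq0.
have [|nr] := boolP (root p w); first by move=> /pos.
have [rs rs0 [_ pE]] := posrootedP pp.
have -> : mulop (fun k => 1 + b * k%:R) p = p + b%:C%C *: ('X * p^`()).
  apply/polyP => k; rewrite coef_mulop coefD coefZ coefXM coef_deriv.
  case: k => [|k] /=; first by rewrite mulr0 addr0 mul1r mulr0 addr0.
  have -> : (1 + b * k.+1%:R)%:C%C = 1 + b%:C%C * k.+1%:R :> R[i].
    by rewrite rmorphD rmorphM rmorph1 /= rmorph_nat.
  by rewrite mulrDl mul1r -mulrA mulr_natl.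
rewrite /root hornerD hornerZ hornerM hornerX pE derivZ !hornerZ.
have l0 : lead_coef p != 0 by rewrite lead_coef_eq0.
have nr' : ~~ root (rpoly rs) w by move: nr; rewrite {1}pE rootZ.
rewrite [w * (_ * (rpoly rs)^`().[w])]mulrCA rpoly_deriv // [b%:C%C * _]mulrCA -mulrDr mulrA.
rewrite -[X in _ * (X + _)]mul1r -mulrDl !mulf_eq0 (negbTE l0).
move: (nr'); rewrite /root => /negbTE ->; rewrite orbF /= => /eqP S0.
have rw r : r \in rs -> 0 < nsq (w - r%:C%C).
  move=> rr; apply: nsq_gt0; rewrite subr_eq0; apply: contra nr' => /eqP ->.
  rewrite /rpoly -(big_map (fun r => r%:C%C) xpredT (fun z => 'X - z%:P)).
  by rewrite root_prod_XsubC map_f.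
have [y0|y0] := eqVneq (complex.Im w) 0; last first.
  have ImS s : {subset s <= rs} ->
      complex.Im w * complex.Im (\sum_(r <- s) w / (w - r%:C%C)) <= 0 /\
      (s != [::] -> complex.Im w * complex.Im (\sum_(r <- s) w / (w - r%:C%C)) < 0).
    elim: s => [_|r s IH sub]; first by rewrite big_nil mulr0.
    have [|IH' _] := IH; first by move=> z zs; apply: sub; rewrite in_cons zs orbT.
    have rr : r \in rs by apply: sub; rewrite mem_head.
    suff : complex.Im w * complex.Im (\sum_(r <- r :: s) w / (w - r%:C%C)) < 0 by move=> L; split; rewrite ?ltW.
    rewrite big_cons; move: IH'; set T := \sum_(_ <- s) _ => IH'.
    have -> : complex.Im (w / (w - r%:C%C) + T) = complex.Im (w / (w - r%:C%C)) + complex.Im T.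
      by case: (w / _) => ? ?; case: (T).
    rewrite mulrDr Im_ratio mulrA mulrCA -expr2.
    have : 0 < r * complex.Im w ^+ 2 / nsq (w - r%:C%C).
      apply: divr_gt0; last exact: rw.
      by apply: mulr_gt0; [exact: rs0|rewrite exprn_even_gt0].
    by rewrite mulNr mulNr; lra.
  have [_ +] := ImS rs (fun _ => id).
  have [rse|rsn] := eqVneq rs [::].
    by move: S0; rewrite rse big_nil mulr0 addr0 => /eqP; rewrite oner_eq0.
  move=> /(_ isT); move: S0; set T := \sum_(_ <- rs) _ => S0 H.
  have /(congr1 (fun z => complex.Im z)) := S0; have /(congr1 (fun z => complex.Re z)) := S0.
  case: T {S0} H => u v /= H; rewrite !(mul0r, subr0, addr0, add0r).
  move=> Hu /eqP; rewrite mulf_eq0 => /orP[/eqP b00|/eqP v0].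
    by move: Hu; rewrite b00 mul0r addr0 => /eqP; rewrite oner_eq0.
  by move: H; rewrite v0 mulr0 ltxx.
rewrite ltcE y0 eqxx /=; rewrite ltNge; apply/negP => x0.
have ReS s : {subset s <= rs} ->
    0 <= complex.Re (\sum_(r <- s) w / (w - r%:C%C)).
  elim: s => [_|r s IH sub]; first by rewrite big_nil.
  have rr : r \in rs by apply: sub; rewrite mem_head.
  have IH' := IH (fun z zs => sub z (@mem_behead _ (r :: s) z zs)).
  rewrite big_cons; move: IH'; set T := \sum_(_ <- s) _ => IH'.
  have -> : complex.Re (w / (w - r%:C%C) + T) = complex.Re (w / (w - r%:C%C)) + complex.Re T.
    by case: (w / _) => ? ?; case: (T).
  rewrite addr_ge0 // Re_ratio divr_ge0 ?nsq_ge0 // addr_ge0 ?nsq_ge0 //.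
  by rewrite oppr_ge0 mulr_ge0_le0 // ltW // rs0.
have := ReS rs (fun _ => id); move: S0; set T := \sum_(_ <- rs) _ => S0 H.
have /(congr1 (fun z => complex.Re z)) := S0.
case: T {S0} H => u v /= H; rewrite !(mul0r, subr0, addr0, add0r) => E.
by have := mulr_ge0 b0 H; lra.
Qed.

Lemma nsq_rpoly (R : realType) (rs : seq R) (w : R[i]) (d : R) :
  0 <= d -> {in rs, forall r, d <= nsq (w - r%:C%C)} ->
  d ^+ size rs <= nsq (rpoly rs).[w].
Proof.
move=> d0; elim: rs => [|r rs IH] H.
  by rewrite /rpoly big_nil hornerC /nsq /= expr0n /= expr1n addr0 expr0.
rewrite /rpoly big_cons -/(rpoly rs) hornerM nsqM /= exprS !hornerE.
apply: ler_pM => //; first by rewrite exprn_ge0.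
  by rewrite H // mem_head.
by apply: IH => z zs; rewrite H // in_cons zs orbT.
Qed.

(** A nonzero point off the positive axis is at distance at least |Im w| from it, or at least |w| if
    w is negative. *)
Lemma nsq_dist (R : realType) (w : R[i]) : ~~ (0 < w) -> w != 0 ->
  exists2 d : R, 0 < d & forall r : R, 0 < r -> d <= nsq (w - r%:C%C).
Proof.
case: w => x y; rewrite ltcE eq_complex /= => H H0.
have [y0|y0] := eqVneq y 0; last first.
  exists (y ^+ 2); first by rewrite exprn_even_gt0.
  by move=> r _; rewrite /nsq /= subr0 lerDr sqr_ge0.
move: H H0; rewrite y0 eqxx /= andbT -leNgt => x0 xn0.
exists (x ^+ 2); first by rewrite exprn_even_gt0.
move=> r r0; rewrite /nsq /= subr0 expr0n addr0.
by nra.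
Qed.

Lemma cvg_exprn (R : realType) (u : nat -> R) (l : R) (k : nat) :
  u N @[N --> \oo] --> l -> u N ^+ k @[N --> \oo] --> l ^+ k.
Proof.
move=> ul; elim: k => [|k IH]; first exact: cvg_cst.
by rewrite exprS; under eq_fun do rewrite exprS; exact: cvgM.
Qed.

(** If w is at squared distance at least d > 0 from all positive reals, each approximating
    polynomial of degree n with leading coefficient l satisfies |q(w)|^2 >= |l|^2 d^n. The leading
    coefficients converge to a nonzero limit, so the bound survives and w is no root of the
    limit. *)
Lemma preserving_lim (R : realType) (m_ : nat -> nat -> R) (m : nat -> R) :
  (forall N, preserving (m_ N)) -> (forall k, 0 < m k) ->
  (forall k, m_ N k @[N --> \oo] --> m k) -> preserving m.
Proof.
move=> mp m0 mm; split=> // p pp; have [p0 pos] := pp.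
split=> [|w rw]; first by rewrite -size_poly_eq0 size_mulop // size_poly_eq0.
apply: contraT => w0.
(* At w = 0 there is no uniform distance to the positive axis; the constant coefficient decides
   instead. *)
have [wE|wn0] := eqVneq w 0.
  move: rw; rewrite /root wE horner_coef0 coef_mulop mulf_eq0 eq_complex /= gt_eqF //=.
  rewrite -horner_coef0 => /pos; by rewrite ltxx.
have [d d0 dr] := nsq_dist w0 wn0.
(* [L h] is the squared modulus of [mulop h p] at w, written as a function of finitely many real
   multipliers so that its continuity is visible. *)
pose L (h : nat -> R) : R :=
  (\sum_(k < size p) h k * complex.Re (p`_k * w ^+ k)) ^+ 2 +
  (\sum_(k < size p) h k * complex.Im (p`_k * w ^+ k)) ^+ 2.
have LE h : nsq (mulop h p).[w] = L h.
  rewrite horner_mulop /L /nsq; congr (_ ^+ 2 + _ ^+ 2).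
    rewrite (big_morph (fun z : R[i] => complex.Re z) (id1 := 0) (op1 := +%R)) //; last by case=> ? ? [].
    by apply: eq_bigr => k _; case: (p`_k * _) => ? ? /=; rewrite mul0r subr0.
  rewrite (big_morph (fun z : R[i] => complex.Im z) (id1 := 0) (op1 := +%R)) //; last by case=> ? ? [].
  by apply: eq_bigr => k _; case: (p`_k * _) => ? ? /=; rewrite mul0r addr0.
have cvL : L (m_ N) @[N --> \oo] --> L m.
  have cvS (c : nat -> R) : \sum_(k < size p) m_ N k * c k @[N --> \oo] -->
      \sum_(k < size p) m k * c k.
    apply: (cvg_big (op := +%R)); first exact: add_continuous.
    by move=> k _; apply: cvgMr_tmp; exact: mm.
  exact: (cvgD (cvg_exprn (cvS (fun k => complex.Re (p`_k * w ^+ k))))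
               (cvg_exprn (cvS (fun k => complex.Im (p`_k * w ^+ k))))).
pose n := (size p).-1.
have cvR : (m_ N n) ^+ 2 * (nsq (lead_coef p) * d ^+ n) @[N --> \oo] -->
           (m n) ^+ 2 * (nsq (lead_coef p) * d ^+ n).
  by apply: cvgMr_tmp; apply: cvg_exprn; exact: mm.
have le : (m n) ^+ 2 * (nsq (lead_coef p) * d ^+ n) <= L m.
  apply: (ler_cvg_to cvR cvL); apply: nearW => N.
  have qp := (mp N).2 p pp; have [rs rs0 [_ qE]] := posrootedP qp.
  have mN0 := (mp N).1.
  have sq : size rs = n.
    have := size_mulop p mN0; rewrite {1}qE size_scale ?lead_coef_eq0; last by case: qp.
    by rewrite size_rpoly /n => <-.
  have lq : lead_coef (mulop (m_ N) p) = (m_ N n)%:C%C * lead_coef p.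
    by rewrite lead_coefE size_mulop // coef_mulop -lead_coefE.
  rewrite -LE qE hornerZ nsqM lq nsqM.
  have -> : nsq (m_ N n)%:C%C = m_ N n ^+ 2 by rewrite /nsq /= expr0n addr0.
  rewrite -mulrA ler_wpM2l ?sqr_ge0 // ler_wpM2l ?nsq_ge0 // -sq.
  by apply: nsq_rpoly => [|r /rs0 /dr]; first exact: ltW.
suff : 0 < L m by rewrite -LE; move: rw; rewrite /root => /eqP ->; rewrite /nsq /= expr0n addr0 ltxx.
apply: lt_le_trans le; rewrite mulr_gt0 ?exprn_gt0 // mulr_gt0 ?exprn_gt0 //.
by rewrite nsq_gt0 // lead_coef_eq0.
Qed.

(** * Laguerre-Polya functions on the half-line *)

Definition lp_partial (R : realType) (f : LPfun R) (N : nat) (z : R) : R :=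
  \prod_(j < N) ((1 - lp_alpha f j * z) * expR (lp_alpha f j * z)).

(** This is - f' / f at x, obtained by differentiating the logarithm of the product factor by
    factor. *)
Definition lp_drift (R : realType) (f : LPfun R) (x : R) : R :=
  lp_c f + lp_sigma f ^+ 2 * x +
  limn (series (fun j => lp_alpha f j ^+ 2 * x / (1 - lp_alpha f j * x))).

Lemma lp_eval0 (R : realType) (f : LPfun R) : f 0 = 1.
Proof.
rewrite /lp_eval; under [X in limn X]eq_fun => N.
  under eq_bigr => j _ do rewrite !mulr0 expR0 subr0 mulr1.
  rewrite big1 //.
  over.
by rewrite lim_cst // expr0n /= !mulr0 subr0 expR0 mul1r.
Qed.

Lemma lp_alpha_le0 (R : realType) (f : LPfun R) :
  (forall x : R, f x = 0 -> x < 0) -> forall j, lp_alpha f j <= 0.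
Proof.
move=> f_neg j; rewrite leNgt; apply/negP => aj.
have : f (lp_alpha f j)^-1 = 0.
  rewrite /lp_eval (_ : limn _ = 0) ?mulr0 //; apply/cvg_lim => //.
  apply: cvg_near_cst; exists j.+1 => // N /= jN.
  by rewrite (bigD1 (Ordinal jN)) //= divff ?gt_eqF // subrr !mul0r.
by move=> /f_neg; rewrite invr_lt0 ltNge ltW.
Qed.

Lemma factor_le1 (R : realType) (y : R) : (1 + y) * expR (- y) <= 1.
Proof. by rewrite expRN ler_pdivrMr ?expR_gt0 // mul1r expR_ge1Dx. Qed.

(** Uses (1 - y + y^2)(1 + y) = 1 + y^3 >= 1. The quadratic exponent makes summability of the
    alpha_j^2 bound the infinite product away from 0. *)
Lemma factor_ge (R : realType) (y : R) : 0 <= y ->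
  expR (- y ^+ 2) <= (1 + y) * expR (- y).
Proof.
move=> y0; have y1 : 0 < 1 + y by lra.
rewrite -ler_pdivrMr ?expR_gt0 // -expRB.
rewrite -lef_pV2 ?posrE ?expR_gt0 // -expRN.
apply: le_trans (expR_ge1Dx _).
rewrite -[(1 + y)^-1]mul1r ler_pdivrMr //.
by nra.
Qed.

Lemma cvg_expR (R : realType) (u : nat -> R) (l : R) :
  u N @[N --> \oo] --> l -> expR (u N) @[N --> \oo] --> expR l.
Proof. by move=> ul; apply: continuous_cvg => //; exact: continuous_expR. Qed.

Section nonpositive_alpha.
Context (R : realType) (f : LPfun R).
Hypothesis alpha_le0 : forall j, lp_alpha f j <= 0.

Let b j := - lp_alpha f j.
Let b_ge0 j : 0 <= b j. Proof. by rewrite oppr_ge0. Qed.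
Let alphaE j : lp_alpha f j = - b j. Proof. by rewrite opprK. Qed.

Let factorE j z : (1 - lp_alpha f j * z) * expR (lp_alpha f j * z) =
  (1 + b j * z) * expR (- (b j * z)).
Proof. by rewrite alphaE !mulNr opprK. Qed.

Let termE j x : lp_alpha f j ^+ 2 * x / (1 - lp_alpha f j * x) =
  b j ^+ 2 * x / (1 + b j * x).
Proof. by rewrite alphaE !mulNr sqrrN opprK. Qed.

Lemma lp_partial_gt0 N z : 0 <= z -> 0 < lp_partial f N z.
Proof.
move=> z0; apply: prodr_gt0 => j _; rewrite factorE mulr_gt0 ?expR_gt0 //.
by rewrite ltr_pwDl // mulr_ge0.
Qed.

Lemma lp_partial_cvg z : 0 <= z -> cvgn (fun N => lp_partial f N z).
Proof.
move=> z0; apply: nonincreasing_is_cvgn.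
  apply/nonincreasing_seqP => N; rewrite /lp_partial big_ord_recr /=.
  by rewrite ler_piMr ?(ltW (lp_partial_gt0 N z0)) // factorE factor_le1.
by exists 0 => _ [N _ <-]; rewrite ltW // lp_partial_gt0.
Qed.

Lemma lp_partial_lim_gt0 z : 0 <= z -> 0 < limn (fun N => lp_partial f N z).
Proof.
move=> z0; pose S := limn (series (fun j => lp_alpha f j ^+ 2)).
apply: (@lt_le_trans _ _ (expR (- (z ^+ 2 * S)))); first exact: expR_gt0.
apply: limr_ge; first exact: lp_partial_cvg.
apply: nearW => N.
apply: (@le_trans _ _ (expR (- (z ^+ 2 * series (fun j => lp_alpha f j ^+ 2) N)))).
  rewrite ler_expR lerN2 ler_wpM2l ?sqr_ge0 //.
  apply: nondecreasing_cvgn_le; last exact: lp_summable.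
  by apply: nondecreasing_series => *; rewrite sqr_ge0.
rewrite /series /= big_mkord mulr_sumr -sumrN expR_sum.
apply: ler_prod => j _; rewrite expR_ge0 /= factorE alphaE.
have -> : - (z ^+ 2 * (- b j) ^+ 2) = - (b j * z) ^+ 2 by ring.
by rewrite factor_ge // mulr_ge0.
Qed.

Lemma lp_eval_gt0 z : 0 <= z -> 0 < f z.
Proof. by move=> z0; rewrite mulr_gt0 ?expR_gt0 // lp_partial_lim_gt0. Qed.

Lemma lp_series_cvg x : 0 <= x ->
  cvgn (series (fun j => lp_alpha f j ^+ 2 * x / (1 - lp_alpha f j * x))).
Proof.
move=> x0; apply: (@series_le_cvg _ _ (fun j => x * lp_alpha f j ^+ 2)).
- move=> j; rewrite termE divr_ge0 // ?mulr_ge0 ?sqr_ge0 //.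
  by rewrite addr_ge0 // mulr_ge0.
- by move=> j; rewrite mulr_ge0 ?sqr_ge0.
- move=> j; rewrite termE ler_pdivrMr; last by rewrite ltr_pwDl // mulr_ge0.
  have -> : x * lp_alpha f j ^+ 2 * (1 + b j * x) =
      b j ^+ 2 * x * (1 + b j * x) by rewrite alphaE sqrrN; ring.
  by rewrite ler_peMr ?mulr_ge0 ?sqr_ge0 // lerDl mulr_ge0.
- exact/is_cvg_seriesZ/lp_summable.
Qed.

(** This is concavity of log f on the half-line: every term of the series increases with x. *)
Lemma lp_drift_mono x y : 0 <= x -> x <= y -> lp_drift f x <= lp_drift f y.
Proof.
move=> x0 xy; have y0 := le_trans x0 xy.
rewrite /lp_drift lerD //; first by rewrite lerD2l ler_wpM2l ?sqr_ge0.
apply: ler_lim; [exact: lp_series_cvg|exact: lp_series_cvg|].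
apply: nearW => N; rewrite /series /=; apply: ler_sum => j _.
have p : 0 < 1 + b j * x by rewrite ltr_pwDl // mulr_ge0.
have q : 0 < 1 + b j * y by rewrite ltr_pwDl // mulr_ge0.
rewrite !termE ler_pdivrMr // [leRHS]mulrAC ler_pdivlMr //.
have := b_ge0 j; have := sqr_ge0 (b j); nra.
Qed.

(* Both bounds are instances of [1 + s <= expR s]. *)
Lemma lp_partial_ratio N x y : 0 <= x -> x <= y ->
  let s z := series (fun j => lp_alpha f j ^+ 2 * z / (1 - lp_alpha f j * z)) N in
  lp_partial f N x * expR (- ((y - x) * s y)) <= lp_partial f N y /\
  lp_partial f N y <= lp_partial f N x * expR (- ((y - x) * s x)).
Proof.
move=> x0 xy s; have y0 := le_trans x0 xy.
rewrite /s /series /= !big_mkord !mulr_sumr -!sumrN !expR_sum /lp_partial.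
rewrite -!big_split /=.
split; apply: ler_prod => j _; rewrite factorE termE factorE;
  set B := b j; have B0 : 0 <= B by exact: b_ge0.
- have p : 0 < 1 + B * x by rewrite ltr_pwDl // mulr_ge0.
  have q : 0 < 1 + B * y by rewrite ltr_pwDl // mulr_ge0.
  rewrite !mulr_ge0 ?expR_ge0 ?(ltW p) //=.
  rewrite -[leLHS]mulrA -expRD -ler_pdivlMl // [leRHS]mulrA.
  have -> : - (B * x) - (y - x) * (B ^+ 2 * y / (1 + B * y)) =
     (1 - (1 + B * x) / (1 + B * y)) - B * y by field; rewrite gt_eqF.
  rewrite expRD ler_pM2r ?expR_gt0 // -lef_pV2 ?posrE ?expR_gt0 ?mulr_gt0 ?invr_gt0 //.
  rewrite -expRN invfM invrK opprB mulrC; apply: le_trans (expR_ge1Dx _).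
  by lra.
- have p : 0 < 1 + B * x by rewrite ltr_pwDl // mulr_ge0.
  have q : 0 < 1 + B * y by rewrite ltr_pwDl // mulr_ge0.
  rewrite !mulr_ge0 ?expR_ge0 ?(ltW q) //=.
  rewrite -[leRHS]mulrA -expRD -ler_pdivrMl // [leLHS]mulrA.
  have -> : - (B * x) - (y - x) * (B ^+ 2 * x / (1 + B * x)) =
     ((1 + B * y) / (1 + B * x) - 1) - B * y by field; rewrite gt_eqF.
  rewrite expRD ler_pM2r ?expR_gt0 // mulrC; apply: le_trans (expR_ge1Dx _).
  by lra.
Qed.

(** Mean value bounds for the concave function log f, inherited from the partial products by passing
    to the limit. *)
Lemma lp_ratio x y : 0 <= x -> x <= y ->
  f x * expR (- ((y - x) * lp_drift f y)) <= f y /\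
  f y <= f x * expR (- ((y - x) * lp_drift f x)).
Proof.
move=> x0 xy; have y0 := le_trans x0 xy.
pose s z := series (fun j => lp_alpha f j ^+ 2 * z / (1 - lp_alpha f j * z)).
have cvP z : 0 <= z -> lp_partial f N x * expR (- ((y - x) * s z N)) @[N --> \oo] -->
    limn (fun N => lp_partial f N x) * expR (- ((y - x) * limn (s z))).
  move=> z0; apply: cvgM; first exact: lp_partial_cvg.
  by apply: cvg_expR; apply: cvgN; apply: cvgMl_tmp; exact: lp_series_cvg.
have := ler_cvg_to (cvP _ y0) (lp_partial_cvg y0)
  (nearW _ (fun N => (lp_partial_ratio N x0 xy).1)).
have := ler_cvg_to (lp_partial_cvg y0) (cvP _ x0)
  (nearW _ (fun N => (lp_partial_ratio N x0 xy).2)).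
rewrite /lp_eval -!/(lp_partial f _ _) /lp_drift -!/(s _).
have := lp_partial_lim_gt0 x0.
move: (limn (fun N => lp_partial f N x)) (limn (fun N => lp_partial f N y)).
move: (limn (s x)) (limn (s y)) (lp_c f) (lp_sigma f ^+ 2) (sqr_ge0 (lp_sigma f)).
move=> Sx Sy c S S0 P Q P0 Q1 Q2.
have {}Q1 := Q1 eventually_filter eventually_filter.
have {}Q2 := Q2 eventually_filter eventually_filter.
(* The Gaussian exponent differs from each of its two bounds by exactly half of this quantity. *)
have D0 := mulr_ge0 S0 (sqr_ge0 (y - x)).
have E u : expR (- c * x - S / 2 * x ^+ 2) * P * expR u =
    P * expR (- c * x - S / 2 * x ^+ 2 + u) by rewrite (expRD (_ - _) u); ring.
rewrite !E ![_ * Q]mulrC; split.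
- apply: (@le_trans _ _ (P * expR (- ((y - x) * Sy)) * expR (- c * y - S / 2 * y ^+ 2))).
    rewrite -[leRHS]mulrA -expRD ler_pM2l // ler_expR.
    by nra.
  by rewrite ler_pM2r ?expR_gt0.
- apply: (@le_trans _ _ (P * expR (- ((y - x) * Sx)) * expR (- c * y - S / 2 * y ^+ 2))).
    by rewrite ler_pM2r ?expR_gt0.
  rewrite -[leLHS]mulrA -expRD ler_pM2l // ler_expR.
  by nra.
Qed.

End nonpositive_alpha.

(** The quotient of the two sides has a derivative proportional to y^2. With [le_exp_cubic] this
    determines log (1 + y) up to y^3, the precision needed when N^2 factors with y of order 1 / N
    are multiplied. *)
Lemma exp_quad_le (R : realType) (y : R) : 0 <= y ->
  expR (y - y ^+ 2 / 2) <= 1 + y.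
Proof.
move=> y0; pose h (x : R) : R := (1 + x) * expR (- (x - x ^+ 2 / 2)).
have dh (x : R) : is_derive x 1 h (x ^+ 2 * expR (- (x - x ^+ 2 / 2))).
  rewrite /h; apply: is_derive_eq.
  by rewrite /GRing.scale /=; field.
have : h 0 <= h y.
  apply: (@ger0_derive1_ndecry _ h 0) => //.
  - by move=> x _; rewrite derive1E derive_val mulr_ge0 ?sqr_ge0 ?expR_ge0.
  - apply: continuous_subspaceT => x; apply: differentiable_continuous.
    exact/derivable1_diffP.
rewrite /h expr0n mul0r subr0 oppr0 expR0 addr0 mulr1 expRN.
by rewrite ler_pdivlMr ?expR_gt0 // mul1r.
Qed.

Lemma le_exp_cubic (R : realType) (y : R) : 0 <= y ->
  1 + y <= expR (y - y ^+ 2 / 2 + y ^+ 3).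
Proof.
move=> y0; pose h (x : R) : R := - ((1 + x) * expR (- (x - x ^+ 2 / 2 + x ^+ 3))).
have dh (x : R) : is_derive x 1 h
    ((2 * x ^+ 2 + 3 * x ^+ 3) * expR (- (x - x ^+ 2 / 2 + x ^+ 3))).
  rewrite /h; apply: is_derive_eq.
  by rewrite /GRing.scale /=; field.
have : h 0 <= h y.
  apply: (@ger0_derive1_ndecry _ h 0) => //.
  - move=> x; rewrite in_itv /= andbT => x0; rewrite derive1E derive_val.
    by rewrite mulr_ge0 ?expR_ge0 // addr_ge0 // mulr_ge0 // exprn_ge0 // ltW.
  - apply: continuous_subspaceT => x; apply: differentiable_continuous.
    exact/derivable1_diffP.
rewrite /h !expr0n /= mul0r subr0 !addr0 oppr0 expR0 mulr1 lerN2 expRN.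
by rewrite ler_pdivrMr ?expR_gt0 // mul1r.
Qed.

(** Each factor is exp(- y^2 / 2 + O(y^3)) with y = s / (N + 1), and there are (N + 1)^2 of them, so
    the total error is of order s^3 / (N + 1). The Gaussian factor of f thus becomes a limit of
    admissible linear factors. *)
Lemma gaussian_cvg (R : realType) (s : R) : 0 <= s ->
  ((1 + s / N.+1%:R) * expR (- (s / N.+1%:R))) ^+ (N.+1 ^ 2) @[N --> \oo] -->
  expR (- (s ^+ 2 / 2)).
Proof.
move=> s0.
have H : expR (- (s ^+ 2 / 2) + s ^+ 3 * N.+1%:R^-1) @[N --> \oo] --> expR (- (s ^+ 2 / 2)).
  apply: cvg_expR; rewrite -[X in _ --> X]addr0; apply: cvgD; first exact: cvg_cst.
  rewrite -[X in _ --> X](mulr0 (s ^+ 3)); apply: cvgMl_tmp.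
  exact: cvg_harmonic.
apply: (squeeze_cvgr _ (cvg_cst _) H); apply: nearW => N.
have n0 : (N.+1%:R : R) != 0 by rewrite pnatr_eq0.
set y := s / N.+1%:R; have y0 : 0 <= y by rewrite divr_ge0.
apply/andP; split.
- have -> : - (s ^+ 2 / 2) = (- (y ^+ 2 / 2)) * (N.+1 ^ 2)%:R.
    by rewrite /y natrX; field.
  rewrite expRM_natr; apply: lerXn2r; rewrite ?nnegrE ?expR_ge0 //.
    by rewrite mulr_ge0 ?expR_ge0 // addr_ge0.
  by rewrite -ler_pdivrMr ?expR_gt0 // -expRB opprK addrC exp_quad_le.
- have -> : - (s ^+ 2 / 2) + s ^+ 3 * N.+1%:R^-1 = (- (y ^+ 2 / 2) + y ^+ 3) * (N.+1 ^ 2)%:R.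
    by rewrite /y natrX; field.
  rewrite expRM_natr; apply: lerXn2r; rewrite ?nnegrE ?expR_ge0 //.
    by rewrite mulr_ge0 ?expR_ge0 // addr_ge0.
  rewrite -ler_pdivlMr ?expR_gt0 // -expRB opprK.
  by apply: le_trans (le_exp_cubic y0) _; rewrite ler_expR; lra.
Qed.

Lemma preserving_factor (R : realType) (b : R) : 0 <= b ->
  preserving (fun k => (1 + b * k%:R) * expR (- (b * k%:R))).
Proof.
move=> b0; apply: preservingM; first exact: preserving_linear.
under eq_fun do rewrite -mulNr expRM_natr.
exact/preserving_scale/expR_gt0.
Qed.

(** The factor exp(- c t k) is a scaling of the variable, the Gaussian is handled by [gaussian_cvg],
    and the product by its partial products; positivity of f on the half-line permits the limit. *)
Lemma preserving_lp (R : realType) (f : LPfun R) (t : R) :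
  (forall j, lp_alpha f j <= 0) -> 0 <= t -> preserving (fun k => f (t * k%:R)).
Proof.
move=> a0 t0.
have tk0 k : 0 <= t * k%:R by rewrite mulr_ge0.
(* Only sigma^2 matters to f, whereas the linear factors need a nonnegative slope. *)
pose s := `|lp_sigma f| * t.
pose m_ N k : R := expR (- (lp_c f * t)) ^+ k *
  (\prod_(j < N.+1 ^ 2) ((1 + s / N.+1%:R * k%:R) * expR (- (s / N.+1%:R * k%:R))) *
   \prod_(j < N) ((1 + - lp_alpha f j * t * k%:R) *
      expR (- (- lp_alpha f j * t * k%:R)))).
apply: (@preserving_lim _ m_).
- move=> N; apply: preservingM; first exact/preserving_scale/expR_gt0.
  apply: preservingM.
    apply: (@preserving_prod _ (fun _ k => (1 + s / N.+1%:R * k%:R) * expR (- (s / N.+1%:R * k%:R)))).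
    by move=> _; apply: preserving_factor; rewrite divr_ge0 // mulr_ge0.
  apply: (@preserving_prod _ (fun j k => (1 + - lp_alpha f j * t * k%:R) *
      expR (- (- lp_alpha f j * t * k%:R)))) => j.
  by apply: preserving_factor; rewrite mulr_ge0 // oppr_ge0.
- by move=> k; apply: lp_eval_gt0.
move=> k; rewrite /m_.
have -> : f (t * k%:R) = expR (- (lp_c f * t)) ^+ k *
   (expR (- ((s * k%:R) ^+ 2 / 2)) * limn (fun N => lp_partial f N (t * k%:R))).
  rewrite mulrA -expRM_natr -expRD /lp_eval; congr (expR _ * _).
  rewrite /s !exprMn real_normK ?num_real //.
  by ring.
apply: cvgMl_tmp; apply: cvgM.
  have := @gaussian_cvg _ (s * k%:R); rewrite !mulr_ge0 // => /(_ isT).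
  apply: cvg_trans; apply: near_eq_cvg; apply: nearW => N.
  by rewrite prodr_const card_ord mulrAC.
have := @lp_partial_cvg _ f a0 _ (tk0 k).
apply: cvg_trans; apply: near_eq_cvg; apply: nearW => N.
by apply: eq_bigr => j _; rewrite -!mulrA !mulNr !opprK.
Qed.

(** * Vague convergence without loss of mass *)

Local Notation measR R := {measure set (measurableTypeR R) -> \bar R}.

Lemma cont_meas (R : realType) (g : R -> R) :
  continuous g -> measurable_fun [set: measurableTypeR R] g.
Proof. exact: continuous_measurable_fun. Qed.

Lemma bounded_integrable (R : realType) (mu : measR R) (g : R -> R) (M : R) :
  (mu setT < +oo)%E -> measurable_fun [set: R] g -> (forall x, `|g x| <= M) ->
  mu.-integrable setT (EFin \o g).
Proof.
move=> mu_fin mg gM; apply: measurable_bounded_integrable => //.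
by exists M; split=> [|y My x _]; [exact: num_real|exact: le_trans (gM x) (ltW My)].
Qed.

(** Pointwise |g - g chi| <= M (1 - chi). This is the positivity property that [vague_mass_cvg]
    requires of its functionals. *)
Lemma Rintegral_truncation (R : realType) (mu : measR R) (g chi : R -> R) (M : R) :
  (mu setT < +oo)%E -> continuous g -> continuous chi ->
  (forall x, 0 <= chi x <= 1) -> (forall x, `|g x| <= M) ->
  `|Rintegral mu setT g - Rintegral mu setT (fun x => g x * chi x)| <=
    M * (Rintegral mu setT (cst 1) - Rintegral mu setT chi).
Proof.
move=> mu_fin cg cchi chi01 gM.
have M0 : 0 <= M by apply: le_trans (gM 0).
have mg := cont_meas cg.
have mchi := cont_meas cchi.
have chi1 x : `|chi x| <= 1 by have /andP[? ?] := chi01 x; rewrite ger0_norm.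
have Ig := bounded_integrable mu_fin mg gM.
have Ichi := bounded_integrable mu_fin mchi chi1.
have I1 : mu.-integrable setT (EFin \o cst (1 : R)).
  by apply: (@bounded_integrable _ _ _ 1) => // x; rewrite normr1.
have Igc : mu.-integrable setT (EFin \o (fun x => g x * chi x)).
  apply: (@bounded_integrable _ _ _ M) => // [|x]; first exact: measurable_funM.
  by rewrite normrM -[leRHS]mulr1 ler_pM.
rewrite -!RintegralB // -RintegralZl //; last first.
  apply: (@bounded_integrable _ _ _ 1) => // [|x]; first exact: measurable_funB.
  by have /andP[? ?] := chi01 x; rewrite ger0_norm ?subr_ge0 // gerBl.
have Igd : mu.-integrable setT (EFin \o (fun x => g x - g x * chi x)).
  apply: (@bounded_integrable _ _ _ M) => // [|x].
    by apply: measurable_funB => //; exact: measurable_funM.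
  rewrite -{1}[g x]mulr1 -mulrBr normrM -[leRHS]mulr1 ler_pM //.
  by have /andP[? ?] := chi01 x; rewrite ger0_norm ?subr_ge0 // gerBl.
apply: le_trans (le_normr_Rintegral _ Igd) _ => //.
apply: le_Rintegral => //.
- exact: integrable_norm.
- apply: (@bounded_integrable _ _ _ M) => // [|x].
    by apply: measurable_funM => //; exact: measurable_funB.
  rewrite normrM -[leRHS]mulr1 ler_pM ?(ger0_norm M0) //.
  by have /andP[? ?] := chi01 x; rewrite ger0_norm ?subr_ge0 // gerBl.
- move=> x _; rewrite -{1}[g x]mulr1 -mulrBr normrM.
  have /andP[? ?] := chi01 x; rewrite [`|1 - _|]ger0_norm ?subr_ge0 //.
  by rewrite ler_wpM2r // subr_ge0.
Qed.

Definition cutoff (R : realType) (K x : R) : R :=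
  Num.max 0 (Num.min 1 (K + 1 - `|x|)).

Lemma cutoff_continuous (R : realType) (K : R) : continuous (cutoff K).
Proof.
have c0 (a : R) : continuous (cst a : R -> R) by exact: cst_continuous.
have cK : continuous (fun x : R => K + 1 - `|x|).
  by move=> x; apply: cvgB; [exact: cvg_cst|exact: norm_continuous].
move=> x; apply: (@continuous_max _ _ (cst 0) (cst 1 \min (fun x : R => K + 1 - `|x|))).
  exact: c0.
by apply: (@continuous_min _ _ (cst 1) (fun x : R => K + 1 - `|x|)); [exact: c0|exact: cK].
Qed.

Lemma cutoff01 (R : realType) (K x : R) : 0 <= cutoff K x <= 1.
Proof.
rewrite /cutoff le_max lexx /=; rewrite ge_max ler01 /=.
by rewrite ge_min lexx.
Qed.

Lemma cutoff1 (R : realType) (K x : R) : `|x| <= K -> cutoff K x = 1.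
Proof.
move=> xK; rewrite /cutoff min_l; last by lra.
by rewrite max_r.
Qed.

Lemma cutoff0 (R : realType) (K x : R) : K + 1 <= `|x| -> cutoff K x = 0.
Proof.
move=> xK; rewrite /cutoff min_r; last by lra.
by rewrite max_l //; lra.
Qed.

Lemma compact_support_cutoff (R : realType) (g : R -> R) (K : R) :
  compact (closure [set x | g x * cutoff K x != 0]).
Proof.
apply: (@subclosed_compact _ _ `[- (K + 1), K + 1]).
- exact: closed_closure.
- exact: segment_compact.
- have /closure_id -> : closed `[- (K + 1), K + 1]%classic by exact: itv_closed.
  apply: closureS => x /=; rewrite in_itv /= -ler_norml.
  by apply: contraNT => /negP/negP; rewrite -ltNge => /ltW/cutoff0 ->; rewrite mulr0.
Qed.

Lemma cutoff_integral_cvg (R : realType)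
    (mu : {finite_measure set (measurableTypeR R) -> \bar R}) :
  Rintegral mu setT (cutoff K%:R) @[K --> \oo] --> Rintegral mu setT (cst 1).
Proof.
have mu_fin : (mu setT < +oo)%E by rewrite ltey_eq fin_num_measure.
have I1 : mu.-integrable setT (EFin \o cst (1 : R)).
  by apply: (@bounded_integrable _ _ _ 1) => // x; rewrite normr1.
apply: fine_cvg; rewrite fineK; last exact: integrable_fin_num.
have [] // := @dominated_convergence _ _ _ mu setT measurableT
  (fun K x => (cutoff K%:R x)%:E) (cst 1%:E) (cst 1%:E).
- by move=> K; apply/measurable_EFinP; apply: cont_meas; exact: cutoff_continuous.
- apply: aeW => x _; apply: cvg_near_cst; near=> K; congr EFin; apply: cutoff1.
  by near: K; exact: nbhs_infty_ger.
- apply: aeW => x K _ /=; rewrite lee_fin.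
  by have /andP[? ?] := cutoff01 K%:R x; rewrite ger0_norm.
Unshelve. all: by end_near. Qed.

(* [L] stands for any sequence of positive functionals: an integral, or the mean
   over a finite set of points. *)
Lemma vague_mass_cvg (R : realType)
    (mu : {finite_measure set (measurableTypeR R) -> \bar R})
    (L : nat -> (R -> R) -> R) :
  (forall n (g chi : R -> R) (M : R), continuous g -> continuous chi ->
     (forall x, 0 <= chi x <= 1) -> (forall x, `|g x| <= M) ->
     `|L n g - L n (fun x => g x * chi x)| <= M * (L n (cst 1) - L n chi)) ->
  (forall g : R -> R, continuous g -> compact (closure [set x | g x != 0]) ->
     L n g @[n --> \oo] --> Rintegral mu setT g) ->
  L n (cst 1) @[n --> \oo] --> Rintegral mu setT (cst 1) ->
  forall (g : R -> R) (M : R), continuous g -> (forall x, `|g x| <= M) ->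
    L n g @[n --> \oo] --> Rintegral mu setT g.
Proof.
move=> Lpos Lvague L1 g M cg gM.
have mu_fin : (mu setT < +oo)%E by rewrite ltey_eq fin_num_measure.
have M0 : 0 <= M by apply: le_trans (gM 0).
apply/cvgrPdist_lt => e e0.
(* The denominator is [M + 1] because M may be 0. *)
have d0 : 0 < e / 8 / (M + 1) by rewrite !divr_gt0 // ltr_wpDl.
set d := e / 8 / (M + 1) in d0 *.
have Md : M * d <= e / 8.
  by rewrite /d mulrA ler_pdivrMr; nra.
have /cvgrPdist_lt /(_ _ d0) [K _ HK] := @cutoff_integral_cvg _ mu.
have {}HK := HK K (leqnn K).
set chi := cutoff K%:R in HK.
have cchi : continuous chi by exact: cutoff_continuous.
have T1 := Rintegral_truncation mu_fin cg cchi (@cutoff01 _ _) gM.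
have Lchi : L n chi @[n --> \oo] --> Rintegral mu setT chi.
  apply: Lvague => //.
  have -> : [set x | chi x != 0] = [set x | 1 * cutoff K%:R x != 0].
    by apply/seteqP; split=> x /=; rewrite mul1r.
  exact: (@compact_support_cutoff _ (fun=> 1) K%:R).
have Lgchi : L n (fun x => g x * chi x) @[n --> \oo] -->
    Rintegral mu setT (fun x => g x * chi x).
  apply: Lvague; last exact: compact_support_cutoff.
  by move=> x; apply: cvgM; [exact: cg|exact: cchi].
near=> n.
have A1 : `|Rintegral mu setT chi - L n chi| < d.
  by near: n; move/cvgrPdist_lt : Lchi; exact.
have A2 : `|Rintegral mu setT (cst 1) - L n (cst 1)| < d.
  by near: n; move/cvgrPdist_lt : L1; exact.
have A3 : `|Rintegral mu setT (fun x => g x * chi x) - L n (fun x => g x * chi x)| < e / 8.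
  by near: n; move/cvgrPdist_lt : Lgchi; apply; rewrite divr_gt0.
have T2 := Lpos n g chi M cg cchi (@cutoff01 _ _) gM.
move: HK A1 A2 A3 T1 T2.
move: (Rintegral mu setT g) (L n g) (Rintegral mu setT (fun x => g x * chi x))
  (L n (fun x => g x * chi x)) (Rintegral mu setT chi) (L n chi)
  (Rintegral mu setT (cst 1)) (L n (cst 1)) => a1 a2 a3 a4 a5 a6 a7 a8.
rewrite !ltr_norml !ler_norml => /andP[? ?] /andP[? ?] /andP[? ?] /andP[? ?].
have B1 : M * (a7 - a5) <= e / 8.
  by apply: le_trans Md; rewrite ler_wpM2l // ltW.
(* The mass that [L n] has outside the cutoff is within 2 d of that of mu, which is below d. *)
have B2 : M * (a8 - a6) <= 3 * (e / 8).
  apply: (@le_trans _ _ (M * (3 * d))); first by rewrite ler_wpM2l //; lra.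
  by rewrite mulrCA ler_wpM2l.
move=> /andP[? ?] /andP[? ?].
by apply/andP; split; lra.
Unshelve. all: by end_near. Qed.

(** * The logarithmic derivative converges to the R-transform *)

Definition lp_atom (R : realType) (n : nat) (f : LPfun R) (j : nat) : R :=
  n%:R * lp_alpha f j.

Definition lp_weight (R : realType) (n : nat) (f : LPfun R) (j : nat) : R :=
  n%:R^-1 * (lp_atom n f j ^+ 2 / (lp_atom n f j ^+ 2 + 1)).

Lemma lp_weight_ge0 (R : realType) (n : nat) (f : LPfun R) j : 0 <= lp_weight n f j.
Proof. by rewrite mulr_ge0 ?invr_ge0 // weight_ge0. Qed.

Lemma measurable_pos (R : realType) :
  measurable ([set x | 0 < x] : set (measurableTypeR R)).
Proof.
rewrite (_ : [set x | 0 < x] = `]0, +oo[%classic); first exact: measurable_itv.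
by apply/seteqP; split=> x /=; rewrite in_itv /= andbT.
Qed.

Lemma nneseries_EFin (R : realType) (v : nat -> R) :
  cvgn (series v) -> (\sum_(j <oo) (v j)%:E)%E = (limn (series v))%:E.
Proof.
move=> cv; rewrite -EFin_lim //; congr (limn _); apply/funext => N.
by rewrite /series /= sumEFin.
Qed.

Lemma lp_measure_integral (R : realType) (n : nat) (f : LPfun R) (h : R -> R) :
  measurable_fun [set: measurableTypeR R] h -> (forall x, 0 <= h x) ->
  cvgn (series (fun j => lp_weight n f j * h (lp_atom n f j))) ->
  (\int[lp_measure n f]_x (h x)%:E)%E =
  (n%:R * lp_sigma f ^+ 2 * h 0 +
   limn (series (fun j => lp_weight n f j * h (lp_atom n f j))))%:E.
Proof.
move=> mh h0 cv.
have mhE : measurable_fun [set: measurableTypeR R] (EFin \o h) by exact/measurable_EFinP.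
rewrite /lp_measure ge0_integral_measure_add //= ?ge0_integral_mscale //.
rewrite integral_dirac // diracT mul1e ge0_integral_measure_series //.
have E j : (\int[mscale (NngNum (weight_ge0 (n%:R * lp_alpha f j)))
      \d_(n%:R * lp_alpha f j : measurableTypeR R)%R]_x (h x)%:E)%E =
    (lp_atom n f j ^+ 2 / (lp_atom n f j ^+ 2 + 1) * h (lp_atom n f j))%:E.
  rewrite ge0_integral_mscale //; last by move=> x _; rewrite lee_fin.
  by rewrite integral_dirac // diracT mul1e.
under eq_eseriesr => j _ do rewrite E.
rewrite -nneseriesZl; last first.
  by move=> j _; rewrite lee_fin mulr_ge0 // weight_ge0.
rewrite EFinD EFinM; congr (_ + _)%E.
rewrite -nneseries_EFin //; apply: eq_eseriesr => j _.
by rewrite -EFinM /lp_weight mulrA.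
all: by move=> *; rewrite lee_fin.
Qed.

Lemma lp_measure_integrable (R : realType) (n : nat) (f : LPfun R) (h : R -> R) :
  measurable_fun [set: measurableTypeR R] h -> (forall x, 0 <= h x) ->
  cvgn (series (fun j => lp_weight n f j * h (lp_atom n f j))) ->
  (lp_measure n f).-integrable setT (EFin \o h).
Proof.
move=> mh h0 cv; apply/integrableP; split; first exact/measurable_EFinP.
under eq_integral => x _ do rewrite /= ger0_norm //.
by rewrite lp_measure_integral // ltry.
Qed.

(** Turns [lp_summable] into finiteness of the measure. For n = 0 both sides vanish, as
    [0^-1 = 0]. *)
Lemma lp_weight_le (R : realType) (n : nat) (f : LPfun R) j :
  lp_weight n f j <= n%:R * lp_alpha f j ^+ 2.
Proof.
rewrite /lp_weight /lp_atom; case: n => [|n]; first by rewrite invr0 !mul0r.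
rewrite exprMn; set N : R := n.+1%:R; have N0 : 0 < N by rewrite ltr0n.
have a0 := sqr_ge0 (lp_alpha f j); move: (lp_alpha f j ^+ 2) a0 => a a0.
have Na : 0 <= N ^+ 2 * a by rewrite mulr_ge0 ?sqr_ge0.
rewrite ler_pdivrMl // ler_pdivrMr; last by rewrite ltr_wpDl.
by rewrite [leRHS](_ : _ = N ^+ 2 * a * (N ^+ 2 * a + 1)); [rewrite ler_peMr //; lra|ring].
Qed.

Lemma lp_weight_summable (R : realType) (n : nat) (f : LPfun R) :
  cvgn (series (fun j => lp_weight n f j * 1)).
Proof.
apply: (@series_le_cvg _ _ (fun j => n%:R * lp_alpha f j ^+ 2)).
- by move=> j; rewrite mulr1 lp_weight_ge0.
- by move=> j; rewrite mulr_ge0 ?sqr_ge0.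
- by move=> j; rewrite mulr1 lp_weight_le.
- exact/is_cvg_seriesZ/lp_summable.
Qed.

Lemma lp_measure_fin (R : realType) (n : nat) (f : LPfun R) :
  (lp_measure n f setT < +oo)%E.
Proof.
rewrite -[X in (X < _)%E]mul1e -(@integral_cst _ _ _ _ setT) //.
rewrite (lp_measure_integral (h := fun=> 1)) ?ltry //.
exact: lp_weight_summable.
Qed.

Section nonpositive_alpha.
Context (R : realType) (n : nat) (f : LPfun R).
Hypothesis alpha_le0 : forall j, lp_alpha f j <= 0.

Lemma lp_atom_le0 j : lp_atom n f j <= 0.
Proof. by rewrite mulr_ge0_le0. Qed.

Lemma lp_measure_integral0 (h : R -> R) : continuous h -> (forall x, 0 <= h x) ->
  (forall x, x <= 0 -> h x = 0) -> Rintegral (lp_measure n f) setT h = 0.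
Proof.
move=> ch h0 hN.
have E : (fun j => lp_weight n f j * h (lp_atom n f j)) = (fun=> 0).
  by apply/funext => j; rewrite hN ?mulr0 // lp_atom_le0.
have S0 : series (fun _ : nat => 0 : R) = (fun=> 0).
  by apply/funext => N; rewrite /series /= big1.
rewrite /Rintegral lp_measure_integral //; last 2 first.
- exact: cont_meas.
- by rewrite E S0; exact: is_cvg_cst.
by rewrite E S0 lim_cst // hN // mulr0 addr0.
Qed.

Lemma lp_measure_gt0 : lp_measure n f [set x | 0 < x] = 0%E.
Proof.
have A0 x : x <= 0 -> \1_[set x : R | 0 < x] x = 0 :> R.
  by move=> x0; rewrite indicE memNset //= ltNge x0.
have E : (fun j => lp_weight n f j * \1_[set x : R | 0 < x] (lp_atom n f j)) = (fun=> 0).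
  by apply/funext => j; rewrite A0 ?mulr0 // lp_atom_le0.
have S0 : series (fun _ : nat => 0 : R) = (fun=> 0).
  by apply/funext => N; rewrite /series /= big1.
have := integral_indic (lp_measure n f) measurableT (@measurable_pos R).
rewrite setIT => <-.
have mA : measurable_fun [set: measurableTypeR R] (\1_[set x : R | 0 < x] : R -> R).
  by apply: measurable_indic; exact: (@measurable_pos R).
rewrite lp_measure_integral //.
- by rewrite E S0 lim_cst // A0 // mulr0 addr0.
- by rewrite E S0; exact: is_cvg_cst.
Qed.

(** The kernel (u + x) / (1 - x u) has a pole at x = 1 / u > 0, while the measures live on the
    closed negative half-line. Replacing x by min(x, 0) makes it continuous everywhere without
    changing the integrals. *)
Definition neg_part_id (x : R) : R := Num.min x 0.

Lemma neg_part_id_le0 x : neg_part_id x <= 0.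
Proof. by rewrite /neg_part_id ge_min lexx orbT. Qed.

Lemma continuous_neg_part_id : continuous neg_part_id.
Proof.
move=> x; apply: (@continuous_min _ _ id (cst 0)); first exact: id.
exact: cst_continuous.
Qed.

Lemma lp_measure_integrable_neg :
  (lp_measure n f).-integrable setT (EFin \o (fun x => - neg_part_id x)).
Proof.
apply: lp_measure_integrable.
- by apply: cont_meas => x; apply: cvgN; exact: continuous_neg_part_id.
- by move=> x; rewrite oppr_ge0 neg_part_id_le0.
apply: (@series_le_cvg _ _ (fun j => n%:R * lp_alpha f j ^+ 2)).
- by move=> j; rewrite mulr_ge0 ?lp_weight_ge0 // oppr_ge0 neg_part_id_le0.
- by move=> j; rewrite mulr_ge0 ?sqr_ge0.
- move=> j; rewrite /neg_part_id min_l ?lp_atom_le0 // /lp_weight.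
  have [->|n0] := eqVneq n 0%N; first by rewrite invr0 !mul0r.
  have -> : n%:R * lp_alpha f j ^+ 2 = n%:R^-1 * lp_atom n f j ^+ 2.
    by rewrite /lp_atom; field; rewrite pnatr_eq0.
  rewrite -mulrA ler_wpM2l ?invr_ge0 //.
  have := lp_atom_le0 j; move: (lp_atom n f j) => x x0.
  rewrite mulrAC ler_pdivrMr; last by rewrite ltr_wpDl ?sqr_ge0.
  rewrite ler_wpM2l ?sqr_ge0 //.
  by nra.
- exact/is_cvg_seriesZ/lp_summable.
Qed.

Lemma lp_measure_integral_id :
  Rintegral (lp_measure n f) setT id = - Rintegral (lp_measure n f) setT (fun x => - neg_part_id x).
Proof.
have -> : Rintegral (lp_measure n f) setT id =
    Rintegral (lp_measure n f) setT neg_part_id.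
  congr fine; apply: ae_eq_integral => //.
  - by apply/measurable_EFinP; apply: cont_meas; exact: continuous_neg_part_id.
  - exists [set x | 0 < x]; split; last 1 first.
    + move=> x /= /not_implyP[_ H]; rewrite ltNge; apply/negP => x0; apply: H.
      by rewrite /neg_part_id min_l.
    + exact: measurable_pos.
    + exact: lp_measure_gt0.
have := RintegralZl (-1) measurableT lp_measure_integrable_neg.
rewrite mulN1r => <-; apply: eq_Rintegral => x _.
by rewrite mulN1r opprK.
Qed.

Definition kernelR (u x : R) : R := (u + neg_part_id x) / (1 - u * neg_part_id x).

(** Its factor 1 + x^2 cancels the denominator of the atom weights, so its integral is the drift
    without [lp_c]. It grows linearly at minus infinity; adding x leaves the bounded [kernelR] and
    produces the centring term of [admissible]. *)
Definition kernelD (u x : R) : R := u * (1 + neg_part_id x ^+ 2) / (1 - u * neg_part_id x).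

Lemma kernel_den_gt0 u x : 0 < u -> 0 < 1 - u * neg_part_id x.
Proof.
move=> u0; rewrite subr_gt0 (@le_lt_trans _ _ 0) //.
by rewrite mulr_ge0_le0 ?neg_part_id_le0 // ltW.
Qed.

Lemma kernelRE u x : 0 < u -> kernelR u x = kernelD u x - (- neg_part_id x).
Proof.
move=> u0; rewrite /kernelR /kernelD; field.
by rewrite gt_eqF // kernel_den_gt0.
Qed.

Lemma continuous_kernelR u : 0 < u -> continuous (kernelR u).
Proof.
move=> u0 x; have cm := continuous_neg_part_id.
apply: cvgM; first by apply: cvgD; [exact: cvg_cst|exact: cm].
apply: cvgV; first by rewrite gt_eqF // kernel_den_gt0.
by apply: cvgB; [exact: cvg_cst|apply: cvgMl_tmp; exact: cm].
Qed.

Lemma kernelR_bounded u x : 0 < u -> `|kernelR u x| <= u + u^-1.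
Proof.
move=> u0; have d0 := kernel_den_gt0 x u0; have := neg_part_id_le0 x.
rewrite /kernelR normrM normfV [`|1 - _|]gtr0_norm // ler_pdivrMr //.
move: (neg_part_id x) d0 => m d0 m0.
have ui : 0 < u^-1 by rewrite invr_gt0.
have uu : u * u^-1 = 1 by rewrite divff // gt_eqF.
have um : u * m <= 0 by rewrite mulr_ge0_le0 // ltW.
have -> : (u + u^-1) * (1 - u * m) = u + u^-1 - m * u ^+ 2 - m * (u * u^-1) by ring.
rewrite uu mulr1 ler_norml.
have : m * u ^+ 2 <= 0 by rewrite mulr_le0_ge0 ?sqr_ge0.
by move=> ?; apply/andP; split; lra.
Qed.

Lemma lp_drift_integral u : (0 < n)%N -> 0 < u ->
  lp_drift f (n%:R * u) =
  (lp_c f - Rintegral (lp_measure n f) setT id) +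
  Rintegral (lp_measure n f) setT (kernelR u).
Proof.
move=> n0 u0; have N0 : (n%:R : R) != 0 by rewrite pnatr_eq0 -lt0n.
have tE : (fun j => lp_weight n f j * kernelD u (lp_atom n f j)) =
    (fun j => lp_alpha f j ^+ 2 * (n%:R * u) / (1 - lp_alpha f j * (n%:R * u))).
  apply/funext => j; have := kernel_den_gt0 (lp_atom n f j) u0.
  rewrite /kernelD /neg_part_id min_l ?lp_atom_le0 // /lp_weight /lp_atom => d0.
  have d1 : (n%:R * lp_alpha f j) ^+ 2 + 1 != 0.
    by rewrite gt_eqF // ltr_wpDl ?sqr_ge0.
  field; rewrite d1 N0 /= -?andbA.
  by rewrite gt_eqF //; move: d0; congr (_ < _); ring.
have cD : continuous (kernelD u).
  move=> x; have cm := continuous_neg_part_id.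
  apply: cvgM; last first.
    apply: cvgV; first by rewrite gt_eqF // kernel_den_gt0.
    by apply: cvgB; [exact: cvg_cst|apply: cvgMl_tmp; exact: cm].
  apply: cvgMl_tmp; apply: cvgD; first exact: cvg_cst.
  by rewrite expr2; under eq_fun do rewrite expr2; apply: cvgM; exact: cm.
have D0 x : 0 <= kernelD u x.
  rewrite /kernelD divr_ge0 ?(ltW (kernel_den_gt0 x u0)) //.
  by rewrite mulr_ge0 ?addr_ge0 ?sqr_ge0 ?(ltW u0).
have cv : cvgn (series (fun j => lp_weight n f j * kernelD u (lp_atom n f j))).
  by rewrite tE; apply: lp_series_cvg => //; rewrite mulr_ge0 // ltW.
have -> : Rintegral (lp_measure n f) setT (kernelR u) =
    Rintegral (lp_measure n f) setT (kernelD u) -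
    Rintegral (lp_measure n f) setT (fun x => - neg_part_id x).
  rewrite -RintegralB //; last 2 first.
  - by apply: lp_measure_integrable => //; exact: cont_meas.
  - exact: lp_measure_integrable_neg.
  by apply: eq_Rintegral => x _; exact: kernelRE.
rewrite lp_measure_integral_id opprK addrA addrAC addrK.
rewrite [X in _ = _ + X]/Rintegral lp_measure_integral //; last exact: cont_meas.
rewrite /lp_drift -addrA; congr (_ + _); rewrite /= -tE; congr (_ + _).
by rewrite /kernelD /neg_part_id minxx; field.
Qed.
End nonpositive_alpha.

Lemma admissible_drift (R : realType) (f : nat -> LPfun R) (c : R)
    (Sigma : {finite_measure set (measurableTypeR R) -> \bar R}) (u : R) :
  (forall n, (0 < n)%N -> forall j, lp_alpha (f n) j <= 0) ->
  admissible f c Sigma -> 0 < u ->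
  lp_drift (f n) (n%:R * u) @[n --> \oo] --> Rtransform c Sigma u.
Proof.
move=> alpha_le0 [vague mass cen] u0.
have S_fin : (Sigma setT < +oo)%E by rewrite ltey_eq fin_num_measure.
(* The positive half-line is exhausted by intervals; on each, a bump function with compact support
   has integral 0 against every [lp_measure n (f n)] with n > 0, hence against Sigma. *)
have Spos : Sigma [set x | 0 < x] = 0%E.
  pose I (k : nat) : set R := `]k.+1%:R^-1, k.+2%:R[%classic.
  have -> : [set x : R | 0 < x] = \bigcup_k I k.
    apply/seteqP; split=> [x /= x0|x [k _]]; last first.
      rewrite /I /= in_itv /= => /andP[kx _].
      by apply: lt_trans kx; rewrite invr_gt0.
    have [k kx] : exists k : nat, x + x^-1 < k%:R.
      by exists (Num.truncn (x + x^-1)).+1; rewrite truncnS_gt.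
    have xi : 0 < x^-1 by rewrite invr_gt0.
    have kS : k%:R < k.+1%:R :> R by rewrite ltr_nat.
    have kSS : k%:R < k.+2%:R :> R by rewrite ltr_nat.
    exists k => //; rewrite /I /= in_itv /=; apply/andP; split; last by lra.
    by rewrite -[x]invrK ltf_pV2 ?posrE ?ltr0n //; lra.
  suff I0 k : Sigma (I k) = 0%E.
    apply/eqP; rewrite eq_le measure_ge0 andbT.
    have mI k : measurable (I k : set (measurableTypeR R)) by exact: measurable_itv.
    apply: (le_trans (measure_sigma_subadditive Sigma mI (bigcupT_measurable _ mI)
      (@subset_refl _ _))).
    by rewrite eseries0 // => k _ _; exact: I0.
  pose h (x : R) : R := Num.max 0 ((x - k.+1%:R^-1) * (k.+2%:R - x)).
  have ki : 0 < (k.+1%:R^-1 : R) by rewrite invr_gt0 ltr0n.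
  have ch : continuous h.
    move=> x; apply: (@continuous_max _ _ (cst 0) (fun x : R => (x - k.+1%:R^-1) * (k.+2%:R - x))).
      exact: cst_continuous.
    by apply: cvgM; apply: cvgB; by [exact: cvg_cst|exact: cvg_id].
  have h0 x : 0 <= h x by rewrite /h le_max lexx.
  have hpos x : I k x -> 0 < h x.
    by rewrite /I /= in_itv /= => /andP[? ?]; rewrite /h lt_max mulr_gt0 ?orbT // subr_gt0.
  have hsupp x : h x != 0 -> x \in `[k.+1%:R^-1, k.+2%:R].
    move=> /eqP H; rewrite in_itv /=; apply/negP => /negP; rewrite negb_and -!ltNge => J.
    apply: H; rewrite /h max_l //.
    have kk : (k.+1%:R^-1 : R) < k.+2%:R.
      by rewrite (@le_lt_trans _ _ 1) ?invf_le1 ?ltr0n ?ler1n ?ltr1n.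
    move: J => /orP[J|J].
      by apply: mulr_le0_ge0; rewrite ?subr_le0 ?subr_ge0 ltW // (lt_trans J).
    by apply: mulr_ge0_le0; rewrite ?subr_le0 ?subr_ge0 ltW // (lt_trans kk).
  have hint : Rintegral Sigma setT h = 0.
    have H : Rintegral (lp_measure n (f n)) setT h @[n --> \oo] --> Rintegral Sigma setT h.
      apply: vague; first exact: ch.
      apply: (@subclosed_compact _ _ `[k.+1%:R^-1 : R, k.+2%:R]%classic).
      - exact: closed_closure.
      - exact: segment_compact.
      - have /closure_id -> : closed `[k.+1%:R^-1 : R, k.+2%:R]%classic by exact: itv_closed.
        by apply: closureS => x /= /hsupp.
    apply: (cvg_unique _ H) => //; apply: cvg_near_cst; exists 1%N => // n /= n1.
    apply: lp_measure_integral0 => //; first exact: alpha_le0.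
    move=> x x0; apply/eqP; apply: contraT => /hsupp; rewrite in_itv /= => /andP[kx _].
    by have := lt_le_trans ki kx; rewrite ltNge x0.
  have hb x : `|h x| <= k.+2%:R * k.+2%:R.
    rewrite ger0_norm //; have [->|/hsupp] := eqVneq (h x) 0; first by rewrite mulr_ge0.
    rewrite in_itv /= => /andP[x1 x2]; rewrite /h ge_max mulr_ge0 //=.
    have k2 : 0 <= k.+2%:R :> R by [].
    move: (k.+1%:R^-1) (k.+2%:R) ki x1 x2 k2 => a b a0 ax xb b0.
    by rewrite ler_pM ?subr_ge0 //; lra.
  have Ih := bounded_integrable S_fin (cont_meas ch) hb.
  have : (\int[Sigma]_x `|(EFin \o h) x| = 0)%E.
    under eq_integral => x _ do rewrite /= ger0_norm //.
    have := fineK (integrable_fin_num measurableT Ih).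
    by rewrite -[X in (fine X)]/(\int[Sigma]_x (h x)%:E)%E [fine _]hint => <-.
  have mh : measurable_fun [set: measurableTypeR R] (EFin \o h).
    by apply/measurable_EFinP; exact: cont_meas.
  move/(ae_eq_integral_abs Sigma measurableT mh) => [N [mN N0 sN]].
  apply/eqP; rewrite eq_le measure_ge0 andbT -N0.
  apply: le_measure; rewrite ?inE //; first exact: measurable_itv.
  move=> x /hpos hx; apply: sN => /= /(_ Logic.I) [] E.
  by move: hx; rewrite E ltxx.
(* The truncated and the original kernel differ only on the positive half-line, which is null for
   Sigma. *)
have gE : Rtransform c Sigma u = c + Rintegral Sigma setT (kernelR u).
  congr (_ + _); congr fine; apply: ae_eq_integral => //.
  - apply/measurable_EFinP.
    (* The original kernel is continuous only away from its pole, so measurability is checked on the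
       two pieces. *)
    rewrite (_ : setT = ~` [set u^-1] `|` [set u^-1]); last by rewrite setUC setUCr.
    have oD : open (~` [set u^-1]) by apply: closed_openC; exact: closed_eq.
    have mD : measurable (~` [set u^-1] : set (measurableTypeR R)) by exact: open_measurable.
    have mE : measurable ([set u^-1] : set (measurableTypeR R)) by exact: measurable_set1.
    apply: (measurable_funU _ mD mE).2; split; last exact: measurable_fun_set1.
    apply: open_continuous_measurable_fun => // x; rewrite inE /= => xu.
    apply: cvgM; first by apply: cvgD; [exact: cvg_cst|exact: cvg_id].
    apply: cvgV.
      rewrite subr_eq0; apply/eqP => H; apply: xu.
      by rewrite -[RHS]mulr1 H mulrCA mulVf ?mulr1 // gt_eqF.
    by apply: cvgB; [exact: cvg_cst|apply: cvgMr_tmp; exact: cvg_id].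
  - by apply/measurable_EFinP; apply: cont_meas; exact: continuous_kernelR.
  - exists [set x | 0 < x]; split => //.
      exact: measurable_pos.
    move=> x /= /not_implyP[_ H]; rewrite ltNge; apply/negP => x0; apply: H.
    by rewrite /kernelR /neg_part_id min_l // [u * x]mulrC.
rewrite gE.
(* The kernel tends to - 1 / u at minus infinity and so lacks compact support: convergence of the
   total masses is essential. *)
have cK : Rintegral (lp_measure n (f n)) setT (kernelR u) @[n --> \oo] -->
    Rintegral Sigma setT (kernelR u).
  apply: (vague_mass_cvg (L := fun n => Rintegral (lp_measure n (f n)) setT)
     _ _ _ (continuous_kernelR u0) (fun x => kernelR_bounded x u0)).
  - move=> n g chi M; exact: Rintegral_truncation (lp_measure_fin _ _).
  - exact: vague.
  - rewrite Rintegral_cst // mul1r; under eq_fun do rewrite Rintegral_cst // mul1r.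
    by apply: fine_cvg; rewrite fineK // fin_num_measure.
have : lp_c (f n) - Rintegral (lp_measure n (f n)) setT id +
   Rintegral (lp_measure n (f n)) setT (kernelR u) @[n --> \oo] -->
   c + Rintegral Sigma setT (kernelR u) by exact: cvgD.
apply: cvg_trans; apply: near_eq_cvg; exists 1%N => // n /= n0.
by rewrite lp_drift_integral //; exact: alpha_le0.
Qed.

(** * The S-transform through averages of x / (x + r) *)

(** The function x / (x + r), continued by 1 to negative r so as to be continuous and bounded on the
    whole line. *)
Definition hker (R : realType) (x r : R) : R := x / (x + Num.max r 0).

Lemma max0_ge0 (R : realType) (r : R) : 0 <= Num.max r 0.
Proof. by rewrite le_max lexx orbT. Qed.

Lemma continuous_max0 (R : realType) : continuous (fun r : R => Num.max r 0).
Proof.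
move=> r; apply: (@continuous_max _ _ id (cst 0)); first exact: id.
exact: cst_continuous.
Qed.

Lemma hker_den_gt0 (R : realType) (x r : R) : 0 < x -> 0 < x + Num.max r 0.
Proof. by move=> x0; rewrite ltr_pwDl // max0_ge0. Qed.

Lemma continuous_hker (R : realType) (x : R) : 0 < x -> continuous (hker x).
Proof.
move=> x0 r; apply: cvgMl_tmp; apply: cvgV; first by rewrite gt_eqF // hker_den_gt0.
by apply: cvgD; [exact: cvg_cst|exact: continuous_max0].
Qed.

Lemma hker_gt0 (R : realType) (x r : R) : 0 < x -> 0 < hker x r.
Proof. by move=> x0; rewrite divr_gt0 // hker_den_gt0. Qed.

Lemma hker_le1 (R : realType) (x r : R) : 0 < x -> hker x r <= 1.
Proof.
move=> x0; rewrite ler_pdivrMr ?hker_den_gt0 // mul1r lerDl.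
exact: max0_ge0.
Qed.

Lemma hker_norm (R : realType) (x r : R) : 0 < x -> `|hker x r| <= 1.
Proof. by move=> x0; rewrite gtr0_norm ?hker_gt0 // hker_le1. Qed.

Lemma hkerB (R : realType) (x y r : R) : 0 < x -> 0 < y ->
  hker y r - hker x r = (y - x) * (Num.max r 0 / ((x + Num.max r 0) * (y + Num.max r 0))).
Proof.
move=> x0 y0; rewrite /hker; field.
by rewrite !gt_eqF // hker_den_gt0.
Qed.

Lemma hker_le (R : realType) (x y r : R) : 0 < x -> x <= y -> hker x r <= hker y r.
Proof.
move=> x0 xy; have y0 := lt_le_trans x0 xy.
rewrite -subr_ge0 hkerB // mulr_ge0 ?subr_ge0 // divr_ge0 ?max0_ge0 //.
by rewrite mulr_ge0 // ltW // hker_den_gt0.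
Qed.

Lemma hker_lt (R : realType) (x y r : R) : 0 < x -> x < y -> 0 < r -> hker x r < hker y r.
Proof.
move=> x0 xy r0; have y0 := lt_trans x0 xy.
rewrite -subr_gt0 hkerB // mulr_gt0 ?subr_gt0 // divr_gt0 ?mulr_gt0 ?hker_den_gt0 //.
by rewrite lt_max r0.
Qed.

Lemma atom_is_delta0 (R : realType) (mu : probability (measurableTypeR R) R) :
  mu [set 0] = 1%E -> is_delta0 mu.
Proof.
move=> mu1 A mA; rewrite diracE.
have m0 : measurable ([set 0 : R] : set (measurableTypeR R)) by exact: measurable_set1.
have mu0 : mu (~` [set 0]) = 0%E by rewrite probability_setC // mu1 subee.
have [A0|A0] := boolP (0 \in A).
  apply/eqP; rewrite eq_le probability_le1 //= -mu1; apply: le_measure; rewrite ?inE //.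
  by move=> _ ->; rewrite inE in A0.
apply/eqP; rewrite eq_le measure_ge0 andbT -[leRHS]mu0.
apply: le_measure; rewrite ?inE //; first exact: measurableC.
by move=> x Ax /= x0; move: A0; rewrite -x0 mem_set.
Qed.

Section probability.
Context (R : realType) (mu : probability (measurableTypeR R) R).

Lemma prob1 : mu [set: measurableTypeR R] = 1%E.
Proof. exact: probability_setT. Qed.

Lemma prob_integrable (g : R -> R) (M : R) : continuous g -> (forall x, `|g x| <= M) ->
  mu.-integrable setT (EFin \o g).
Proof.
move=> cg gM; apply: (@bounded_integrable _ _ _ M) => //; last exact: cont_meas.
by rewrite ltey_eq fin_num_measure.
Qed.

Lemma Rintegral_prob_cst (a : R) : Rintegral mu setT (fun=> a) = a.
Proof.
rewrite Rintegral_cst // -[RHS]mulr1; congr (_ * _).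
exact: (congr1 fine prob1).
Qed.

Lemma Rintegral_prob_le (g : R -> R) (M a : R) : continuous g -> (forall x, `|g x| <= M) ->
  (forall x, g x <= a) -> Rintegral mu setT g <= a.
Proof.
move=> cg gM ga; rewrite -[leRHS]Rintegral_prob_cst; apply: le_Rintegral => //.
  exact: prob_integrable cg gM.
by apply: (@prob_integrable _ `|a|) => //; exact: cst_continuous.
Qed.

Lemma Rintegral_prob_norm (g : R -> R) (a : R) : continuous g -> (forall x, `|g x| <= a) ->
  `|Rintegral mu setT g| <= a.
Proof.
move=> cg ga; apply: le_trans (le_normr_Rintegral _ (prob_integrable cg ga)) _ => //.
apply: (@Rintegral_prob_le _ a) => // [|x].
  by move=> x; apply: cvg_norm; exact: cg.
by rewrite normr_id.
Qed.

Definition htrans (x : R) : R := Rintegral mu setT (hker x).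

Lemma hker_integrable x : 0 < x -> mu.-integrable setT (EFin \o hker x).
Proof.
move=> x0; apply: (@prob_integrable _ 1); first exact: continuous_hker.
by move=> r; exact: hker_norm.
Qed.

Lemma htrans_le1 x : 0 < x -> htrans x <= 1.
Proof.
move=> x0; apply: (@Rintegral_prob_le _ 1) => //; first exact: continuous_hker.
  by move=> r; exact: hker_norm.
by move=> r; exact: hker_le1.
Qed.

Lemma htrans_le x y : 0 < x -> x <= y -> htrans x <= htrans y.
Proof.
move=> x0 xy; have y0 := lt_le_trans x0 xy.
apply: le_Rintegral => //; [exact: hker_integrable|exact: hker_integrable|].
by move=> r _; exact: hker_le.
Qed.

Lemma htransB x y : 0 < x -> 0 < y ->
  htrans y - htrans x = Rintegral mu setT (fun r => hker y r - hker x r).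
Proof. by move=> x0 y0; rewrite RintegralB //; exact: hker_integrable. Qed.

Lemma htrans_lipschitz (a x y : R) : 0 < a -> a <= x -> a <= y ->
  `|htrans y - htrans x| <= `|y - x| / a.
Proof.
move=> a0 ax ay; have x0 := lt_le_trans a0 ax; have y0 := lt_le_trans a0 ay.
rewrite htransB //; apply: Rintegral_prob_norm => [r|r].
  by apply: cvgB; exact: continuous_hker.
rewrite hkerB // normrM ler_wpM2l //.
have m0 := max0_ge0 r; move: (Num.max r 0) m0 => m m0.
have xm : 0 < x + m by rewrite ltr_pwDl.
have ym : 0 < y + m by rewrite ltr_pwDl.
rewrite ger0_norm ?divr_ge0 ?mulr_ge0 ?(ltW xm) ?(ltW ym) //.
rewrite ler_pdivrMr ?mulr_gt0 // mulrC ler_pdivlMr //.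
apply: (@le_trans _ _ ((m + 0) * (0 + a))); first by rewrite addr0 add0r.
have : m * a <= (x + m) * (y + m); last by rewrite addr0 add0r.
by rewrite ler_pM //; lra.
Qed.

Lemma htrans_continuous (x : R) : 0 < x -> {for x, continuous htrans}.
Proof.
move=> x0; apply/cvgrPdist_le => e e0.
have a0 : 0 < x / 2 by rewrite divr_gt0.
near=> y.
have ay : x / 2 <= y.
  by near: y; apply: (cvgr_ge x (@cvg_id _ _)); lra.
rewrite (le_trans (htrans_lipschitz a0 ay _)) //; first by lra.
rewrite ler_pdivrMr //; near: y.
have := @cvgr_dist_le _ _ _ _ _ id x cvg_id (e * (x / 2)).
by apply; rewrite mulr_gt0.
Unshelve. all: by end_near. Qed.

Lemma htrans_cvg1 : htrans n.+1%:R @[n --> \oo] --> (1 : R).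
Proof.
suff : htrans n.+1%:R @[n --> \oo] --> Rintegral mu setT (cst 1).
  by rewrite Rintegral_prob_cst.
have I1 : mu.-integrable setT (EFin \o cst (1 : R)).
  by apply: (@prob_integrable _ 1) => [|x]; [exact: cst_continuous|rewrite normr1].
apply: fine_cvg; rewrite fineK; last exact: integrable_fin_num.
have [] // := @dominated_convergence _ _ _ mu setT measurableT
  (fun n x => (hker n.+1%:R x)%:E) (cst 1%:E) (cst 1%:E).
- by move=> n; apply/measurable_EFinP; apply: cont_meas; exact: continuous_hker.
- apply: aeW => r _; apply: cvg_EFin; first by apply: nearW => n.
  have : (1 + Num.max r 0 * harmonic n)^-1 @[n --> \oo] --> (1 : R).
    rewrite -[X in _ --> X]invr1; apply: cvgV => //.
    rewrite -[X in _ --> X]addr0; apply: cvgD; first exact: cvg_cst.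
    by rewrite -[X in _ --> X](mulr0 (Num.max r 0)); apply: cvgMl_tmp; exact: cvg_harmonic.
  apply: cvg_trans; apply: near_eq_cvg; apply: nearW => n /=.
  rewrite /hker; field.
  have n0 : 0 < 1 + n%:R :> R by rewrite ltr_pwDl.
  by rewrite !gt_eqF // hker_den_gt0.
- by apply: aeW => x n _ /=; rewrite lee_fin hker_norm.
Qed.

Lemma is_delta0_htrans x : is_delta0 mu -> 0 < x -> htrans x = 1.
Proof.
move=> d0 x0; rewrite /htrans /Rintegral.
rewrite (eq_measure_integral (\d_(0 : measurableTypeR R))); last first.
  by move=> A mA _; exact: d0.
rewrite integral_dirac //.
  by rewrite diracT mul1e /= /hker maxxx addr0 divff // gt_eqF.
by apply/measurable_EFinP; apply: cont_meas; exact: continuous_hker.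
Qed.

Section nonneg.
Hypothesis mu_nonneg : on_nonneg mu.

Lemma measurable_nonneg : measurable ([set x | 0 <= x] : set (measurableTypeR R)).
Proof.
rewrite (_ : [set x | 0 <= x] = `[0, +oo[%classic); first exact: measurable_itv.
by apply/seteqP; split=> x /=; rewrite in_itv /= andbT.
Qed.

Lemma measure_neg : mu (~` [set x | 0 <= x]) = 0%E.
Proof.
rewrite probability_setC; last exact: measurable_nonneg.
by rewrite mu_nonneg subee.
Qed.

Lemma psi_htrans x : 0 < x -> psi mu (- x^-1) = htrans x - 1.
Proof.
move=> x0; pose g r := hker x r - 1.
have cg : continuous g by move=> r; apply: cvgB; [exact: continuous_hker|exact: cvg_cst].
transitivity (Rintegral mu [set u : R | 0 <= u] g).
  apply: eq_Rintegral => r; rewrite inE /= => r0.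
  rewrite /g /hker max_l //; field.
  by rewrite !gt_eqF // ltr_pwDl.
transitivity (Rintegral mu setT g).
  rewrite Rintegral_mkcond; congr fine; apply: ae_eq_integral => //.
  - have mP := measurable_nonneg.
    apply/measurable_EFinP; apply/(measurable_restrictT _ _).1 => //.
    by apply: measurable_funTS; exact: cont_meas.
  - by apply/measurable_EFinP; exact: cont_meas.
  - exists (~` [set x | 0 <= x]); split; last 1 first.
    + move=> r /= /not_implyP[_ H] r0; apply: H.
      by rewrite patchE mem_set.
    + by apply: measurableC; exact: measurable_nonneg.
    + exact: measure_neg.
rewrite RintegralB ?Rintegral_prob_cst //; first exact: hker_integrable.
by apply: (@prob_integrable _ 1) => [|r]; [exact: cst_continuous|rewrite normr1].
Qed.

(** Source of the strict inequalities on [htrans]: it is applied to [1 - hker x], to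
    [hker y - hker x] and to [hker x]. *)
Lemma null_is_delta0 (g : R -> R) (M : R) : continuous g -> (forall x, `|g x| <= M) ->
  (forall x, 0 <= g x) -> (forall x, 0 < x -> 0 < g x) ->
  Rintegral mu setT g = 0 -> is_delta0 mu.
Proof.
move=> cg gM g0 gpos int0.
have Ig := prob_integrable cg gM.
have mg : measurable_fun [set: measurableTypeR R] (EFin \o g).
  by apply/measurable_EFinP; exact: cont_meas.
have : (\int[mu]_x `|(EFin \o g) x| = 0)%E.
  under eq_integral => x _ do rewrite /= ger0_norm //.
  have := fineK (integrable_fin_num measurableT Ig).
  by rewrite [fine _]int0 => <-.
move/(ae_eq_integral_abs mu measurableT mg) => [N [mN N0 sN]].
have m0 : measurable ([set 0 : R] : set (measurableTypeR R)) by exact: measurable_set1.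
have mu0 : mu (~` [set 0]) = 0%E.
  apply/eqP; rewrite eq_le measure_ge0 andbT.
  have mP := measurable_nonneg.
  apply: (@le_trans _ _ (mu (N `|` ~` [set x | 0 <= x]))).
    apply: le_measure; rewrite ?inE; [exact: measurableC| | ].
      by apply: measurableU => //; exact: measurableC.
    move=> x /= x0; have [x1|x1] := ltP (x : R) 0; first by right.
    left; apply: sN => /= /(_ Logic.I) [] E.
    have : 0 < g x by apply: gpos; rewrite lt_neqAle x1 andbT; apply/eqP => E'; apply: x0.
    by rewrite E ltxx.
  apply: le_trans (measureU2 _ _ _) _ => //; first exact: measurableC.
  have E1 : (mu N <= 0)%E by rewrite N0.
  have E2 : (mu (~` [set x : R | (0 <= x)%R]) <= 0)%E by rewrite measure_neg.
  by rewrite -[leRHS]adde0; apply: leeD; [exact: E1|exact: E2].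
apply: atom_is_delta0; have := probability_setC mu m0; rewrite mu0 => /esym/eqP.
by rewrite sube_eq ?add0e // => /eqP.
Qed.

Hypothesis mu_ndelta0 : ~ is_delta0 mu.

Lemma htrans_lt1 x : 0 < x -> htrans x < 1.
Proof.
move=> x0; rewrite lt_neqAle htrans_le1 // andbT; apply/eqP => h1; apply: mu_ndelta0.
apply: (@null_is_delta0 (fun r => 1 - hker x r) 1).
- by move=> r; apply: cvgB; [exact: cvg_cst|exact: continuous_hker].
- by move=> r; rewrite ger0_norm ?subr_ge0 ?hker_le1 // gerBl ltW // hker_gt0.
- by move=> r; rewrite subr_ge0 hker_le1.
- move=> r r0; rewrite subr_gt0 ltr_pdivrMr ?hker_den_gt0 // mul1r ltrDl.
  by rewrite lt_max r0.
rewrite RintegralB //; last exact: hker_integrable.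
  by rewrite Rintegral_prob_cst -/(htrans x) h1 subrr.
by apply: (@prob_integrable _ 1) => [|r]; [exact: cst_continuous|rewrite normr1].
Qed.

Lemma htrans_lt x y : 0 < x -> x < y -> htrans x < htrans y.
Proof.
move=> x0 xy; have y0 := lt_trans x0 xy.
rewrite lt_neqAle htrans_le ?(ltW xy) // andbT; apply/eqP => h1; apply: mu_ndelta0.
apply: (@null_is_delta0 (fun r => hker y r - hker x r) 1).
- by move=> r; apply: cvgB; exact: continuous_hker.
- move=> r; rewrite ger0_norm ?subr_ge0 ?hker_le ?(ltW xy) //.
  by rewrite lerBlDr (le_trans (hker_le1 r y0)) // lerDl ltW // hker_gt0.
- by move=> r; rewrite subr_ge0 hker_le // ltW.
- by move=> r r0; rewrite subr_gt0 hker_lt.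
by rewrite -htransB // h1 subrr.
Qed.

Lemma htrans_inj x y : 0 < x -> 0 < y -> htrans x = htrans y -> x = y.
Proof.
move=> x0 y0 E; apply/eqP; rewrite eq_le !leNgt; apply/andP; split; apply/negP.
  by move=> /(htrans_lt y0); rewrite E ltxx.
by move=> /(htrans_lt x0); rewrite E ltxx.
Qed.

Lemma Stransform_htrans x : 0 < x ->
  Stransform mu (htrans x - 1) = htrans x / ((1 - htrans x) * x).
Proof.
move=> x0; rewrite /Stransform.
have -> : psi_inv mu (htrans x - 1) = - x^-1.
  (* Any negative w has the form - 1 / y with y > 0, and injectivity of [htrans] forces y = x; the
     default case is excluded by the preimage - 1 / x. *)
  rewrite /psi_inv; case: xgetP => [w _ [w0 pw]|H].
    have wE : w = - ((- w)^-1)^-1 by rewrite invrK opprK.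
    have w0' : 0 < (- w)^-1 by rewrite invr_gt0 oppr_gt0.
    move: pw; rewrite {1}wE psi_htrans // => /addIr /(htrans_inj w0' x0) <-.
    by rewrite invrK opprK.
  exfalso; apply: (H (- x^-1)); split; first by rewrite oppr_lt0 invr_gt0.
  exact: psi_htrans.
have h1 := htrans_lt1 x0.
rewrite subrKC //; field.
by rewrite gt_eqF //= !subr_eq0 gt_eqF //= lt_eqF.
Qed.
End nonneg.

(** Since [psi_inv] defaults to 0, a nonzero value certifies that z lies in the range of psi on the
    negative axis. *)
Lemma Stransform_neq0 z : on_nonneg mu -> Stransform mu z != 0 ->
  exists2 y : R, 0 < y & htrans y = z + 1.
Proof.
move=> mu_nonneg; rewrite /Stransform mulf_eq0 negb_or => /andP[_].
rewrite /psi_inv; case: xgetP => [w _ [w0 pw] _|_]; last by rewrite eqxx.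
have w0' : 0 < (- w)^-1 by rewrite invr_gt0 oppr_gt0.
exists (- w)^-1 => //; apply/eqP; rewrite -subr_eq -psi_htrans //.
by rewrite invrK opprK pw.
Qed.

End probability.

(** * Root measures *)

Lemma continuous_Re (R : realType) : 
  continuous ((fun z => complex.Re z) : (R[i])^o -> R).
Proof.
move=> z; apply: (cvgrPdist_lt (FF := nbhs_filter z) _ _).2 => e e0.
have e0' : (0 : R[i]) < e%:C%C by rewrite ltcR.
have H : \forall w \near nbhs z, `|z - w| < e%:C%C by exists e%:C%C.
apply: filterS H => w; rewrite -ltcR; apply: le_lt_trans.
apply: le_trans (normc_ge_Re _).
by case: z w => a b [c d].
Qed.

Lemma continuous_real_complex (R : realType) :
  continuous ((fun x => x%:C%C) : R -> (R[i])^o).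
Proof.
move=> x; apply/cvgrPdist_lt => e e0.
have eE : e = (complex.Re e)%:C%C by rewrite RRe_real // gtr0_real.
have e0' : 0 < complex.Re e by rewrite -ltcR -eE.
near=> y.
have : `|x - y| < complex.Re e by near: y; exact: (@cvgr_dist_lt _ _ _ _ _ id x cvg_id).
rewrite eE -ltcR; apply: le_lt_trans.
by rewrite -rmorphB /= normc_def /= expr0n addr0 sqrtr_sqr.
Unshelve. all: by end_near. Qed.

Lemma continuous_Cborel (R : realType) (g : (R[i])^o -> R) :
  continuous g -> measurable_fun [set: Cborel R] g.
Proof.
move=> /continuousP cg; apply: (measurability _ (RGenOpens.measurableE R)).
move=> _ [_ [a [b ->] <-]]; rewrite setTI; apply: sub_sigma_algebra.
exact/cg/interval_open.
Qed.

Lemma root_measure_integral (R : realType) (n : nat) (p : {poly R[i]})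
    (g : (R[i])^o -> R) : continuous g -> (forall z, 0 <= g z) ->
  (\int[root_measure n p]_z (g z)%:E)%E =
  (n%:R^-1 * \sum_(z <- proots p) g z)%:E.
Proof.
move=> cg g0.
have mg : measurable_fun [set: Cborel R] (EFin \o g).
  by apply/measurable_EFinP; exact: continuous_Cborel.
rewrite /root_measure ge0_integral_mscale //; last by move=> *; rewrite lee_fin.
rewrite ge0_integral_measure_sum //; last by move=> *; rewrite lee_fin.
rewrite EFinM; congr (_ * _)%E.
rewrite -sumEFin (big_nth 0) big_mkord; apply: eq_bigr => j _.
by rewrite integral_dirac // diracT mul1e.
Qed.

Lemma root_measure_Rintegral (R : realType) (n : nat) (p : {poly R[i]})
    (g : (R[i])^o -> R) (M : R) : continuous g -> (forall z, `|g z| <= M) ->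
  Rintegral (root_measure n p) setT g = n%:R^-1 * \sum_(z <- proots p) g z.
Proof.
move=> cg gM; have M0 : 0 <= M by exact: le_trans (gM 0).
have cM (a : R) : continuous (fun _ : (R[i])^o => a) by exact: cst_continuous.
(* Writing g as (g + M) - M reduces to nonnegative integrands. *)
have cgM : continuous (fun z : (R[i])^o => g z + M).
  by move=> z; exact: (cvgD (cg z) (cvg_cst M)).
have gM0 z : 0 <= g z + M by have := gM z; rewrite ler_norml => /andP[? _]; lra.
have int_ge0 (h : (R[i])^o -> R) : continuous h -> (forall z, 0 <= h z) ->
    (root_measure n p).-integrable [set: Cborel R] (EFin \o h).
  move=> ch h0; apply/integrableP; split.
    by apply/measurable_EFinP; exact: continuous_Cborel.
  under eq_integral => x _ do rewrite /= ger0_norm //.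
  by rewrite root_measure_integral // ltry.
have -> : Rintegral (root_measure n p) setT g =
    Rintegral (root_measure n p) setT (fun z => (g z + M) - M).
  by apply: eq_Rintegral => z _; rewrite addrK.
rewrite RintegralB //; [|exact: int_ge0|exact: (int_ge0 (fun=> M))].
rewrite /Rintegral !root_measure_integral //= -mulrBr -sumrB.
by congr (_ * _); apply: eq_bigr => z _; rewrite addrK.
Qed.

Definition rroots (R : realType) (p : {poly R[i]}) : seq R :=
  [seq complex.Re z | z <- proots p].

Lemma rrootsP (R : realType) (p : {poly R[i]}) : posrooted p ->
  [/\ {in rroots p, forall r, 0 < r}, proots p = [seq r%:C%C | r <- rroots p],
      p = lead_coef p *: rpoly (rroots p) & size (rroots p) = (size p).-1].
Proof.
move=> pp; have [rs rs0 [prs pE]] := posrootedP pp.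
have -> : rroots p = rs.
  by rewrite /rroots prs -map_comp map_id_in.
split => //; rewrite pE size_scale ?size_rpoly //.
by case: pp => p0 _; rewrite lead_coef_eq0.
Qed.

Lemma posrooted_Rintegral (R : realType) (n : nat) (p : {poly R[i]})
    (g : (R[i])^o -> R) (M : R) : posrooted p ->
  continuous g -> (forall z, `|g z| <= M) ->
  Rintegral (root_measure n p) setT g = n%:R^-1 * \sum_(r <- rroots p) g r%:C%C.
Proof.
move=> pp cg gM; rewrite (root_measure_Rintegral _ _ cg gM).
by have [_ prs _ _] := rrootsP pp; rewrite {1}prs big_map.
Qed.

Lemma weak_cvg_htrans (R : realType) (p : nat -> {poly R[i]})
    (mu : probability (measurableTypeR R) R) (x : R) :
  (forall n, (0 < n)%N -> posrooted (p n)) ->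
  weak_cvg (fun n => root_measure n (p n)) mu -> 0 < x ->
  n%:R^-1 * hsum (rroots (p n)) x @[n --> \oo] --> htrans mu x.
Proof.
move=> pp wc x0; pose g (z : (R[i])^o) := hker x (complex.Re z).
have cg : continuous g.
  move=> z; apply: (@continuous_comp _ _ _ (fun z : (R[i])^o => complex.Re z) (hker x)).
      exact: continuous_Re.
    exact: continuous_hker.
have gM z : `|g z| <= 1 by exact: hker_norm.
have := wc g cg (ex_intro _ 1 gM).
rewrite /g /= -/(htrans mu x).
apply: cvg_trans; apply: near_eq_cvg; exists 1%N => // n /= n0.
rewrite (posrooted_Rintegral _ (pp n n0) cg gM); congr (_ * _).
have [rs0 _ _ _] := rrootsP (pp n n0).
apply: eq_big_seq => r /rs0 r0.
by rewrite /g /hker /= max_l // ltW.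
Qed.

(** * Transfer of averages from p to f(tz d/dz) p *)

(** [epoly] is monic while [mulop] multiplies the leading coefficient by [m (size p).-1], hence the
    factor on the left. The degree is preserved, so the signs of [coef_rpoly] agree. *)
Lemma epoly_mulop (R : realType) (m : nat -> R) (p : {poly R[i]}) k :
  preserving m -> posrooted p ->
  m (size p).-1 * (epoly (rroots (mulop m p)))`_k = m k * (epoly (rroots p))`_k.
Proof.
move=> mp pp; have [m0 mpp] := mp; have qp := mpp p pp.
have [_ _ pE sp] := rrootsP pp; have [_ _ qE sq] := rrootsP qp.
have l0 : lead_coef p != 0 by case: pp => ? _; rewrite lead_coef_eq0.
have lq : lead_coef (mulop m p) = (m (size p).-1)%:C%C * lead_coef p.
  by rewrite lead_coefE size_mulop // coef_mulop -lead_coefE.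
have pk : p`_k = lead_coef p * ((-1) ^+ (size (rroots p) + k) * (epoly (rroots p))`_k)%:C%C.
  by rewrite {1}pE coefZ coef_rpoly.
have qk : (mulop m p)`_k = lead_coef (mulop m p) *
    ((-1) ^+ (size (rroots (mulop m p)) + k) * (epoly (rroots (mulop m p)))`_k)%:C%C.
  by rewrite {1}qE coefZ coef_rpoly.
have := coef_mulop m p k; rewrite pk qk lq sq size_mulop // -sp.
move=> H; have {H} := mulfI l0 (etrans (mulrCA _ _ _) (etrans (mulrA _ _ _) (etrans H (mulrCA _ _ _)))).
rewrite -!rmorphM => /complexI.
set s := (-1) ^+ _; have s0 : s != 0 by rewrite signr_eq0.
by move=> H; apply: (mulfI s0); rewrite [LHS]mulrCA [RHS]mulrCA.
Qed.

Lemma hsum_ge0 (R : realType) (rs : seq R) (x : R) :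
  {in rs, forall r, 0 < r} -> 0 < x -> 0 <= hsum rs x.
Proof.
move=> rs0 x0; rewrite /hsum big_seq; apply: sumr_ge0 => r /rs0 r0.
by rewrite divr_ge0 // ltW // addr_gt0.
Qed.

Lemma hsum_le (R : realType) (rs : seq R) (x : R) :
  {in rs, forall r, 0 < r} -> 0 < x -> hsum rs x <= (size rs)%:R.
Proof.
move=> rs0 x0; rewrite /hsum -sum1_size natr_sum big_seq [leRHS]big_seq.
apply: ler_sum => r /rs0 r0.
by rewrite ler_pdivrMr ?addr_gt0 // mul1r lerDl ltW.
Qed.

(** The exponent 5 is 2 + 1 + 2: one tilt to read off from the mean that the weights of [rs]
    increase at k, one factor a for the error in the multiplier ratio, and one tilt to return from
    the increase of the weights of [qs] to their mean. *)
Lemma transfer_step_ge (R : realType) (rs qs : seq R) (M : nat -> R) (k : nat) (a x rho : R) :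
  {in rs, forall r, 0 < r} -> {in qs, forall r, 0 < r} -> size qs = size rs ->
  (forall j, 0 < M j) ->
  (forall j, M (size rs) * (epoly qs)`_j = M j * (epoly rs)`_j) ->
  0 < x -> 0 < rho -> 1 < a -> (k < size rs)%N -> rho * M k <= a * M k.+1 ->
  k%:R + (a - 1) ^- 2 < hsum rs (x / a ^+ 5) ->
  k.+1%:R - (a - 1) ^- 2 <= hsum qs (x / rho).
Proof.
move=> rs0 qs0 sE M0 qE x0 rho0 a1 kn rat hk; have a0 : 0 < a by lra.
have z0 : 0 < x / a ^+ 3 by rewrite divr_gt0 // exprn_gt0.
have y'0 : 0 < x / rho / a ^+ 2 by rewrite !divr_gt0 // exprn_gt0.
(* Otherwise [hsum_tilt_le] would keep the mean at x / a^5 below k + (a - 1)^-2. *)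
have Ez : (epoly rs)`_k < (epoly rs)`_k.+1 * (x / a ^+ 3).
  rewrite ltNge; apply/negP => H.
  have := hsum_tilt_le rs0 z0 a1 kn H.
  have -> : x / a ^+ 3 / a ^+ 2 = x / a ^+ 5 by field; rewrite gt_eqF.
  by rewrite leNgt hk.
have -> : x / rho = a ^+ 2 * (x / rho / a ^+ 2) by field; rewrite !gt_eqF.
apply: hsum_tilt_ge => //; first by rewrite sE.
rewrite -(ler_pM2l (M0 (size rs))) mulrA !qE.
have Mk := M0 k.
have e1 : 0 <= (epoly rs)`_k.+1 by exact: epoly_ge0.
apply: (@le_trans _ _ (M k * ((epoly rs)`_k.+1 * (x / a ^+ 3)))).
  by rewrite ler_pM2l // ltW.
have -> : M k * ((epoly rs)`_k.+1 * (x / a ^+ 3)) =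
   rho * M k * ((epoly rs)`_k.+1 * (x / rho / a ^+ 3)) by field; rewrite !gt_eqF.
have -> : M k.+1 * (epoly rs)`_k.+1 * (x / rho / a ^+ 2) =
   a * M k.+1 * ((epoly rs)`_k.+1 * (x / rho / a ^+ 3)) by field; rewrite !gt_eqF.
by rewrite ler_wpM2r // mulr_ge0 // !divr_ge0 ?exprn_ge0 // ltW.
Qed.

Lemma transfer_step_le (R : realType) (rs qs : seq R) (M : nat -> R) (k : nat) (a x rho : R) :
  {in rs, forall r, 0 < r} -> {in qs, forall r, 0 < r} -> size qs = size rs ->
  (forall j, 0 < M j) ->
  (forall j, M (size rs) * (epoly qs)`_j = M j * (epoly rs)`_j) ->
  0 < x -> 0 < rho -> 1 < a -> (k < size rs)%N -> M k.+1 <= a * rho * M k ->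
  hsum rs (x * a ^+ 5) < k.+1%:R - (a - 1) ^- 2 ->
  hsum qs (x / rho) <= k%:R + (a - 1) ^- 2.
Proof.
move=> rs0 qs0 sE M0 qE x0 rho0 a1 kn rat hk; have a0 : 0 < a by lra.
have z0 : 0 < x * a ^+ 3 by rewrite mulr_gt0 // exprn_gt0.
have y'0 : 0 < x / rho * a ^+ 2 by rewrite mulr_gt0 ?divr_gt0 // exprn_gt0.
have Ez : (epoly rs)`_k.+1 * (x * a ^+ 3) < (epoly rs)`_k.
  rewrite ltNge; apply/negP => H.
  have := hsum_tilt_ge rs0 z0 a1 kn H.
  have -> : a ^+ 2 * (x * a ^+ 3) = x * a ^+ 5 by ring.
  by rewrite leNgt hk.
have -> : x / rho = x / rho * a ^+ 2 / a ^+ 2 by field; rewrite !gt_eqF.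
apply: hsum_tilt_le => //; first by rewrite sE.
rewrite -(ler_pM2l (M0 (size rs))) mulrA !qE.
have Mk := M0 k.
have e1 : 0 <= (epoly rs)`_k.+1 by exact: epoly_ge0.
apply: (@le_trans _ _ (M k * ((epoly rs)`_k.+1 * (x * a ^+ 3)))); last first.
  by rewrite ler_pM2l // ltW.
have -> : M k * ((epoly rs)`_k.+1 * (x * a ^+ 3)) =
   a * rho * M k * ((epoly rs)`_k.+1 * (x / rho * a ^+ 2)) by field; rewrite !gt_eqF.
by rewrite -[leLHS]mulrA ler_wpM2r // mulr_ge0 // ltW.
Qed.

Lemma ex_tilt (R : realType) (h : R -> R) (x : R) (U : set R) :
  {for x, continuous h} -> nbhs (h x) U ->
  exists a : R, [/\ 1 < a, U (h (x / a ^+ 5)) & U (h (x * a ^+ 5))].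
Proof.
move=> hc hU.
have cA : (1 + @harmonic R n) ^+ 5 @[n --> \oo] --> (1 : R).
  have H : 1 + @harmonic R n @[n --> \oo] --> (1 : R).
    rewrite -[X in _ --> X]addr0; apply: cvgD; [exact: cvg_cst|exact: cvg_harmonic].
  by rewrite -[X in _ --> X](expr1n R 5); exact: cvg_exprn.
have c1 : h (x / (1 + @harmonic R n) ^+ 5) @[n --> \oo] --> h x.
  apply: continuous_cvg => //.
  rewrite -[X in _ --> X]divr1; apply: cvgMl_tmp.
  by apply: cvgV => //; exact: oner_neq0.
have c2 : h (x * (1 + @harmonic R n) ^+ 5) @[n --> \oo] --> h x.
  apply: continuous_cvg => //.
  by rewrite -[X in _ --> X]mulr1; apply: cvgMl_tmp.
near \oo => n; exists (1 + harmonic n); split.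
- by rewrite ltrDl /harmonic /= invr_gt0.
- by near: n; exact: c1 U hU.
- by near: n; exact: c2 U hU.
Unshelve. all: by end_near. Qed.

Section transfer.
Context (R : realType) (rs qs : nat -> seq R) (M : nat -> nat -> R).
Context (h : R -> R) (x rho : R).
Hypothesis near_n : \forall n \near \oo,
  [/\ size (rs n) = n, size (qs n) = n, {in rs n, forall r, 0 < r},
      {in qs n, forall r, 0 < r} & (forall k, 0 < M n k) /\
      (forall k, M n n * (epoly (qs n))`_k = M n k * (epoly (rs n))`_k)].
Hypothesis x_gt0 : 0 < x.
Hypothesis rho_gt0 : 0 < rho.
Hypothesis h_cvg : forall y, 0 < y -> n%:R^-1 * hsum (rs n) y @[n --> \oo] --> h y.
Hypothesis h_cont : {for x, continuous h}.
Hypothesis ratio_ge : forall v a, v < h x -> 1 < a ->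
  \forall n \near \oo, forall k, k.+1%:R <= v * n%:R -> rho * M n k <= a * M n k.+1.
Hypothesis ratio_le : forall v a, h x < v -> 1 < a ->
  \forall n \near \oo, forall k, v * n%:R <= k%:R -> M n k.+1 <= a * rho * M n k.

Let hx_le1 : h x <= 1.
Proof.
apply: (cvgr_to_le (h_cvg x_gt0)); near=> n.
have n0 : (0 < n)%N by near: n; exists 1%N.
have [sr _ r0 _ _] : [/\ size (rs n) = n, size (qs n) = n, {in rs n, forall r, 0 < r},
      {in qs n, forall r, 0 < r} & (forall k, 0 < M n k) /\
      (forall k, M n n * (epoly (qs n))`_k = M n k * (epoly (rs n))`_k)] by near: n.
rewrite ler_pdivrMl ?ltr0n // mulr1 -[X in _ <= X%:R]sr.
exact: hsum_le.
Unshelve. all: by end_near. Qed.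

(** The step lemma is applied near k = v n with v slightly below h(x). The number a is fixed first,
    with h(x / a^5) > v; the gap d and the slack e / 2 then absorb the constant (a - 1)^-2 for large
    n. *)
Lemma transfer_ge e : 0 < e -> \forall n \near \oo, h x - e <= n%:R^-1 * hsum (qs n) (x / rho).
Proof.
move=> e0; pose v := h x - e / 2; have y0 : 0 < x / rho by rewrite divr_gt0.
have [v0|v0] := lerP v 0.
  near=> n; apply: (@le_trans _ _ 0); first by rewrite /v in v0; lra.
  have [_ _ _ q0 _] : [/\ size (rs n) = n, size (qs n) = n, {in rs n, forall r, 0 < r},
      {in qs n, forall r, 0 < r} & (forall k, 0 < M n k) /\
      (forall k, M n n * (epoly (qs n))`_k = M n k * (epoly (rs n))`_k)] by near: n.
  by rewrite mulr_ge0 // hsum_ge0.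
have vh : v < h x by rewrite /v; lra.
have v1 : v <= 1 by have := hx_le1; rewrite /v; lra.
have [a [a1 ha _]] := ex_tilt h_cont (lt_nbhsr vh).
have a0 : 0 < a by lra.
pose C := (a - 1) ^- 2; have C0 : 0 <= C by rewrite invr_ge0 sqr_ge0.
have x'0 : 0 < x / a ^+ 5 by rewrite divr_gt0 // exprn_gt0.
pose d := h (x / a ^+ 5) - v; have d0 : 0 < d by rewrite subr_gt0.
near=> n.
have [sr sq r0 q0 [M0 qE]] : [/\ size (rs n) = n, size (qs n) = n, {in rs n, forall r, 0 < r},
      {in qs n, forall r, 0 < r} & (forall k, 0 < M n k) /\
      (forall k, M n n * (epoly (qs n))`_k = M n k * (epoly (rs n))`_k)] by near: n.
have N0 : 0 < n%:R :> R by rewrite ltr0n; near: n; exists 1%N.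
have vn0 : 0 <= v * n%:R by rewrite mulr_ge0 // ltW.
have vn1 : 1 <= v * n%:R.
  by rewrite -ler_pdivrMl // mulr1; near: n; exact: nbhs_infty_ger.
have dn : C <= d / 2 * n%:R.
  by rewrite -ler_pdivrMl ?divr_gt0 //; near: n; exact: nbhs_infty_ger.
have en : 1 + C <= e / 2 * n%:R.
  by rewrite -ler_pdivrMl ?divr_gt0 //; near: n; exact: nbhs_infty_ger.
have hn : v + d / 2 < n%:R^-1 * hsum (rs n) (x / a ^+ 5).
  by near: n; apply: (cvgr_gt _ (h_cvg x'0)); rewrite /d; lra.
have rat k : k.+1%:R <= v * n%:R -> rho * M n k <= a * M n k.+1.
  by move: k; near: n; exact: ratio_ge.
have /andP[Kle Klt] := truncn_itv vn0.
(* The index is k = floor(v n) - 1, so that k + 1 <= v n as [ratio_ge] demands; the floor has to be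
   positive. *)
have K0 : (0 < Num.truncn (v * n%:R))%N by rewrite truncn_gt0.
case: (Num.truncn (v * n%:R)) K0 Kle Klt => // k _ Kle Klt.
have kn : (k < n)%N.
  rewrite -(ltr_nat R); apply: (@lt_le_trans _ _ k.+1%:R); first by rewrite ltr_nat.
  by rewrite (le_trans Kle) // -[leRHS]mul1r ler_pM2r.
have := @transfer_step_ge _ (rs n) (qs n) (M n) k a x rho.
rewrite sr sq => /(_ r0 q0 erefl M0 qE x_gt0 rho_gt0 a1 kn (rat k Kle)).
rewrite -/C ltr_pdivlMl // in hn *.
have k1 : k.+1%:R = k%:R + 1 :> R by rewrite natr1.
have k2 : k.+2%:R = k%:R + 2 :> R by rewrite -natr1 k1; ring.
rewrite k1 in Kle *; rewrite k2 in Klt.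
move=> H; rewrite ler_pdivlMl //; apply: le_trans (H _); first by rewrite /v in Klt; nra.
by apply: le_lt_trans hn; nra.
Unshelve. all: by end_near. Qed.

Lemma transfer_le e : 0 < e -> \forall n \near \oo, n%:R^-1 * hsum (qs n) (x / rho) <= h x + e.
Proof.
move=> e0; pose v := h x + e / 2; have y0 : 0 < x / rho by rewrite divr_gt0.
have [v1|v1] := lerP 1 v.
  near=> n.
  have N0 : 0 < n%:R :> R by rewrite ltr0n; near: n; exists 1%N.
  have [_ sq _ q0 _] : [/\ size (rs n) = n, size (qs n) = n, {in rs n, forall r, 0 < r},
      {in qs n, forall r, 0 < r} & (forall k, 0 < M n k) /\
      (forall k, M n n * (epoly (qs n))`_k = M n k * (epoly (rs n))`_k)] by near: n.
  apply: (@le_trans _ _ 1); last by rewrite /v in v1; lra.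
  by rewrite ler_pdivrMl // mulr1 -[X in _ <= X%:R]sq hsum_le.
have vh : h x < v by rewrite /v; lra.
have [a [a1 _ ha]] := ex_tilt h_cont (lt_nbhsl vh).
have a0 : 0 < a by lra.
pose C := (a - 1) ^- 2; have C0 : 0 <= C by rewrite invr_ge0 sqr_ge0.
have x'0 : 0 < x * a ^+ 5 by rewrite mulr_gt0 // exprn_gt0.
pose d := v - h (x * a ^+ 5); have d0 : 0 < d by rewrite subr_gt0.
have hx0 : 0 <= h x.
  apply: (cvgr_to_ge (h_cvg x_gt0)); near=> n.
  have [_ _ r0 _ _] : [/\ size (rs n) = n, size (qs n) = n, {in rs n, forall r, 0 < r},
      {in qs n, forall r, 0 < r} & (forall k, 0 < M n k) /\
      (forall k, M n n * (epoly (qs n))`_k = M n k * (epoly (rs n))`_k)] by near: n.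
  by rewrite mulr_ge0 // hsum_ge0.
near=> n.
have [sr sq r0 q0 [M0 qE]] : [/\ size (rs n) = n, size (qs n) = n, {in rs n, forall r, 0 < r},
      {in qs n, forall r, 0 < r} & (forall k, 0 < M n k) /\
      (forall k, M n n * (epoly (qs n))`_k = M n k * (epoly (rs n))`_k)] by near: n.
have N0 : 0 < n%:R :> R by rewrite ltr0n; near: n; exists 1%N.
have v0 : 0 <= v by lra.
have vn0 : 0 <= v * n%:R by rewrite mulr_ge0 // ltW.
have vn1 : 1 < (1 - v) * n%:R.
  by rewrite -ltr_pdivrMl ?subr_gt0 // mulr1; near: n; exact: nbhs_infty_gtr.
have dn : C <= d / 2 * n%:R.
  by rewrite -ler_pdivrMl ?divr_gt0 //; near: n; exact: nbhs_infty_ger.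
have en : 1 + C <= e / 2 * n%:R.
  by rewrite -ler_pdivrMl ?divr_gt0 //; near: n; exact: nbhs_infty_ger.
have hn : n%:R^-1 * hsum (rs n) (x * a ^+ 5) < v - d / 2.
  by near: n; apply: (cvgr_lt _ (h_cvg x'0)); rewrite /d; lra.
have rat k : v * n%:R <= k%:R -> M n k.+1 <= a * rho * M n k.
  by move: k; near: n; exact: ratio_le.
have /andP[Kle Klt] := truncn_itv vn0.
(* Here the index is floor(v n) + 1: it lies above v n, as [ratio_le] demands, and below n because
   (1 - v) n > 1. *)
set k := (Num.truncn (v * n%:R)).+1 in Klt.
have k1 : k%:R = (Num.truncn (v * n%:R))%:R + 1 :> R by rewrite natr1.
have kn : (k < n)%N by rewrite -(ltr_nat R) k1; nra.
have := @transfer_step_le _ (rs n) (qs n) (M n) k a x rho.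
rewrite sr sq => /(_ r0 q0 erefl M0 qE x_gt0 rho_gt0 a1 kn (rat k (ltW Klt))).
rewrite -/C ltr_pdivrMl // in hn *.
have k2 : k.+1%:R = k%:R + 1 :> R by rewrite natr1.
rewrite k2.
move=> H; rewrite ler_pdivrMl //; apply: le_trans (H _) _; last by rewrite /v in Kle; nra.
by apply: lt_le_trans hn _; nra.
Unshelve. all: by end_near. Qed.

Lemma transfer_cvg : n%:R^-1 * hsum (qs n) (x / rho) @[n --> \oo] --> h x.
Proof.
apply/cvgrPdist_le => e e0; near=> n; rewrite ler_distlC; apply/andP; split.
  by near: n; exact: transfer_ge.
by near: n; exact: transfer_le.
Unshelve. all: by end_near. Qed.
End transfer.

(** * Ratios of consecutive multipliers *)

Section lp_ratio.
Context (R : realType) (f : nat -> LPfun R) (c t : R)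
    (Sigma : {finite_measure set (measurableTypeR R) -> \bar R}).
Hypothesis f_neg : forall n, (0 < n)%N -> forall x : R, f n x = 0 -> x < 0.
Hypothesis f_adm : admissible f c Sigma.
Hypothesis t_gt0 : 0 < t.

Let m n := Num.truncn (t * n%:R).

Let alpha_le0 n : (0 < n)%N -> forall j, lp_alpha (f n) j <= 0.
Proof. by move=> n0; apply: lp_alpha_le0; exact: f_neg. Qed.

Let m_cvg : m n @[n --> \oo] --> \oo.
Proof.
move=> A [N _ NA]; suff : \forall n \near \oo, (N <= m n)%N by apply: filterS => n; exact: NA.
near=> n; rewrite -ltnS -(ltr_nat R); apply: (@le_lt_trans _ _ (t * n%:R)).
  by rewrite -ler_pdivrMl //; near: n; exact: nbhs_infty_ger.
by have /andP[] := truncn_itv (mulr_ge0 (ltW t_gt0) (ler0n R n)).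
Unshelve. all: by end_near. Qed.

Let m_gt0 : \forall n \near \oo, (0 < m n)%N.
Proof.
have H : \forall k \near \oo, (0 < k)%N by exists 1%N.
exact: m_cvg H.
Qed.

Let drift_cvg u : 0 < u ->
  expR (- (t * lp_drift (f (m n)) ((m n)%:R * u))) @[n --> \oo] -->
  expR (- (t * Rtransform c Sigma u)).
Proof.
move=> u0; apply: cvg_expR; apply: cvgN; apply: cvgMl_tmp.
exact: (@cvg_comp _ _ _ m (fun n => lp_drift (f n) (n%:R * u)) _ _ _ m_cvg
  (admissible_drift alpha_le0 f_adm u0)).
Qed.

(** For k + 1 <= v n with v < u, the point t (k + 1) lies below m u for large n: the floor in m
    costs at most u, less than the slack t (u - v) n. Monotonicity then bounds the drift at t (k +
    1) by its value at m u, uniformly in k. *)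
Lemma lp_ratio_ge u v a : 0 < u -> v < u -> 1 < a ->
  \forall n \near \oo, forall k, k.+1%:R <= v * n%:R ->
    expR (- (t * Rtransform c Sigma u)) * f (m n) (t * k%:R) <=
    a * f (m n) (t * k.+1%:R).
Proof.
move=> u0 vu a1; have a0 : 0 < a by lra.
set rho := expR _; have rho0 : 0 < rho by exact: expR_gt0.
have rhoa : rho / a < rho by rewrite ltr_pdivrMr // ltr_pMr.
near=> n => k kv.
have m0 : (0 < m n)%N by near: n; exact: m_gt0.
have al := alpha_le0 m0.
have tk0 : 0 <= t * k%:R by rewrite mulr_ge0 // ltW.
have tkk : t * k%:R <= t * k.+1%:R by rewrite ler_pM2l // ler_nat.
have [H _] := lp_ratio al tk0 tkk.
have mu : t * k.+1%:R <= (m n)%:R * u.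
  have /andP[_] := truncn_itv (mulr_ge0 (ltW t_gt0) (ler0n R n)).
  rewrite -/(m n) -natr1 => mt.
  have nb : u <= t * (u - v) * n%:R.
    rewrite -ler_pdivrMl ?mulr_gt0 ?subr_gt0 //; near: n; exact: nbhs_infty_ger.
  have : t * k.+1%:R <= t * (v * n%:R) by rewrite ler_pM2l.
  by nra.
have D := lp_drift_mono al (le_trans tk0 tkk) mu.
have E : rho / a < expR (- (t * lp_drift (f (m n)) ((m n)%:R * u))).
  by near: n; exact: (cvgr_gt _ (drift_cvg u0)).
have f0 : 0 < f (m n) (t * k%:R) by exact: lp_eval_gt0.
have -> : rho * f (m n) (t * k%:R) = a * (f (m n) (t * k%:R) * (rho / a)).
  by field; rewrite gt_eqF.
rewrite ler_pM2l //; apply: le_trans H.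
rewrite ler_pM2l //; apply: le_trans (ltW E) _.
rewrite ler_expR lerN2 -mulrBr -natr1 addrAC subrr add0r mulr1.
by rewrite ler_pM2l // natr1.
Unshelve. all: by end_near. Qed.

(** In this direction the floor is harmless: m u <= t n u <= t n v <= t k. *)
Lemma lp_ratio_le u v a : 0 < u -> u < v -> 1 < a ->
  \forall n \near \oo, forall k, v * n%:R <= k%:R ->
    f (m n) (t * k.+1%:R) <=
    a * expR (- (t * Rtransform c Sigma u)) * f (m n) (t * k%:R).
Proof.
move=> u0 uv a1; have a0 : 0 < a by lra.
set rho := expR _; have rho0 : 0 < rho by exact: expR_gt0.
have rhoa : rho < a * rho by rewrite ltr_pMl.
near=> n => k kv.
have m0 : (0 < m n)%N by near: n; exact: m_gt0.
have al := alpha_le0 m0.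
have tk0 : 0 <= t * k%:R by rewrite mulr_ge0 // ltW.
have tkk : t * k%:R <= t * k.+1%:R by rewrite ler_pM2l // ler_nat.
have [_ H] := lp_ratio al tk0 tkk.
have mu0 : 0 <= (m n)%:R * u by rewrite mulr_ge0 // ltW.
have mu : (m n)%:R * u <= t * k%:R.
  have /andP[mt _] := truncn_itv (mulr_ge0 (ltW t_gt0) (ler0n R n)).
  rewrite -/(m n) in mt.
  have : t * (v * n%:R) <= t * k%:R by rewrite ler_pM2l.
  have : (m n)%:R * u <= t * n%:R * u by rewrite ler_pM2r.
  have : t * n%:R * u <= t * n%:R * v.
    by rewrite ler_wpM2l ?(ltW uv) // mulr_ge0 // ltW.
  by lra.
have D := lp_drift_mono al mu0 mu.
have E : expR (- (t * lp_drift (f (m n)) ((m n)%:R * u))) < a * rho.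
  by near: n; exact: (cvgr_lt _ (drift_cvg u0)).
have f0 : 0 < f (m n) (t * k%:R) by exact: lp_eval_gt0.
apply: le_trans H _; rewrite mulrC ler_pM2r //; apply: le_trans (ltW E).
rewrite ler_expR lerN2 -mulrBr -natr1 addrAC subrr add0r mulr1.
by rewrite ler_pM2l.
Unshelve. all: by end_near. Qed.
End lp_ratio.

Lemma htrans_gt0 (R : realType) (mu : probability (measurableTypeR R) R) (x : R) :
  on_nonneg mu -> 0 < x -> 0 < htrans mu x.
Proof.
move=> mu0 x0; rewrite lt_neqAle eq_sym; apply/andP; split; last first.
  by apply: Rintegral_ge0 => r _; exact/ltW/hker_gt0.
apply/eqP => h0.
have H : is_delta0 mu.
  apply: (null_is_delta0 mu0 (continuous_hker x0) (fun r => hker_norm r x0)) => //.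
  - by move=> r; exact/ltW/hker_gt0.
  - by move=> r _; exact: hker_gt0.
by have := is_delta0_htrans H x0; rewrite h0 => /eqP; rewrite eq_sym oner_eq0.
Qed.

Section core.
Context (R : realType) (f : nat -> LPfun R) (c t : R)
    (Sigma : {finite_measure set (measurableTypeR R) -> \bar R})
    (p : nat -> {poly R[i]}) (mu : probability (measurableTypeR R) R).
Hypothesis f_neg : forall n, (0 < n)%N -> forall x : R, f n x = 0 -> x < 0.
Hypothesis f_adm : admissible f c Sigma.
Hypothesis t_ge0 : 0 <= t.
Hypothesis p_deg : forall n, (0 < n)%N -> size (p n) = n.+1.
Hypothesis p_pos : forall n, (0 < n)%N -> forall w : R[i], root (p n) w -> 0 < w.
Hypothesis mu_nonneg : on_nonneg mu.
Hypothesis p_cvg : weak_cvg (fun n => root_measure n (p n)) mu.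

Let m n := Num.truncn (t * n%:R).
Let M n k : R := f (m n) (t * k%:R).
Let q n := euler_op (f (m n)) t (p n).

Let qE n : q n = mulop (M n) (p n). Proof. by []. Qed.

Let p_posrooted n : (0 < n)%N -> posrooted (p n).
Proof.
move=> n0; split; last exact: p_pos.
by rewrite -size_poly_eq0 p_deg.
Qed.

Let M_preserving : \forall n \near \oo, preserving (M n).
Proof.
(* For t = 0 the function is always f 0, whose zeros are unrestricted, but it is evaluated only at
   0, where it equals 1. *)
have [t0|t0] := eqVneq t 0.
  apply: nearW => n; rewrite (_ : M n = fun=> 1); first exact: preserving1.
  by apply/funext => k; rewrite /M t0 mul0r lp_eval0.
have tpos : 0 < t by rewrite lt_neqAle eq_sym t0.
near=> n; apply: preserving_lp => //; apply: lp_alpha_le0; apply: f_neg.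
rewrite truncn_gt0 -ler_pdivrMl // mulr1; near: n; exact: nbhs_infty_ger.
Unshelve. all: by end_near. Qed.

Lemma euler_op_posrooted : \forall n \near \oo, posrooted (q n).
Proof.
near=> n; have [_] : preserving (M n) by near: n; exact: M_preserving.
by apply; apply: p_posrooted; near: n; exists 1%N.
Unshelve. all: by end_near. Qed.

Lemma euler_op_size : \forall n \near \oo, size (rroots (q n)) = n.
Proof.
near=> n; have [M0 Mp] : preserving (M n) by near: n; exact: M_preserving.
have n0 : (0 < n)%N by near: n; exists 1%N.
have [_ _ _ ->] := rrootsP (Mp _ (p_posrooted n0)).
by rewrite size_mulop // p_deg.
Unshelve. all: by end_near. Qed.

Lemma euler_op_htrans x : 0 < x ->
  n%:R^-1 * hsum (rroots (q n)) (x / expR (- (t * Rtransform c Sigma (htrans mu x))))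
    @[n --> \oo] --> htrans mu x.
Proof.
move=> x0; have u0 := htrans_gt0 mu_nonneg x0.
apply: (@transfer_cvg R (fun n => rroots (p n)) (fun n => rroots (q n)) M (htrans mu)) => //.
- near=> n; have Mn : preserving (M n) by near: n; exact: M_preserving.
  have n0 : (0 < n)%N by near: n; exists 1%N.
  have pp := p_posrooted n0.
  have qp : posrooted (q n) by exact: Mn.2.
  have [r0 _ _ sr] := rrootsP pp; have [s0 _ _ _] := rrootsP qp.
  split => //; first by rewrite sr p_deg.
    by near: n; exact: euler_op_size.
  split; first exact: Mn.1.
  by move=> k; have := epoly_mulop k Mn pp; rewrite p_deg.
- exact: expR_gt0.
- by move=> y y0; exact: weak_cvg_htrans.
- exact: htrans_continuous.
- move=> v a vu a1; have [t0|t0] := eqVneq t 0.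
    apply: nearW => n k _; rewrite /M t0 !mul0r !lp_eval0 oppr0 expR0 !mulr1.
    exact: ltW.
  by apply: lp_ratio_ge => //; rewrite lt_neqAle eq_sym t0.
- move=> v a vu a1; have [t0|t0] := eqVneq t 0.
    apply: nearW => n k _; rewrite /M t0 !mul0r !lp_eval0 oppr0 expR0 !mulr1.
    exact: ltW.
  by apply: lp_ratio_le => //; rewrite lt_neqAle eq_sym t0.
Unshelve. all: by end_near. Qed.
End core.

(** * Riemann sums of monotone functions *)

Lemma measurable_inv (R : realType) :
  measurable_fun [set: measurableTypeR R] ((fun x => x^-1) : R -> R).
Proof.
rewrite (_ : setT = ~` [set 0] `|` [set 0]); last by rewrite setUC setUCr.
have oD : open (~` [set 0 : R]) by apply: closed_openC; exact: closed_eq.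
have mD : measurable (~` [set 0] : set (measurableTypeR R)) by exact: open_measurable.
have mE : measurable ([set 0] : set (measurableTypeR R)) by exact: measurable_set1.
apply: (measurable_funU _ mD mE).2; split; last exact: measurable_fun_set1.
apply: open_continuous_measurable_fun => // x; rewrite inE /= => /eqP x0.
by apply: cvgV => //; exact: cvg_id.
Qed.

Section uniform.
Context (R : realType).
Local Notation P := (uniform_prob (@ltr01 R) : probability (measurableTypeR R) R).

Lemma uniform_itv (a b : R) : 0 <= a -> a <= b -> b <= 1 -> P `[a, b[%classic = (b - a)%:E.
Proof.
move=> a0 ab b1.
have mA : measurable (`[a, b[%classic : set (measurableTypeR R)) by exact: measurable_itv.
have := integral_indic P measurableT mA; rewrite setIT => <-.
rewrite integral_uniform; last 2 first.
- by apply/measurable_EFinP; exact: measurable_indic.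
- by move=> x; rewrite lee_fin.
rewrite subr0 invr1 mul1e integral_indic // (_ : _ `&` _ = `[a, b[%classic).
  have [ab'|ab'] := eqVneq a b.
    by rewrite ab' subrr set_itvco0 measure0.
  by rewrite [LHS](lebesgue_measure_itv `[a, b[) /= lte_fin lt_neqAle ab' ab EFinB.
apply/seteqP; split=> [x [] //|x]; rewrite /= !in_itv /= => /andP[ax xb].
by split; [rewrite ax xb|rewrite (le_trans a0 ax) (le_trans (ltW xb) b1)].
Qed.

Lemma uniform_co : P (~` `[0, 1[%classic) = 0%E.
Proof.
rewrite probability_setC; last exact: measurable_itv.
by rewrite uniform_itv ?subr0 ?subee.
Qed.

Lemma step_integral (A : nat -> set (measurableTypeR R)) (c : nat -> R) N :
  (forall i, measurable (A i)) ->
  P.-integrable setT (EFin \o (fun s => \sum_(i < N) c i * \1_(A i) s)) /\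
  Rintegral P setT (fun s => \sum_(i < N) c i * \1_(A i) s) =
  \sum_(i < N) c i * fine (P (A i)).
Proof.
move=> mA.
have Ii i : P.-integrable setT (EFin \o (\1_(A i) : R -> R)).
  apply: (@bounded_integrable _ _ _ 1); first by rewrite ltey_eq fin_num_measure.
    by apply: measurable_indic; exact: mA.
  by move=> x; rewrite ger0_norm // indicE; case: (_ \in _).
have IZ i : P.-integrable setT (EFin \o (fun s => c i * \1_(A i) s)).
  have := integrableZl measurableT (c i) (Ii i).
  by congr (integrable _ _ _); apply/funext => s; rewrite /= EFinM.
elim: N => [|N [IN EN]].
  under eq_fun do rewrite big_ord0; rewrite big_ord0.
  split; last by rewrite (Rintegral_prob_cst P).
  by apply: (@prob_integrable _ P _ 0) => [|x]; [exact: cst_continuous|rewrite normr0].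
under eq_fun do rewrite big_ord_recr /=; rewrite big_ord_recr /=.
split; first by apply: (integrableD measurableT IN (IZ N)).
rewrite RintegralD // EN RintegralZl //; congr (_ + _ * _).
by rewrite /Rintegral integral_indic // setIT.
Qed.

Definition riemann (g : R -> R) (N : nat) : R := N%:R^-1 * \sum_(i < N) g (i%:R / N%:R).

Let cell N i : set (measurableTypeR R) := `[i%:R / N%:R, i.+1%:R / N%:R[%classic.

Let cellP N i (s : R) : (0 < N)%N -> 0 <= s ->
  cell N i s <-> i = Num.truncn (s * N%:R).
Proof.
move=> N0 s0; have N0' : 0 < N%:R :> R by rewrite ltr0n.
rewrite /cell /= in_itv /= ler_pdivrMr // ltr_pdivlMr //.
have sN : 0 <= s * N%:R by rewrite mulr_ge0.
split; first by move=> H; apply/esym/eqP; rewrite truncn_eq.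
by move=> ->; exact: truncn_itv.
Qed.

Let cell_indic N (c : nat -> R) (s : R) : (0 < N)%N -> 0 <= s < 1 ->
  \sum_(i < N) c i * \1_(cell N i) s = c (Num.truncn (s * N%:R)).
Proof.
move=> N0 /andP[s0 s1]; have N0' : 0 < N%:R :> R by rewrite ltr0n.
have sN : 0 <= s * N%:R by rewrite mulr_ge0.
have iN : (Num.truncn (s * N%:R) < N)%N.
  rewrite -(ltr_nat R); have /andP[H _] := truncn_itv sN.
  by rewrite (le_lt_trans H) // gtr_pMl.
rewrite (bigD1 (Ordinal iN)) //= indicE mem_set ?mulr1; last exact/cellP.
rewrite big1 ?addr0 // => i /eqP ineq; rewrite indicE memNset ?mulr0 // => /(cellP _ N0 s0) E.
by apply: ineq; apply: val_inj.
Qed.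

Let cell_indic0 N (c : nat -> R) (s : R) : (0 < N)%N -> ~~ (0 <= s < 1) ->
  \sum_(i < N) c i * \1_(cell N i) s = 0.
Proof.
move=> N0 sn; have N0' : 0 < N%:R :> R by rewrite ltr0n.
rewrite big1 // => i _; rewrite indicE memNset ?mulr0 // /cell /= in_itv /= => /andP[a b].
move: sn; rewrite (le_trans _ a) ?divr_ge0 //= => /negP; apply.
by rewrite (lt_le_trans b) // ler_pdivrMr // mul1r ler_nat ltn_ord.
Qed.

Let P_cell N i : (i < N)%N -> fine (P (cell N i)) = N%:R^-1.
Proof.
move=> iN; have N0' : 0 < N%:R :> R by rewrite ltr0n (leq_ltn_trans _ iN).
rewrite uniform_itv.
- by rewrite /= -mulrBl -natr1 addrAC subrr add0r mul1r.
- by rewrite divr_ge0.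
- by rewrite ler_pM2r ?invr_gt0 // ler_nat.
- by rewrite ler_pdivrMr // mul1r ler_nat.
Qed.

(** The upper and lower sums telescope to a gap of at most 1 / N. The bound is uniform in g, which
    later justifies exchanging integral and limit. *)
Lemma riemann_antitone (g : R -> R) N : (0 < N)%N ->
  measurable_fun [set: measurableTypeR R] g ->
  (forall x y, x <= y -> g y <= g x) -> (forall x, 0 <= g x <= 1) ->
  `|Rintegral P setT g - riemann g N| <= N%:R^-1.
Proof.
move=> N0 mg ga g01; have N0' : 0 < N%:R :> R by rewrite ltr0n.
have mc i : measurable (cell N i) by exact: measurable_itv.
have Pfin : (P setT < +oo)%E by rewrite ltey_eq fin_num_measure.
have Ig : P.-integrable setT (EFin \o g).
  apply: (@bounded_integrable _ _ _ 1) => // x.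
  by have /andP[? ?] := g01 x; rewrite ger0_norm.
have [Iu Eu] := step_integral (fun i => g (i%:R / N%:R)) N mc.
have [Il El] := step_integral (fun i => g (i.+1%:R / N%:R)) N mc.
have S (c : nat -> R) : \sum_(i < N) c i * fine (P (cell N i)) = N%:R^-1 * \sum_(i < N) c i.
  by rewrite mulr_sumr; apply: eq_bigr => i _; rewrite P_cell // mulrC.
have {}Eu := etrans Eu (S (fun i => g (i%:R / N%:R))).
have {}El := etrans El (S (fun i => g (i.+1%:R / N%:R))).
(* Outside [[0, 1[] the step functions vanish but g need not; adding the indicator of this null set
   restores the upper bound pointwise. *)
pose B : set (measurableTypeR R) := ~` `[0, 1[%classic.
have mB : measurable B by apply: measurableC; exact: measurable_itv.
have PB : P B = 0%E by exact: uniform_co.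
have IB : P.-integrable setT (EFin \o (\1_B : R -> R)).
  apply: (@bounded_integrable _ _ _ 1); [exact: Pfin|by apply: measurable_indic|].
  by move=> x; rewrite ger0_norm // indicE; case: (_ \in _).
have upper : Rintegral P setT g <= riemann g N.
  rewrite /riemann -Eu.
  have -> : Rintegral P setT (fun s => \sum_(i < N) g (i%:R / N%:R) * \1_(cell N i) s) =
      Rintegral P setT (fun s => \sum_(i < N) g (i%:R / N%:R) * \1_(cell N i) s + \1_B s).
    rewrite RintegralD // [X in _ = _ + X](_ : _ = 0) ?addr0 //.
    rewrite /Rintegral (integral_indic P measurableT mB) setIT.
    exact: (congr1 fine PB).
  apply: le_Rintegral => //; first exact: (integrableD measurableT Iu IB).
  move=> s _; have [s01|s01] := boolP (0 <= s < 1).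
    rewrite (cell_indic (fun i => g (i%:R / N%:R))) // indicE memNset ?addr0; last first.
      by move=> H; apply: H; rewrite /= in_itv /= s01.
    apply: ga; rewrite ler_pdivrMr //; have /andP[s0 _] := s01.
    by have /andP[] := truncn_itv (mulr_ge0 s0 (ltW N0')).
  rewrite (cell_indic0 (fun i => g (i%:R / N%:R))) // indicE mem_set /=.
    by rewrite add0r; have /andP[] := g01 s.
  by rewrite /B /= in_itv /=; apply/negP.
have lower : N%:R^-1 * \sum_(i < N) g (i.+1%:R / N%:R) <= Rintegral P setT g.
  rewrite -El; apply: le_Rintegral => // s _.
  have [s01|s01] := boolP (0 <= s < 1).
    rewrite (cell_indic (fun i => g (i.+1%:R / N%:R))) //.
    apply: ga; rewrite ler_pdivlMr // ltW //; have /andP[s0 _] := s01.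
    by have /andP[] := truncn_itv (mulr_ge0 s0 (ltW N0')).
  rewrite (cell_indic0 (fun i => g (i.+1%:R / N%:R))) //.
  by have /andP[] := g01 s.
have tele K : \sum_(i < K) g (i%:R / N%:R) - \sum_(i < K) g (i.+1%:R / N%:R) =
    g (0%:R / N%:R) - g (K%:R / N%:R).
  elim: K => [|K IH]; first by rewrite !big_ord0 !subrr.
  rewrite !big_ord_recr /= opprD addrACA IH; ring.
have gap : riemann g N - N%:R^-1 <= N%:R^-1 * \sum_(i < N) g (i.+1%:R / N%:R).
  rewrite /riemann lerBlDr -[X in _ <= _ + X]mulr1 -mulrDr ler_pM2l ?invr_gt0 //.
  rewrite -lerBlDl tele lerBlDr.
  by have /andP[_ ?] := g01 (0%:R / N%:R); have /andP[? _] := g01 (N%:R / N%:R); lra.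
by rewrite ler_distl; apply/andP; split; lra.
Qed.
End uniform.

(** * Limits of empirical measures *)

Lemma fmap_ultra (S T : Type) (F : set_system S) (h : S -> T) :
  UltraFilter F -> UltraFilter (fmap h F).
Proof.
move=> FU; split; first exact: fmap_proper_filter.
move=> G GF FG; rewrite predeqE => A; split; last exact: FG.
move=> GA; have [//|FnA] := in_ultra_setVsetC (h @^-1` A) FU.
have GnA : G (~` A) by exact: FG.
by have := filter_not_empty G; rewrite -(setICr A); case; exact: filterI.
Qed.

(** This is y / (y + r) in the coordinate w = 1 / (1 + r); it stays continuous at w = 0, that is at
    r = oo. *)
Definition kappa (R : realType) (y w : R) : R := y * w / (y * w + (1 - w)).

Lemma kappa_den_gt0 (R : realType) (y w : R) : 0 < y -> 0 <= w <= 1 -> 0 < y * w + (1 - w).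
Proof. by move=> y0 /andP[w0 w1]; have [->|w0'] := eqVneq w 0; nra. Qed.

Lemma kappa01 (R : realType) (y w : R) : 0 < y -> 0 <= w <= 1 -> 0 <= kappa y w <= 1.
Proof.
move=> y0 w01; have d0 := kappa_den_gt0 y0 w01; have /andP[w0 w1] := w01.
have yw : 0 <= y * w by rewrite mulr_ge0 // ltW.
by rewrite /kappa divr_ge0 ?(ltW d0) //= ler_pdivrMr // mul1r; lra.
Qed.

Lemma kappa_le (R : realType) (y w v : R) : 0 < y -> 0 <= w -> w <= v -> v <= 1 ->
  kappa y w <= kappa y v.
Proof.
move=> y0 w0 wv v1.
have dw : 0 < y * w + (1 - w) by apply: kappa_den_gt0 => //; rewrite w0 (le_trans wv).
have dv : 0 < y * v + (1 - v) by apply: kappa_den_gt0 => //; rewrite v1 (le_trans w0).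
rewrite /kappa ler_pdivrMr // mulrAC ler_pdivlMr //.
by have := ler_wpM2l (ltW y0) wv; lra.
Qed.

Lemma kappa_hker (R : realType) (y r : R) : 0 < y -> 0 <= r -> kappa y (1 + r)^-1 = hker y r.
Proof.
move=> y0 r0; rewrite /kappa /hker max_l //; field.
by rewrite !gt_eqF //; lra.
Qed.

Section quantile.
Context (R : realType) (qs : nat -> seq R).
Local Notation P := (uniform_prob (@ltr01 R) : probability (measurableTypeR R) R).

(* The quantile function of the empirical measure of [qs n], transported to [0, 1]
   by [r |-> 1 / (1 + r)] so that limits along an ultrafilter always exist. *)
Definition quantile (n : nat) (s : R) : R :=
  if s < 0 then 1 else if 1 <= s then 0 else
  (1 + nth 0 (sort <=%R (qs n)) (Num.truncn (s * n%:R)))^-1.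

Section finite.
Variable n : nat.
Hypothesis n_gt0 : (0 < n)%N.
Hypothesis qs_size : size (qs n) = n.
Hypothesis qs_gt0 : {in qs n, forall r, 0 < r}.

Let index_lt (s : R) : 0 <= s -> s < 1 -> (Num.truncn (s * n%:R) < n)%N.
Proof.
move=> s0 s1; have N0 : 0 < n%:R :> R by rewrite ltr0n.
rewrite -(ltr_nat R); have /andP[H _] := truncn_itv (mulr_ge0 s0 (ltW N0)).
by rewrite (le_lt_trans H) // gtr_pMl.
Qed.

Let nth_gt0 i : (i < n)%N -> 0 < nth 0 (sort <=%R (qs n)) i.
Proof.
move=> i_n; apply: qs_gt0; rewrite -(mem_sort <=%R) mem_nth //.
by rewrite size_sort qs_size.
Qed.

Let quantileE (s : R) : 0 <= s -> s < 1 ->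
  quantile n s = (1 + nth 0 (sort <=%R (qs n)) (Num.truncn (s * n%:R)))^-1.
Proof. by move=> s0 s1; rewrite /quantile (le_gtF s0) (lt_geF s1). Qed.

Lemma quantile01 (s : R) : 0 <= quantile n s <= 1.
Proof.
have [s0|s0] := ltP s 0; first by rewrite /quantile s0 ler01 lexx.
have [s1|s1] := leP 1 s; first by rewrite /quantile (le_gtF s0) s1 lexx ler01.
have r0 := nth_gt0 (index_lt s0 s1).
by rewrite quantileE // invr_ge0 invf_le1; lra.
Qed.

(** The values 1 to the left of [[0, 1[] and 0 to the right extend the monotonicity to the whole
    line, which also yields measurability. *)
Lemma quantile_antitone (s s' : R) : s <= s' -> quantile n s' <= quantile n s.
Proof.
move=> ss'; have /andP[q0 q1] := quantile01 s; have /andP[q0' q1'] := quantile01 s'.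
have [s0|s0] := ltP s 0; first by rewrite [leRHS]/quantile s0.
have s0' := le_trans s0 ss'.
have [s1'|s1'] := leP 1 s'; first by rewrite [leLHS]/quantile (le_gtF s0') s1'.
have s1 := le_lt_trans ss' s1'.
have i1 := index_lt s0 s1; have i2 := index_lt s0' s1'.
have r1 := nth_gt0 i1; have r2 := nth_gt0 i2.
rewrite !quantileE // lef_pV2 ?posrE; [|lra|lra].
rewrite lerD2l; apply: (sorted_leq_nth le_trans lexx) => //.
- by apply: sort_sorted; exact: le_total.
- by rewrite inE size_sort qs_size.
- by rewrite inE size_sort qs_size.
- by apply: le_truncn; rewrite ler_wpM2r.
Qed.

(** With as many nodes as roots, the Riemann sum visits every root exactly once. *)
Lemma riemann_quantile y : 0 < y ->
  riemann (fun s => kappa y (quantile n s)) n = n%:R^-1 * hsum (qs n) y.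
Proof.
move=> y0; have N0 : 0 < n%:R :> R by rewrite ltr0n.
rewrite /riemann; congr (_ * _).
have pq : perm_eq (sort <=%R (qs n)) (qs n) by rewrite perm_sort.
rewrite /hsum -(perm_big _ pq) /= (big_nth 0) big_mkord size_sort qs_size.
apply: eq_bigr => i _; rewrite /quantile ltNge divr_ge0 //= leNgt.
have -> : i%:R / n%:R < 1 :> R by rewrite ltr_pdivrMr // mul1r ltr_nat.
rewrite /= divfK ?gt_eqF // natrK.
have r0 := nth_gt0 (ltn_ord i).
by rewrite kappa_hker ?(ltW r0) // /hker max_l // ltW.
Qed.
End finite.
End quantile.

(** The measure is the law of 1 / W - 1 under the uniform distribution, where W is the pointwise
    limit of the transported quantile functions. The last hypothesis is tightness: L comes
    arbitrarily close to 1. *)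
Lemma limit_measure (R : realType) (qs : nat -> seq R) (Y : set R) (L : R -> R) :
  (\forall n \near \oo, size (qs n) = n /\ {in qs n, forall r, 0 < r}) ->
  (forall y, Y y -> 0 < y /\ n%:R^-1 * hsum (qs n) y @[n --> \oo] --> L y) ->
  (forall e, 0 < e -> exists2 y, Y y & 1 - e < L y) ->
  exists nu : probability (measurableTypeR R) R,
    on_nonneg nu /\ forall y, Y y -> htrans nu y = L y.
Proof.
move=> near_qs cvL tight.
pose P : probability (measurableTypeR R) R := uniform_prob (@ltr01 R).
(* Along an ultrafilter, compactness of [0, 1] gives a limit at every s simultaneously. *)
have [U [UU ooU]] := ultraFilterLemma (@eventually_filter).
have UF : ProperFilter U by exact: ultra_proper.
have good : \forall n \near U, [/\ (0 < n)%N, size (qs n) = n & {in qs n, forall r, 0 < r}].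
  apply: ooU; near=> n.
  have [? ?] : size (qs n) = n /\ {in qs n, forall r, 0 < r} by near: n.
  by split => //; near: n; exists 1%N.
have /choice[W HW] : forall s : R, exists w : R, 0 <= w <= 1 /\ quantile qs n s @[n --> U] --> w.
  move=> s; have := @segment_compact R 0 1; rewrite compact_ultra.
  move=> /(_ (quantile qs n s @[n --> U]) (fmap_ultra _ UU))[].
    have H : \forall n \near U, `[0, 1]%classic (quantile qs n s).
      by apply: filterS good => n [n0 sn r0] /=; rewrite in_itv /=; exact: quantile01.
    exact: H.
  by move=> w [w01 cw]; exists w; split=> //; move: w01; rewrite /= in_itv.
have W01 s : 0 <= W s <= 1 by have [] := HW s.
have Wc s : quantile qs n s @[n --> U] --> W s by have [] := HW s.
have Wanti s s' : s <= s' -> W s' <= W s.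
  move=> ss'; apply: (ler_cvg_to (Wc s') (Wc s)); apply: filterS good => n [n0 sn r0].
  exact: quantile_antitone.
have mW : measurable_fun [set: measurableTypeR R] W.
  have H : measurable_fun [set: measurableTypeR R] (fun s => - W s).
    by apply: nondecreasing_measurable => // s s' ss'; rewrite lerN2 Wanti.
  have := measurable_funN H; congr (measurable_fun _ _).
  by apply/funext => s /=; rewrite opprK.
pose g y s := kappa y (W s).
have g01 y s : 0 < y -> 0 <= g y s <= 1 by move=> y0; exact: kappa01.
have ganti y s s' : 0 < y -> s <= s' -> g y s' <= g y s.
  move=> y0 ss'; have /andP[? ?] := W01 s; have /andP[? ?] := W01 s'.
  by apply: kappa_le => //; exact: Wanti.
have mg y : 0 < y -> measurable_fun [set: measurableTypeR R] (g y).
  move=> y0; have H : measurable_fun [set: measurableTypeR R] (fun s => - g y s).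
    by apply: nondecreasing_measurable => // s s' ss'; rewrite lerN2 ganti.
  have := measurable_funN H; congr (measurable_fun _ _).
  by apply/funext => s /=; rewrite opprK.
have gc y s : 0 < y -> kappa y (quantile qs n s) @[n --> U] --> g y s.
  move=> y0; apply: cvgM; first by apply: cvgMl_tmp; exact: Wc.
  apply: cvgV; first by rewrite gt_eqF // kappa_den_gt0.
  by apply: cvgD; [apply: cvgMl_tmp|apply: cvgB; [exact: cvg_cst|]]; exact: Wc.
(* [harmonic n] is 1 / (n + 1); the bound 1 / n <= 2 / (n + 1) accounts for the shift. *)
have invU : n%:R^-1 @[n --> U] --> (0 : R).
  have c0 : @harmonic R n @[n --> U] --> (0 : R).
    by apply: cvg_trans (@cvg_harmonic R); exact: cvg_app ooU.
  have c1 : 2 * @harmonic R n @[n --> U] --> (2 * 0 : R) by exact: cvgMl_tmp.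
  rewrite mulr0 in c1.
  apply: (squeeze_cvgr _ (cvg_cst (0 : R)) c1).
  apply: filterS good => n [n0 _ _]; rewrite invr_ge0 ler0n /= /harmonic.
  have n1 : 1 <= n%:R :> R by rewrite ler1n.
  have n2 : 0 < n%:R :> R by lra.
  have -> : n.+1%:R = n%:R + 1 :> R by rewrite natr1.
  by rewrite ler_pdivlMr ?ltr_pwDr // mulrC ler_pdivrMr //; lra.
(* For fixed n, the sums with N nodes and with n nodes approximate the same integral within 1 / N
   and 1 / n, and the latter is the average over [qs n]. Then n goes to infinity along U with N
   fixed. *)
have gL y N : Y y -> (0 < N)%N -> `|riemann (g y) N - L y| <= N%:R^-1.
  move=> Yy N0; have [y0 cy] := cvL y Yy.
  have c1 : riemann (fun s => kappa y (quantile qs n s)) N @[n --> U] --> riemann (g y) N.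
    apply: cvgMl_tmp; apply: (cvg_big (op := +%R)); first exact: add_continuous.
    by move=> i _; exact: gc.
  have c2 : n%:R^-1 * hsum (qs n) y @[n --> U] --> L y.
    by apply: cvg_trans cy; exact: cvg_app ooU.
  have c3 : `|riemann (fun s => kappa y (quantile qs n s)) N - n%:R^-1 * hsum (qs n) y|
      @[n --> U] --> `|riemann (g y) N - L y| by apply: cvg_norm; exact: cvgB.
  have c4 : N%:R^-1 + n%:R^-1 @[n --> U] --> (N%:R^-1 + 0 : R).
    by apply: cvgD; [exact: cvg_cst|exact: invU].
  rewrite -[leRHS]addr0; apply: (ler_cvg_to c3 c4); apply: filterS good => n [n0 sn r0].
  rewrite -(riemann_quantile n0 sn r0 y0); set h := fun s => kappa y (quantile qs n s).
  have ha s s' : s <= s' -> h s' <= h s.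
    move=> ss'; have /andP[? ?] := quantile01 n0 sn r0 s.
    have /andP[? ?] := quantile01 n0 sn r0 s'.
    by apply: kappa_le => //; exact: quantile_antitone.
  have h01 s : 0 <= h s <= 1 by apply: kappa01 => //; exact: quantile01.
  have mh : measurable_fun [set: measurableTypeR R] h.
    have H : measurable_fun [set: measurableTypeR R] (fun s => - h s).
      by apply: nondecreasing_measurable => // s s' ss'; rewrite lerN2 ha.
    have := measurable_funN H; congr (measurable_fun _ _).
    by apply/funext => s /=; rewrite opprK.
  have := riemann_antitone N0 mh ha h01; have := riemann_antitone n0 mh ha h01.
  by rewrite !ler_distl => /andP[? ?] /andP[? ?]; apply/andP; split; lra.
have intg y : Y y -> Rintegral P setT (g y) = L y.
  move=> Yy; have [y0 cy] := cvL y Yy.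
  have E N : `|Rintegral P setT (g y) - L y| <= 2 * N.+1%:R^-1.
    have := riemann_antitone (ltn0Sn N) (mg y y0) (fun s s' => ganti y s s' y0) (fun s => g01 y s y0).
    have := gL y N.+1 Yy (ltn0Sn N); rewrite -/P.
    move: (N.+1%:R^-1 : R) (riemann _ _) (Rintegral _ _ _) (L y) => v r z l.
    clear.
    by rewrite !ler_distl => /andP[? ?] /andP[? ?]; apply/andP; split; lra.
  have c0 : 2 * @harmonic R N @[N --> \oo] --> (2 * 0 : R).
    by apply: cvgMl_tmp; exact: cvg_harmonic.
  apply/eqP; rewrite -subr_eq0 -normr_le0 -[leRHS](mulr0 2).
  by apply: (cvgr_to_ge c0); apply: nearW.
have PD : P (~` `[0, 1[%classic) = 0%E by exact: uniform_co.
have Wneg s : s < 0 -> W s = 1.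
  move=> s0; have c1 : quantile qs n s @[n --> U] --> (1 : R).
    by apply: cvg_near_cst; apply: (nearW _ (fun n => _)) => n; rewrite /quantile s0.
  exact: (cvg_unique _ (Wc s) c1).
(* If W vanished at some s in [[0, 1[], it would vanish beyond s, and every L y with y in Y would be
   at most s, against tightness with e = 1 - s. *)
have Wpos s : s < 1 -> 0 < W s.
  have [s0|s0] := ltP s 0; first by rewrite Wneg.
  move=> s1; rewrite lt_neqAle eq_sym; have /andP[-> _] := W01 s; rewrite andbT.
  apply/eqP => Ws; have e0 : 0 < 1 - s by rewrite subr_gt0.
  have [y Yy] := tight _ e0; rewrite opprB addrC subrK ltNge => /negP; apply.
  have [y0 _] := cvL y Yy; rewrite -intg //.
  pose A : set (measurableTypeR R) := `[0, s[%classic.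
  pose B : set (measurableTypeR R) := ~` `[0, 1[%classic.
  have mA : measurable A by exact: measurable_itv.
  have mB : measurable B by apply: measurableC; exact: measurable_itv.
  have Pfin : (P setT < +oo)%E by rewrite ltey_eq fin_num_measure.
  have I1 C : measurable C -> P.-integrable setT (EFin \o (\1_C : R -> R)).
    move=> mC; apply: (@bounded_integrable _ _ _ 1) => //.
    by move=> x; rewrite ger0_norm // indicE; case: (_ \in _).
  have Ig : P.-integrable setT (EFin \o g y).
    apply: (@bounded_integrable _ _ _ 1) => //; first exact: mg.
    by move=> x; have /andP[? ?] := g01 y x y0; rewrite ger0_norm.
  apply: (@le_trans _ _ (Rintegral P setT (fun x => \1_A x + \1_B x))).
    apply: le_Rintegral => //; first exact: (integrableD measurableT (I1 _ mA) (I1 _ mB)).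
    move=> x _; have /andP[g0 g1] := g01 y x y0.
    have [xB|xB] := pselect (B x).
      by rewrite (indicE _ B) (mem_set xB) (le_trans g1) // lerDr indicE.
    have [xA|xA] := pselect (A x).
      by rewrite (indicE _ A) (mem_set xA) (le_trans g1) // lerDl indicE.
    have sx : s <= x.
      rewrite leNgt; apply/negP => xs; apply: xA; rewrite /A /= in_itv /= xs andbT.
      by move: xB => /notP; rewrite /= in_itv /= => /andP[].
    have -> : kappa y (W x) = 0.
      have Wx : W x = 0.
        apply/eqP; rewrite eq_le; have /andP[-> _] := W01 x.
        by rewrite -Ws (Wanti _ _ sx).
      by rewrite /kappa Wx mulr0 mul0r.
    by rewrite addr_ge0.
  rewrite RintegralD //; [|exact: I1|exact: I1].
  rewrite /Rintegral (integral_indic P measurableT mA) (integral_indic P measurableT mB) !setIT.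
  have -> : fine (P B) = 0 by exact: (congr1 fine PD).
  have -> : fine (P A) = s.
    by have := congr1 fine (uniform_itv (lexx 0) s0 (ltW s1)); rewrite subr0.
  by rewrite addr0.
(* Inverse of r -> 1 / (1 + r). The maximum with 0 keeps X nonnegative on the null set where W may
   be 0 and [0^-1 = 0]. *)
pose X (s : measurableTypeR R) : measurableTypeR R := Num.max 0 ((W s)^-1 - 1).
have mX : @measurable_fun _ _ (measurableTypeR R) (measurableTypeR R) setT X.
  apply: measurable_maxr; first exact: measurable_cst.
  apply: measurable_funB; last exact: measurable_cst.
  exact: (measurableT_comp (@measurable_inv R) mW).
pose Xm : {mfun measurableTypeR R >-> measurableTypeR R} :=
  @mfun_Sub _ _ (measurableTypeR R) (measurableTypeR R) X (mem_set mX).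
pose nu : probability (measurableTypeR R) R := distribution P Xm.
exists nu; split.
  rewrite /on_nonneg /nu /= /distribution /pushforward /=.
  rewrite (_ : _ @^-1` _ = setT); first exact: prob1.
  by apply/seteqP; split=> // s _ /=; rewrite /X le_max lexx.
move=> y Yy; have [y0 _] := cvL y Yy; rewrite -intg //.
have mk : measurable_fun [set: measurableTypeR R] (EFin \o hker y).
  by apply/measurable_EFinP; apply: cont_meas; exact: continuous_hker.
rewrite /htrans /Rintegral; congr fine.
rewrite ge0_integral_pushforward //; last by move=> s _; rewrite lee_fin ltW // hker_gt0.
rewrite preimage_setT; apply: ae_eq_integral => //.
- exact: (measurableT_comp mk mX).
- by apply/measurable_EFinP; exact: mg.
exists (~` `[0, 1[%classic); split; [by apply: measurableC; exact: measurable_itv|exact: PD|].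
move=> s /= Hs s01; apply: Hs => _; congr EFin.
move: s01; rewrite in_itv /= => /andP[_ s1].
have w0 := Wpos s s1; have /andP[_ w1] := W01 s.
have r0 : 0 <= (W s)^-1 - 1 by rewrite subr_ge0 invf_ge1.
by rewrite /X max_r // -kappa_hker // subrKC invrK.
Unshelve. all: by end_near. Qed.

(** * Weierstrass approximation *)

(* Bernstein's polynomials in degree [n], with [f k] attached to the node [k / n]; the
   recursion on [n] conditions on the first of [n] coin tosses. *)
Fixpoint bernstein (R : realType) (n : nat) (f : nat -> R) : {poly R} :=
  if n is n'.+1 then 'X * bernstein n' (f \o S) + (1 - 'X) * bernstein n' f
  else (f 0%N)%:P.

Lemma bernsteinS (R : realType) (n : nat) (f : nat -> R) (w : R) :
  (bernstein n.+1 f).[w] = w * (bernstein n (f \o S)).[w] + (1 - w) * (bernstein n f).[w].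
Proof. by rewrite /= !hornerE. Qed.

Lemma bernstein_le (R : realType) (n : nat) (f g : nat -> R) (w : R) : 0 <= w <= 1 ->
  (forall k, (k <= n)%N -> f k <= g k) -> (bernstein n f).[w] <= (bernstein n g).[w].
Proof.
move=> /andP[w0 w1]; elim: n f g => [|n IH] f g fg; first by rewrite /= !hornerC fg.
rewrite !bernsteinS lerD // ler_wpM2l ?subr_ge0 //; apply: IH => k kn; apply: fg => //.
exact: leqW.
Qed.

Lemma bernstein_affine (R : realType) (n : nat) (f : nat -> R) (a b w : R) :
  (bernstein n (fun k => a + b * f k)).[w] = a + b * (bernstein n f).[w].
Proof.
elim: n f => [|n IH] f; first by rewrite /= !hornerC.
rewrite !bernsteinS IH (IH (f \o S)); ring.
Qed.

(** The free shift s lets the induction close, as the successor replaces s by s + 1; s = - n w gives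
    the binomial variance. *)
Lemma bernstein_variance (R : realType) (n : nat) (s w : R) :
  (bernstein n (fun k => (k%:R + s) ^+ 2)).[w] = (n%:R * w + s) ^+ 2 + n%:R * w * (1 - w).
Proof.
elim: n s => [|n IH] s; first by rewrite /= hornerC; ring.
rewrite bernsteinS IH.
have -> : (fun k => (k%:R + s) ^+ 2) \o S = (fun k => (k%:R + (s + 1)) ^+ 2).
  by apply/funext => k /=; rewrite -natr1; ring.
by rewrite IH -natr1; ring.
Qed.

(** Uniform continuity handles pairs at distance below d, and C = 2 M / d^2 the others. A quadratic
    error term is chosen because its Bernstein mean is the variance. *)
Lemma quadratic_modulus (R : realType) (G : R -> R) (e : R) : continuous G -> 0 < e ->
  exists2 C : R, 0 <= C & forall x y, 0 <= x <= 1 -> 0 <= y <= 1 ->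
    `|G x - G y| <= e + C * (x - y) ^+ 2.
Proof.
move=> cG e0.
have [d d0 Hd] : exists2 d : R, 0 < d & forall x, `[0, 1]%classic x ->
    forall y, `|x - y| < d -> `|G x - G y| < e.
  have /compact_near_coveringP := @segment_compact R 0 1.
  move=> /(_ _ (0^'+ : set_system R) (fun d x => forall y, `|x - y| < d -> `|G x - G y| < e)).
  move=> /(_ _) H; have {}H : \forall d \near (0 : R)^'+, `[0, 1]%classic `<=`
      (fun x => forall y, `|x - y| < d -> `|G x - G y| < e).
    apply: H => x _.
    have /cvgrPdist_lt /(_ (e / 2)) := cG x.
    rewrite divr_gt0 // => /(_ isT) [h h0 Hh].
    exists ((ball x (h / 2)), [set d | 0 < d < h / 2]) => /=.
      split; first by apply: nbhsx_ballx; rewrite divr_gt0.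
      near=> d; apply/andP; split; near: d.
        exact: nbhs_right_gt.
      by apply: nbhs_right_lt; rewrite divr_gt0.
    move=> [x' d] /= [xx' /andP[d0 dh]] y x'y.
    have xx'' : `|x - x'| < h / 2 by exact: xx'.
    have H1 : `|G x - G x'| < e / 2 by apply: Hh; rewrite /= /ball /=; lra.
    have H2 : `|G x - G y| < e / 2.
      apply: Hh => /=; rewrite -(subrKA x').
      by apply: le_lt_trans (ler_normD _ _) _; lra.
    rewrite -(subrKA (G x)); apply: le_lt_trans (ler_normD _ _) _.
    by rewrite (distrC (G x')); lra.
  have [d Hd] : exists d : R, 0 < d /\ `[0, 1]%classic `<=`
      (fun x => forall y, `|x - y| < d -> `|G x - G y| < e).
    near (0 : R)^'+ => d; exists d; split; near: d; [exact: nbhs_right_gt|exact: H].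
  by case: Hd => d0 Hd; exists d.
have [M HM] : exists M : R, forall x : R, 0 <= x <= 1 -> `|G x| <= M.
  have cw : {within `[0, 1], continuous (fun x => `|G x|)}.
    by apply: continuous_subspaceT => x; apply: cvg_norm; exact: cG.
  have [z _ Hz] := EVT_max ler01 cw.
  by exists `|G z| => x x01; apply: Hz; rewrite in_itv.
have M0 : 0 <= M by apply: le_trans (HM 0 _) => //; rewrite lexx ler01.
have dd : 0 < d ^+ 2 by rewrite exprn_gt0.
have K0 : 0 <= 2 * M / d ^+ 2 by rewrite divr_ge0 ?mulr_ge0 // ltW.
exists (2 * M / d ^+ 2) => // x y x01 y01.
have [xy|xy] := ltP `|x - y| d.
  apply: le_trans (ltW (Hd x _ y xy)) _; first by rewrite /= in_itv.
  by rewrite lerDl mulr_ge0 ?sqr_ge0.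
apply: le_trans (ler_normB _ _) _.
apply: (@le_trans _ _ (2 * M)); first by have := HM x x01; have := HM y y01; lra.
rewrite (@le_trans _ _ (2 * M / d ^+ 2 * (x - y) ^+ 2)) ?lerDr ?(ltW e0) //.
rewrite mulrAC ler_pdivlMr // ler_wpM2l ?mulr_ge0 //.
by rewrite -[leRHS](real_normK (num_real (x - y))) lerXn2r // nnegrE // ltW.
Unshelve. all: by end_near. Qed.

Lemma weierstrass (R : realType) (G : R -> R) (e : R) : continuous G -> 0 < e ->
  exists p : {poly R}, forall w, 0 <= w <= 1 -> `|G w - p.[w]| <= e.
Proof.
move=> cG e0; have e2 : 0 < e / 2 by rewrite divr_gt0.
have [C C0 HC] := quadratic_modulus cG e2.
(* The variance of the count is at most n, so the quadratic term contributes at most C / n <= e /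
   2. *)
pose n := (Num.truncn (C / (e / 2))).+1.
have n0 : 0 < n%:R :> R by rewrite ltr0n.
have nC : C <= n%:R * (e / 2) by rewrite -ler_pdivrMr // ltW // truncnS_gt.
exists (bernstein n (fun k => G (k%:R / n%:R))) => w w01; have /andP[w0 w1] := w01.
have V : (bernstein n (fun k => (k%:R + - (n%:R * w)) ^+ 2)).[w] <= n%:R.
  rewrite bernstein_variance subrr expr0n add0r -mulrA ler_piMr ?ltW //; nra.
have bound (s : R) : C / n%:R ^+ 2 * s ^+ 2 = C * (s / n%:R) ^+ 2.
  by field; rewrite gt_eqF.
have CV : C / n%:R ^+ 2 * (bernstein n (fun k => (k%:R + - (n%:R * w)) ^+ 2)).[w] <= e / 2.
  apply: (@le_trans _ _ (C / n%:R ^+ 2 * n%:R)).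
    by rewrite ler_wpM2l // divr_ge0 ?sqr_ge0.
  by rewrite expr2 invfM mulrA divfK ?gt_eqF // ler_pdivrMr // mulrC.
have dev k : (k <= n)%N -> `|G w - G (k%:R / n%:R)| <=
    e / 2 + C / n%:R ^+ 2 * (k%:R + - (n%:R * w)) ^+ 2.
  move=> kn; rewrite bound distrC.
  have -> : (k%:R + - (n%:R * w)) / n%:R = k%:R / n%:R - w by field; rewrite gt_eqF.
  apply: HC => //; rewrite divr_ge0 //= ler_pdivrMr // mul1r ler_nat //.
have up : (bernstein n (fun k => G (k%:R / n%:R))).[w] <=
    (G w + e / 2) + C / n%:R ^+ 2 * (bernstein n (fun k => (k%:R + - (n%:R * w)) ^+ 2)).[w].
  rewrite -bernstein_affine; apply: bernstein_le => // k kn.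
  by have := dev k kn; rewrite ler_norml => /andP[? _]; lra.
have low : (G w - e / 2) + - (C / n%:R ^+ 2) * (bernstein n (fun k => (k%:R + - (n%:R * w)) ^+ 2)).[w]
    <= (bernstein n (fun k => G (k%:R / n%:R))).[w].
  rewrite -bernstein_affine; apply: bernstein_le => // k kn.
  by have := dev k kn; rewrite ler_norml mulNr => /andP[_ ?]; lra.
by rewrite mulNr in low; rewrite ler_distlC; apply/andP; split; lra.
Qed.

(** * Averages of x / (x + r) determine weak convergence *)

Lemma continuous_comp_max0 (R : realType) (g : R -> R) : continuous g ->
  continuous (fun r : R => g (Num.max r 0)).
Proof.
move=> cg r; apply: (@continuous_comp _ _ _ (fun r : R => Num.max r 0) g).
  exact: continuous_max0.
exact: cg.
Qed.

Lemma hkerM (R : realType) (x y r : R) : 0 < x -> x < y ->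
  hker x r * hker y r = y / (y - x) * hker x r - x / (y - x) * hker y r.
Proof.
move=> x0 xy; have y0 := lt_trans x0 xy; rewrite /hker; field.
by rewrite !gt_eqF ?hker_den_gt0 // subr_gt0.
Qed.

Lemma hker_dist (R : realType) (x y r : R) : 0 < x -> x < y -> `|hker x r - hker y r| <= (y - x) / x.
Proof.
move=> x0 xy; have y0 := lt_trans x0 xy.
rewrite distrC ger0_norm ?subr_ge0 ?hker_le ?(ltW xy) // hkerB //.
rewrite ler_wpM2l ?subr_ge0 ?(ltW xy) //.
have m0 := max0_ge0 r; have xm := hker_den_gt0 r x0; have ym := hker_den_gt0 r y0.
move: (Num.max r 0) m0 xm ym => m m0 xm ym.
by rewrite ler_pdivrMr ?mulr_gt0 // mulrC ler_pdivlMr // ler_pM //; lra.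
Qed.

Lemma nonneg_Rintegral (R : realType) (nu : probability (measurableTypeR R) R) (g : R -> R) :
  on_nonneg nu -> continuous g ->
  Rintegral nu setT g = Rintegral nu setT (fun r => g (Num.max r 0)).
Proof.
move=> nu0 cg; congr fine; apply: ae_eq_integral => //.
- by apply/measurable_EFinP; exact: cont_meas.
- apply/measurable_EFinP; apply: cont_meas.
  exact: continuous_comp_max0.
exists (~` [set x | 0 <= x]); split.
- by apply: measurableC; exact: measurable_nonneg.
- exact: measure_neg.
- by move=> r /= H r0; apply: H => _; rewrite max_l.
Qed.

Section test_functions.
Context (R : realType) (nu : probability (measurableTypeR R) R) (qs : nat -> seq R) (y1 : R).
Hypothesis nu_nonneg : on_nonneg nu.
Hypothesis qs_near : \forall n \near \oo, size (qs n) = n /\ {in qs n, forall r, 0 < r}.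
Hypothesis y1_gt0 : 0 < y1.
Hypothesis qs_cvg : forall y, y1 < y -> n%:R^-1 * hsum (qs n) y @[n --> \oo] --> htrans nu y.

Let avg n (g : R -> R) : R := n%:R^-1 * \sum_(r <- qs n) g r.

Let good (g : R -> R) := [/\ continuous g, exists M : R, forall x : R, `|g x| <= M &
  avg n g @[n --> \oo] --> Rintegral nu setT g].

Let avgB n (g h : R -> R) : avg n g - avg n h = avg n (fun r => g r - h r).
Proof. by rewrite /avg -mulrBr -sumrB. Qed.

Let avg_le n (g : R -> R) (a : R) : size (qs n) = n -> {in qs n, forall r, 0 < r} -> 0 <= a ->
  (forall r, 0 < r -> `|g r| <= a) -> `|avg n g| <= a.
Proof.
move=> sn r0 a0 ga; have [n0|n0] := posnP n; first by rewrite /avg n0 invr0 mul0r normr0.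
rewrite /avg normrM ger0_norm ?invr_ge0 // mulrC ler_pdivrMr ?ltr0n //.
apply: le_trans (ler_norm_sum _ _ _) _.
apply: (@le_trans _ _ (\sum_(r <- qs n) a)); first by rewrite big_seq [leRHS]big_seq; apply: ler_sum => r /r0 ?; exact: ga.
by rewrite big_const_seq count_predT sn iter_addr_0 mulr_natr.
Qed.

Let good_cst a : good (cst a).
Proof.
split; [exact: cst_continuous|by exists (`|a|)|].
rewrite Rintegral_prob_cst; apply: cvg_near_cst; near=> n.
have [sn _] : size (qs n) = n /\ {in qs n, forall r, 0 < r} by near: n.
have n0 : n%:R != 0 :> R by rewrite pnatr_eq0 -lt0n; near: n; exists 1%N.
by rewrite /avg /= big_const_seq count_predT sn iter_addr_0 -(mulr_natr a) mulrCA mulVf ?mulr1.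
Unshelve. all: by end_near. Qed.

Let good_lin a b g h : good g -> good h -> good (fun r => a * g r + b * h r).
Proof.
move=> [cg [M gM] ag] [ch [N hN] ah]; split.
- by move=> r; apply: cvgD; apply: cvgMl_tmp; [exact: cg|exact: ch].
- exists (`|a| * M + `|b| * N) => r; apply: le_trans (ler_normD _ _) _.
  by rewrite !normrM lerD // ler_wpM2l.
have Ig := prob_integrable nu cg gM; have Ih := prob_integrable nu ch hN.
have IZ c f : nu.-integrable setT (EFin \o f) -> nu.-integrable setT (EFin \o (fun r => c * f r)).
  move=> If; have := integrableZl measurableT c If.
  by congr (integrable _ _ _); apply/funext => s; rewrite /= EFinM.
rewrite RintegralD // ?RintegralZl //; [|exact: IZ|exact: IZ].
have -> : (fun n => avg n (fun r => a * g r + b * h r)) = (fun n => a * avg n g + b * avg n h).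
  apply/funext => n; rewrite /avg big_split /= -!mulr_sumr mulrDr; congr (_ + _); ring.
by apply: cvgD; exact: cvgMl_tmp.
Qed.

(** Approximation on the closed positive half-line is enough, since nu and the points [qs n] live
    there. *)
Let good_approx (g : R -> R) (M : R) : continuous g -> (forall x, `|g x| <= M) ->
  (forall e : R, 0 < e -> exists2 h, good h & forall r : R, 0 <= r -> `|g r - h r| <= e) -> good g.
Proof.
move=> cg gM H; split; [by []|by exists M|].
apply/cvgrPdist_le => e e0; have e3 : 0 < e / 3 by rewrite divr_gt0.
have [h [ch [N hN] ah] gh] := H _ e3.
have Iclose : `|Rintegral nu setT g - Rintegral nu setT h| <= e / 3.
  rewrite -RintegralB //; [|exact: prob_integrable cg gM|exact: prob_integrable ch hN].
  have cgh : continuous (fun r => g r - h r) by move=> r; apply: cvgB; [exact: cg|exact: ch].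
  rewrite nonneg_Rintegral //; apply: Rintegral_prob_norm => [|r].
    exact: (continuous_comp_max0 cgh).
  by apply: gh; exact: max0_ge0.
near=> n.
have [sn r0] : size (qs n) = n /\ {in qs n, forall r, 0 < r} by near: n.
have A1 : `|avg n g - avg n h| <= e / 3.
  by rewrite avgB; apply: avg_le => // [|r r0']; [exact: ltW|apply: gh; exact: ltW].
have A2 : `|Rintegral nu setT h - avg n h| <= e / 3.
  by near: n; move/cvgrPdist_le : ah; exact.
move: Iclose A1 A2; rewrite !ler_norml => /andP[? ?] /andP[? ?] /andP[? ?].
by apply/andP; split; lra.
Unshelve. all: by end_near. Qed.

Let good_hker y : y1 < y -> good (hker y).
Proof.
move=> y1y; have y0 := lt_trans y1_gt0 y1y; split.
- exact: continuous_hker.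
- by exists 1 => r; exact: hker_norm.
rewrite -/(htrans nu y); apply: cvg_trans (qs_cvg y1y); apply: near_eq_cvg.
near=> n.
have [_ r0] : size (qs n) = n /\ {in qs n, forall r, 0 < r} by near: n.
rewrite /avg /hsum; congr (_ * _); apply: eq_big_seq => r /r0 r0'.
by rewrite /hker max_l // ltW.
Unshelve. all: by end_near. Qed.

(** The two claims feed each other: [hker a ^+ k.+1] is the uniform limit of [hker a ^+ k * hker b]
    as b decreases to a, and the partial fractions of [hkerM] reduce [hker a ^+ k.+1 * hker b] to
    these two functions. *)
Let good_pow (a : R) k : y1 < a ->
  good (fun r => hker a r ^+ k) /\ forall b, a < b -> good (fun r => hker a r ^+ k * hker b r).
Proof.
move=> y1a; have a0 := lt_trans y1_gt0 y1a.
have cpow j : continuous (fun r => hker a r ^+ j).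
  move=> r; apply: (@continuous_comp _ _ _ (hker a) (fun w : R => w ^+ j)).
      exact: continuous_hker.
    exact: exprn_continuous.
have pow01 j r : 0 <= hker a r ^+ j <= 1.
  by rewrite exprn_ge0 ?exprn_ile1 ?hker_le1 // ltW // hker_gt0.
elim: k => [|k [IH1 IH2]].
  split; first exact: (good_cst 1).
  move=> b ab; have -> : (fun r => hker a r ^+ 0 * hker b r) = hker b.
    by apply/funext => r; rewrite expr0 mul1r.
  by apply: good_hker; exact: lt_trans ab.
have Q : good (fun r => hker a r ^+ k.+1).
  apply: (@good_approx _ 1); first exact: cpow.
    by move=> r; have /andP[? ?] := pow01 k.+1 r; rewrite ger0_norm.
  move=> e e0; have ea : 0 < e * a by rewrite mulr_gt0.
  (* For b = a + e a the bound (b - a) / a of [hker_dist] equals e. *)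
  exists (fun r => hker a r ^+ k * hker (a + e * a) r); first by apply: IH2; rewrite ltrDl.
  move=> r _; rewrite exprSr -mulrBr normrM.
  apply: (@le_trans _ _ (1 * e)); last by rewrite mul1r.
  have /andP[p0 p1] := pow01 k r; rewrite (ger0_norm p0) ler_pM //.
  have := @hker_dist R a (a + e * a) r a0; rewrite ltrDl => /(_ ea) /le_trans; apply.
  by rewrite addrAC subrr add0r mulfK // gt_eqF.
split => // b ab.
have -> : (fun r => hker a r ^+ k.+1 * hker b r) = (fun r =>
    b / (b - a) * hker a r ^+ k.+1 + - (a / (b - a)) * (hker a r ^+ k * hker b r)).
  by apply/funext => r; rewrite exprSr -mulrA hkerM //; ring.
by apply: good_lin => //; exact: IH2.
Qed.

Let good_poly (a : R) (p : {poly R}) : y1 < a -> good (fun r => p.[hker a r]).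
Proof.
move=> y1a; have -> : (fun r => p.[hker a r]) =
    (fun r => \sum_(i < size p) p`_i * hker a r ^+ i).
  by apply/funext => r; rewrite horner_coef.
elim: (size p) => [|N IH].
  by under eq_fun do rewrite big_ord0; exact: (good_cst 0).
under eq_fun do rewrite big_ord_recr /=.
have -> : (fun r => \sum_(i < N) p`_i * hker a r ^+ i + p`_N * hker a r ^+ N) =
    (fun r => 1 * (\sum_(i < N) p`_i * hker a r ^+ i) + p`_N * hker a r ^+ N).
  by apply/funext => r; rewrite mul1r.
by apply: good_lin => //; have [] := good_pow N y1a.
Qed.

(** In the coordinate w = a / (a + r) the function g becomes continuous on [0, 1], where Weierstrass
    approximates it by polynomials in [hker a]. *)
Let good_compact g : continuous g -> compact (closure [set x | g x != 0]) -> good g.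
Proof.
move=> cg kg; pose a := y1 + 1.
have y1a : y1 < a by rewrite ltrDl.
have a0 := lt_trans y1_gt0 y1a.
have [K K0 HK] : exists2 K : R, 0 < K & forall x, K <= x -> g x = 0.
  have [K0 [_ HK0]] := compact_bounded kg.
  exists (`|K0| + 1); first by rewrite ltr_wpDl.
  move=> x xK; apply/eqP/negPn/negP => gx.
  have gx' : closure [set x | g x != 0] x by exact: subset_closure.
  have K1 : K0 < `|K0| + 1 / 2 by rewrite (le_lt_trans (ler_norm _)) // ltrDl.
  have /= := HK0 _ K1 _ gx'; have k0 := normr_ge0 K0.
  by have x0 := ler_norm x; move: (`|x|) x0 (`|K0|) k0 xK => X ? K ? ? ?; lra.
pose w0 := a / (a + K); have w00 : 0 < w0 by rewrite divr_gt0 // addr_gt0.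
(* Below w0 the argument of g stays at K, where g already vanishes, so G is continuous up to w =
   0. *)
pose G w := g (a / Num.max w w0 - a).
have mx0 w : 0 < Num.max w w0 by rewrite lt_max w00 orbT.
have cG : continuous G.
  move=> w; apply: (@continuous_comp _ _ _ (fun w => a / Num.max w w0 - a) g); last exact: cg.
  apply: cvgB; last exact: cvg_cst.
  apply: cvgMl_tmp; apply: cvgV; first by rewrite gt_eqF.
  apply: (@continuous_max _ _ id (cst w0)); first exact: id.
  exact: cst_continuous.
have gG r : 0 <= r -> g r = G (hker a r).
  move=> r0; rewrite /G /hker (max_l r0); have ar : 0 < a + r by rewrite ltr_wpDr.
  have aK : 0 < a + K by rewrite addr_gt0.
  have [rK|Kr] := leP r K.
    rewrite max_l; last by rewrite /w0 ler_pM2l // lef_pV2 ?posrE // lerD2l.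
    by congr g; field; rewrite !gt_eqF.
  rewrite max_r; last by rewrite /w0 ler_pM2l // lef_pV2 ?posrE // lerD2l ltW.
  have -> : a / w0 - a = K by rewrite /w0; field; rewrite !gt_eqF.
  by rewrite !HK // ltW.
have [M gM] : exists M : R, forall x : R, `|g x| <= M.
  have := @continuous_compact _ _ g _ (continuous_subspaceT cg) kg.
  move=> /compact_bounded[M0 [_ HM]]; exists (`|M0| + 1) => x.
  have [->|gx] := eqVneq (g x) 0; first by rewrite normr0 addr_ge0.
  apply: (HM (`|M0| + 1)); first by rewrite (le_lt_trans (ler_norm _)) // ltrDl.
  by exists x => //; exact: subset_closure.
apply: (good_approx cg gM) => e e0; have [p Hp] := weierstrass cG e0.
exists (fun r => p.[hker a r]); first exact: good_poly.
by move=> r r0; rewrite gG //; apply: Hp; rewrite hker_le1 // ltW // hker_gt0.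
Qed.

(** All masses equal 1 for large n, so convergence on compactly supported functions extends to
    bounded ones. *)
Lemma weak_cvg_of_htrans (g : R -> R) (M : R) : continuous g -> (forall x, `|g x| <= M) ->
  n%:R^-1 * \sum_(r <- qs n) g r @[n --> \oo] --> Rintegral nu setT g.
Proof.
move=> cg gM; apply: (@vague_mass_cvg _ nu avg _ _ _ g M) => //.
- move=> n {cg gM M g}g chi M cg cchi chi01 gM; rewrite !avgB /avg.
  rewrite mulrCA normrM ger0_norm ?invr_ge0 // ler_wpM2l ?invr_ge0 // mulr_sumr.
  apply: le_trans (ler_norm_sum _ _ _) _; apply: ler_sum => r _ /=.
  rewrite -{1}[g r]mulr1 -mulrBr normrM; have /andP[? ?] := chi01 r.
  by rewrite [X in _ * X]ger0_norm ?subr_ge0 // ler_wpM2r // subr_ge0.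
- by move=> h ch kh; have [] := good_compact ch kh.
- by have [] := good_cst 1.
Qed.
End test_functions.

(** * The limit measures *)

Lemma atom_lt1 (R : realType) (mu : probability (measurableTypeR R) R) :
  ~ is_delta0 mu -> fine (mu [set 0]) < 1.
Proof.
move=> nd; have m0 : measurable ([set 0 : R] : set (measurableTypeR R)) by exact: measurable_set1.
have fin : mu [set 0] \is a fin_num by rewrite fin_num_measure.
rewrite -lte_fin fineK // lt_neqAle probability_le1 // andbT.
by apply/eqP => /atom_is_delta0.
Qed.

Lemma htrans_ex_gt (R : realType) (mu : probability (measurableTypeR R) R) (a : R) : a < 1 ->
  exists2 x : R, 0 < x & a < htrans mu x.
Proof.
move=> a1; near \oo => n; exists n.+1%:R; first by rewrite ltr0n.
by near: n; exact: cvgr_gt (@htrans_cvg1 R mu) _ a1.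
Unshelve. all: by end_near. Qed.

Lemma htrans_surj (R : realType) (mu : probability (measurableTypeR R) R) (x0 v : R) :
  on_nonneg mu -> ~ is_delta0 mu -> 0 < x0 -> htrans mu x0 < v -> v < 1 ->
  exists2 x : R, x0 < x & htrans mu x = v.
Proof.
move=> mu0 nd x00 v0 v1; have [x1 x10 v1'] := htrans_ex_gt mu v1.
have x01 : x0 <= x1.
  rewrite leNgt; apply/negP => /ltW /(htrans_le mu x10) H.
  by have := lt_trans v0 v1'; rewrite ltNge H.
have [||x] := @IVT R (htrans mu) x0 x1 v x01.
- apply: continuous_in_subspaceT => x; rewrite inE /= in_itv /= => /andP[x0x _].
  by apply: htrans_continuous; exact: lt_le_trans x0x.
- by rewrite ge_min (ltW v0) /= le_max (ltW v1') orbT.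
rewrite in_itv /= => /andP[x0x _] hx; exists x => //.
rewrite lt_neqAle x0x andbT; apply/eqP => E.
by move: v0; rewrite E hx ltxx.
Qed.

Lemma posrooted_weak_cvg (R : realType) (q : nat -> {poly R[i]})
    (nu : probability (measurableTypeR R) R) (y1 : R) :
  on_nonneg nu -> (\forall n \near \oo, posrooted (q n)) ->
  (\forall n \near \oo, size (rroots (q n)) = n) -> 0 < y1 ->
  (forall y, y1 < y -> n%:R^-1 * hsum (rroots (q n)) y @[n --> \oo] --> htrans nu y) ->
  weak_cvg (fun n => root_measure n (q n)) nu.
Proof.
move=> nu0 qpos qsize y10 H g cg [M gM].
have near_q : \forall n \near \oo, size (rroots (q n)) = n /\ {in rroots (q n), forall r, 0 < r}.
  near=> n; split; first by near: n.
  have qn : posrooted (q n) by near: n.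
  by have [] := rrootsP qn.
have cgR : continuous ((fun r => g r%:C%C) : R -> R).
  move=> r; apply: (@continuous_comp _ _ _ (fun x : R => x%:C%C : (R[i])^o) g); last exact: cg.
  exact: continuous_real_complex.
have := weak_cvg_of_htrans nu0 near_q y10 H cgR (fun r => gM r%:C%C).
apply: cvg_trans; apply: near_eq_cvg; near=> n.
have qn : posrooted (q n) by near: n.
by rewrite (posrooted_Rintegral n qn cg gM).
Unshelve. all: by end_near. Qed.

Section flow.
Context (R : realType) (f : nat -> LPfun R) (c t : R)
    (Sigma : {finite_measure set (measurableTypeR R) -> \bar R})
    (p : nat -> {poly R[i]}) (mu : probability (measurableTypeR R) R).
Hypothesis f_neg : forall n, (0 < n)%N -> forall x : R, f n x = 0 -> x < 0.
Hypothesis f_adm : admissible f c Sigma.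
Hypothesis t_ge0 : 0 <= t.
Hypothesis p_deg : forall n, (0 < n)%N -> size (p n) = n.+1.
Hypothesis p_pos : forall n, (0 < n)%N -> forall w : R[i], root (p n) w -> 0 < w.
Hypothesis mu_nonneg : on_nonneg mu.
Hypothesis p_cvg : weak_cvg (fun n => root_measure n (p n)) mu.

Let q n := euler_op (f (Num.truncn (t * n%:R))) t (p n).
Let E x := expR (- (t * Rtransform c Sigma (htrans mu x))).

Let q_pos : \forall n \near \oo, posrooted (q n).
Proof. exact: euler_op_posrooted. Qed.

Let q_size : \forall n \near \oo, size (rroots (q n)) = n.
Proof. exact: euler_op_size. Qed.

Let q_cvg x : 0 < x -> n%:R^-1 * hsum (rroots (q n)) (x / E x) @[n --> \oo] --> htrans mu x.
Proof. exact: euler_op_htrans. Qed.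

Let near_q : \forall n \near \oo, size (rroots (q n)) = n /\ {in rroots (q n), forall r, 0 < r}.
Proof.
near=> n; split; first by near: n.
have qn : posrooted (q n) by near: n.
by have [] := rrootsP qn.
Unshelve. all: by end_near. Qed.

(** For the converse, the right-hand side is nonzero, so u = h_mu(x) is attained by h_nu at some y;
    comparing the two formulas for the S-transforms gives y = x / E x. *)
Lemma Stransform_flow (nu : probability (measurableTypeR R) R) x :
  on_nonneg nu -> ~ is_delta0 mu -> ~ is_delta0 nu -> 0 < x ->
  htrans nu (x / E x) = htrans mu x <->
  Stransform nu (htrans mu x - 1) = Stransform mu (htrans mu x - 1) * E x.
Proof.
move=> nu0 mud nud x0; have u0 := htrans_gt0 mu_nonneg x0.
have u1 := htrans_lt1 mu_nonneg mud x0.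
have Ex : 0 < E x by exact: expR_gt0.
have y0 : 0 < x / E x by rewrite divr_gt0.
rewrite (Stransform_htrans mu_nonneg mud x0); split.
  move=> h; rewrite -{1}h (Stransform_htrans nu0 nud y0) h; field.
  by rewrite !gt_eqF //= subr_gt0.
move=> S; have [] := @Stransform_neq0 R nu (htrans mu x - 1) nu0.
  by rewrite S mulf_neq0 ?gt_eqF // divr_gt0 // mulr_gt0 // subr_gt0.
move=> y y_gt0; rewrite subrK => hy.
move: S; rewrite -hy (Stransform_htrans nu0 nud y_gt0) hy => S.
suff -> : x / E x = y by [].
have u1' : 0 < 1 - htrans mu x by rewrite subr_gt0.
have S' : htrans mu x / (1 - htrans mu x) * y^-1 = htrans mu x / (1 - htrans mu x) * (E x / x).
  rewrite -mulrA -invfM S; field.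
  by rewrite !gt_eqF.
have K : htrans mu x / (1 - htrans mu x) != 0 by rewrite gt_eqF // divr_gt0.
by have /(congr1 GRing.inv) := mulfI K S'; rewrite invrK invf_div.
Qed.

Lemma flow_limit : ~ is_delta0 mu ->
  exists nu : probability (measurableTypeR R) R,
    [/\ on_nonneg nu, ~ is_delta0 nu &
     forall x, 0 < x -> Stransform nu (htrans mu x - 1) = Stransform mu (htrans mu x - 1) * E x].
Proof.
move=> mud.
pose Y : set R := [set x / E x | x in [set x | 0 < x]].
(* Defining L as a limit makes it a function of y although x -> x / E x is not known to be injective
   at this stage. *)
pose L (y : R) : R := lim (n%:R^-1 * hsum (rroots (q n)) y @[n --> \oo]).
have LE x : 0 < x -> L (x / E x) = htrans mu x by move=> x0; apply: cvg_lim => //; exact: q_cvg.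
have [||nu [nu0 nuL]] := @limit_measure R (fun n => rroots (q n)) Y L near_q.
- move=> _ [x /= x0 <-]; split; first by rewrite divr_gt0 // expR_gt0.
  by rewrite LE //; exact: q_cvg.
- move=> e e0; have [|x x0 hx] := @htrans_ex_gt R mu (1 - e); first by rewrite gtrBl.
  by exists (x / E x); [exists x|rewrite LE].
have hnu x : 0 < x -> htrans nu (x / E x) = htrans mu x.
  by move=> x0; rewrite nuL ?LE //; exists x.
have nud : ~ is_delta0 nu.
  move=> nud; have := htrans_lt1 mu_nonneg mud ltr01.
  by rewrite -hnu ?is_delta0_htrans ?ltxx // divr_gt0 // expR_gt0.
by exists nu; split => // x x0; apply/Stransform_flow => //; exact: hnu.
Qed.

(** Every y > x1 / E x1 must be of the form x / E x. The measure nu itself provides this: choose x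
    with h_mu(x) = h_nu(y) by the intermediate value theorem and use injectivity of h_nu. *)
Lemma flow_weak_cvg (nu : probability (measurableTypeR R) R) (x1 : R) :
  on_nonneg nu -> ~ is_delta0 mu -> ~ is_delta0 nu -> 0 < x1 ->
  (forall x, x1 <= x ->
     Stransform nu (htrans mu x - 1) = Stransform mu (htrans mu x - 1) * E x) ->
  weak_cvg (fun n => root_measure n (q n)) nu.
Proof.
move=> nu0 mud nud x10 S.
have hnu x : x1 <= x -> htrans nu (x / E x) = htrans mu x.
  by move=> x1x; apply/Stransform_flow => //; [exact: lt_le_trans x1x|exact: S].
have y0 x : 0 < x -> 0 < x / E x by move=> x0; rewrite divr_gt0 // expR_gt0.
apply: (posrooted_weak_cvg nu0 q_pos q_size (y0 _ x10)) => y y1y.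
have y_gt0 := lt_trans (y0 _ x10) y1y.
have v0 : htrans mu x1 < htrans nu y by rewrite -hnu //; exact: (htrans_lt nu0 nud (y0 _ x10)).
have [x x1x hx] := htrans_surj mu_nonneg mud x10 v0 (htrans_lt1 nu0 nud y_gt0).
have x0 := lt_trans x10 x1x.
have <- : x / E x = y.
  by apply: (htrans_inj nu0 nud) => //; [exact: y0|rewrite hnu // ltW].
by rewrite hnu ?(ltW x1x) //; exact: q_cvg.
Qed.

(** Here h_mu is constantly 1, so E is a constant and x -> x / E x is a mere scaling. *)
Lemma flow_weak_cvg_delta0 (nu : probability (measurableTypeR R) R) :
  on_nonneg nu -> is_delta0 mu -> is_delta0 nu ->
  weak_cvg (fun n => root_measure n (q n)) nu.
Proof.
move=> nu0 mud nud; apply: (posrooted_weak_cvg nu0 q_pos q_size ltr01) => y y1.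
have y0 := lt_trans ltr01 y1; pose e := expR (- (t * Rtransform c Sigma 1)).
have x0 : 0 < y * e by rewrite mulr_gt0 // expR_gt0.
have := q_cvg x0; rewrite /E !is_delta0_htrans // -/e mulfK // gt_eqF //; exact: expR_gt0.
Qed.
End flow.

(** * Convolution powers obtained from (z - 1)^n *)

Section existence.
Context (R : realType) (f : nat -> LPfun R) (c : R)
    (Sigma : {finite_measure set (measurableTypeR R) -> \bar R}).
Hypothesis f_neg : forall n, (0 < n)%N -> forall x : R, f n x = 0 -> x < 0.
Hypothesis f_adm : admissible f c Sigma.

Let delta1 : probability (measurableTypeR R) R := @dirac _ (measurableTypeR R) 1 R.

Let delta1_nonneg : on_nonneg delta1.
Proof. by rewrite /on_nonneg /delta1 /= diracE mem_set //= ler01. Qed.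

Let delta1_ndelta0 : ~ is_delta0 delta1.
Proof.
move=> /(_ [set 0] (measurable_set1 _)); rewrite /delta1 /= !diracE.
rewrite memNset; last by move=> /eqP; rewrite oner_eq0.
by rewrite mem_set // => /eqP; rewrite eqe eq_sym oner_eq0.
Qed.

Let delta1_htrans (x : R) : 0 < x -> htrans delta1 x = x / (x + 1).
Proof.
move=> x0; rewrite /htrans /Rintegral integral_dirac //.
  by rewrite diracT mul1e /= /hker max_l.
by apply/measurable_EFinP; apply: cont_meas; exact: continuous_hker.
Qed.

Let pow1_root n (w : R[i]) : root (('X - 1%:P) ^+ n : {poly R[i]}) w -> w = 1.
Proof.
case: n => [|n]; first by rewrite expr0 rootE hornerC oner_eq0.
by rewrite rootE !hornerE expf_eq0 /= subr_eq0 => /eqP.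
Qed.

Let pow1_cvg : weak_cvg (fun n => root_measure n (('X - 1%:P) ^+ n : {poly R[i]})) delta1.
Proof.
move=> g cg [M gM]; apply: cvg_near_cst; near=> n.
have n0 : (0 < n)%N by near: n; exists 1%N.
have pp : posrooted (('X - 1%:P) ^+ n : {poly R[i]}).
  split; first by rewrite -size_poly_eq0 size_exp_XsubC.
  by move=> w /pow1_root ->; exact: ltr01.
have [r0 prs pE sz] := rrootsP pp.
rewrite (posrooted_Rintegral n pp cg gM).
have -> : Rintegral delta1 setT (fun x => g x%:C%C) = g 1.
  rewrite /Rintegral integral_dirac ?diracT ?mul1e //.
  apply/measurable_EFinP; apply: cont_meas => r.
  apply: (@continuous_comp _ _ _ (fun x : R => x%:C%C : (R[i])^o) g); last exact: cg.
  exact: continuous_real_complex.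
have -> : \sum_(r <- rroots (('X - 1%:P) ^+ n)) g r%:C%C =
    \sum_(r <- rroots (('X - 1%:P) ^+ n : {poly R[i]})) g 1.
  apply: eq_big_seq => r rr; congr g; apply: (pow1_root (n := n)).
  rewrite pE rootZ ?lead_coef_eq0; last by case: pp.
  by rewrite /rpoly -(big_map (fun r => r%:C%C) xpredT (fun z => 'X - z%:P)) root_prod_XsubC map_f.
rewrite big_const_seq count_predT sz size_exp_XsubC /= iter_addr_0 -(mulr_natr (g 1)) mulrCA.
by rewrite mulVf ?mulr1 // pnatr_eq0 -lt0n.
Unshelve. all: by end_near. Qed.

(** The S-transform of the unit mass at 1 is 1, and its h takes every value in ]0, 1[, so
    [flow_limit] prescribes the S-transform on all of ]-1, 0[. *)
Lemma tilde_mu_pow (t : R) : 0 <= t ->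
  exists nu : probability (measurableTypeR R) R,
    [/\ on_nonneg nu, ~ is_delta0 nu &
     forall z, -1 < z < 0 -> Stransform nu z = expR (- (t * Rtransform c Sigma (z + 1)))].
Proof.
move=> t0.
have [] := @flow_limit R f c t Sigma (fun n => ('X - 1%:P) ^+ n) delta1 => //.
- by move=> n _; rewrite size_exp_XsubC.
- by move=> n _ w /pow1_root ->; exact: ltr01.
move=> nu [nu0 nud S]; exists nu; split => // z /andP[z1 z0].
(* Solution of x / (x + 1) = z + 1. *)
pose x := (z + 1) / - z.
have x0 : 0 < x by rewrite divr_gt0 ?oppr_gt0 //; lra.
have xz : htrans delta1 x = z + 1.
  by rewrite delta1_htrans // /x; field; rewrite lt_eqF //= gt_eqF //; lra.
have := S x x0; rewrite (Stransform_htrans delta1_nonneg delta1_ndelta0 x0) xz addrK => ->.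
rewrite -[RHS]mul1r; congr (_ * _); rewrite /x; field.
by rewrite lt_eqF //= !gt_eqF //; lra.
Qed.
End existence.

(** The limit is described by properties of measures; the first conjunct shows that such measures
    exist, so the second is not vacuous. *)
Theorem theorem2p9 (R : realType) (f : nat -> LPfun R) (c : R)
    (Sigma : {finite_measure set (measurableTypeR R) -> \bar R}) (t : R)
    (p : nat -> {poly R[i]}) (mu : probability (measurableTypeR R) R)
    (f_neg : forall n, (0 < n)%N -> forall x : R, f n x = 0 -> x < 0)
    (f_adm : admissible f c Sigma)
    (t_ge0 : 0 <= t)
    (p_deg : forall n, (0 < n)%N -> size (p n) = n.+1)
    (p_pos : forall n, (0 < n)%N -> forall w : R[i], root (p n) w -> 0 < w)
    (mu_nonneg : on_nonneg mu)
    (p_cvg : weak_cvg (fun n => root_measure n (p n)) mu) :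
  (exists m mt nu : probability (measurableTypeR R) R,
     [/\ is_tilde_mu c Sigma m, is_boxpow m t mt & is_boxtimes mu mt nu]) /\
  (forall m mt nu : probability (measurableTypeR R) R,
     is_tilde_mu c Sigma m -> is_boxpow m t mt -> is_boxtimes mu mt nu ->
     weak_cvg (fun n => root_measure n
                 (euler_op (f (Num.truncn (t * n%:R))) t (p n))) nu).
Proof.
split.
  have [m [m0 md mS]] := tilde_mu_pow f_neg f_adm (@ler01 R).
  have [mt [mt0 mtd mtS]] := tilde_mu_pow f_neg f_adm t_ge0.
  have atom_ge (nu : probability (measurableTypeR R) R) z :
      -1 + fine (nu [set 0]) < z -> -1 < z.
    by apply: le_lt_trans; rewrite lerDl fine_ge0.
  have pow (s : R) (ms : probability (measurableTypeR R) R) : on_nonneg ms -> ~ is_delta0 ms ->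
      (forall z, -1 < z < 0 -> Stransform ms z = expR (- (s * Rtransform c Sigma (z + 1)))) ->
      is_boxpow m s ms.
    move=> ms0 msd msS; split => // z /atom_ge z1 _ z0.
    by rewrite msS ?z1 // mS ?z1 // -expRM; congr expR; ring.
  have tilde : is_tilde_mu c Sigma m.
    split => // [s s0|z z01]; last by rewrite mS // mul1r.
    have [ms [ms0 msd msS]] := tilde_mu_pow f_neg f_adm (ltW s0).
    by exists ms; exact: pow.
  have [mud|mud] := pselect (is_delta0 mu).
    (* The product of the unit mass at 0 with any measure is that mass again, so mu serves as nu. *)
    by exists m, mt, mu; split => //; [exact: pow|split => //; left; split => //; left].
  have [nu [nu0 nud nuS]] := flow_limit f_neg f_adm t_ge0 p_deg p_pos mu_nonneg p_cvg mud.
  exists m, mt, nu; split => //; first exact: pow.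
  split => //; right; split => //; have h0 := htrans_gt0 mu_nonneg (@ltr01 R).
  (* Then z > - e means z + 1 > h_mu(1), so z + 1 is a value h_mu(x) with x > 1. *)
  exists (1 - htrans mu 1); first by rewrite subr_gt0 htrans_lt1.
  move=> z /andP[z1 z0].
  have [|| x x1 hx] := @htrans_surj R mu 1 (z + 1) mu_nonneg mud ltr01; [lra|lra|].
  have := nuS x (lt_trans ltr01 x1); rewrite hx addrK => ->.
  by rewrite mtS //; apply/andP; split => //; lra.
move=> m mt nu [m0 _ mS] [mt0 md mtd mtS] [nu0 [[[mud|//] nud]|[mud _ nud [e e0 nuS]]]].
  exact: (flow_weak_cvg_delta0 f_neg f_adm t_ge0 p_deg p_pos mu_nonneg p_cvg nu0 mud nud).
(* For u = h_mu(x) > a the point u - 1 lies in the range of both the product identity, which needs u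
   - 1 > - e, and the power identity, which needs u to exceed the two atoms at 0. No measure
   involved being the unit mass at 0, a < 1. *)
pose a := Num.max (1 - e) (Num.max (fine (m [set 0])) (fine (mt [set 0]))).
have a1 : a < 1 by rewrite !gt_max gtrBl e0 !atom_lt1.
have [x1 x10 ax1] := htrans_ex_gt mu a1.
apply: (flow_weak_cvg f_neg f_adm t_ge0 p_deg p_pos mu_nonneg p_cvg nu0 mud nud x10) => x x1x.
have x0 := lt_le_trans x10 x1x.
have u0 := htrans_gt0 mu_nonneg x0; have u1 := htrans_lt1 mu_nonneg mud x0.
have : a < htrans mu x by apply: lt_le_trans ax1 _; exact: htrans_le.
rewrite !gt_max => /and3P[ue um umt].
rewrite nuS; last by apply/andP; split; lra.
congr (_ * _); rewrite mtS; [|lra|lra|lra].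
rewrite mS; last by apply/andP; split; lra.
by rewrite -expRM subrK; congr expR; ring.
Qed.
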